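(* Let $q > 3$ be an odd prime power, let $V$ be a $4$-dimensional orthogonal space of $-$ type over $\mathbb{F}_q$, let $G = \mathrm{P}\Omega_4^-(q)$ acting on $V$, and fix a non-isotropic vector $v \in V$. Let $A$ be the set of all elements of $G$ with a $2$-dimensional eigenspace lying in $v^{\perp}$, that is, the set of all $g \in G$ for which there is a $2$-dimensional subspace $U \subseteq v^{\perp}$ on which $g$ acts as a scalar (the identity of $G$ is included). Then $A$ is a maximal coclique of $G$ and $|A| = q^3 + q$.
   Context: For a group $G$, a subset $A \subseteq G$ is a coclique if $\langle g, h\rangle \neq G$ for all $g, h \in A$. A coclique $A$ is maximal if, whenever $B \subseteq G$ is a coclique with $A \subseteq B$, one has $A = B$. An orthogonal space of $-$ type of dimension $4$ over $\mathbb{F}_q$ ($q$ odd) is a $4$-dimensional $\mathbb{F}_q$-space with a nondegenerate symmetric bilinear form $(\cdot,\cdot)$ of Witt index $1$. The group $\Omega_4^-(q) = \Omega(V)$ is the kernel of the spinor norm on $\mathrm{SO}(V)$ (the commutator subgroup of the orthogonal group $\mathrm{O}(V)$); since $q$ is odd, $-I_4 \notin \Omega_4^-(q)$, so $\mathrm{P}\Omega_4^-(q) = \Omega_4^-(q)$ acts linearly on $V$. A vector $v$ is non-isotropic if $(v,v) \neq 0$, and $v^\perp = \{w \in V : (v,w) = 0\}$. *)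

(* Defs.v *)
From mathcomp Require Import all_boot all_order all_fingroup all_algebra.

Set Implicit Arguments.
Unset Strict Implicit.
Unset Printing Implicit Defensive.

Import GRing.Theory.
Local Open Scope ring_scope.

Section Coclique.
Variables (gT : finGroupType) (G : {group gT}).

Definition coclique (A : {set gT}) : Prop :=
  A \subset G /\ {in A &, forall g h, <<[set g; h]>>%g <> G}.

Definition maximal_coclique (A : {set gT}) : Prop :=
  coclique A /\ forall C : {set gT}, coclique C -> A \subset C -> A = C.

End Coclique.

(* The orthogonal space is F^n.+1 (row vectors) with Gram matrix B, so that   *)
(* (u, v) = u *m B *m v^T; invertible matrices act on it on the right.        *)
Section OrthogonalSpace.
Variables (F : finFieldType) (n : nat) (B : 'M[F]_n.+1).

Local Notation "''[' u , v ]" := (form idfun B u v) : ring_scope.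
Local Notation GL := {'GL_n.+1[F]}.

(* Subspaces of F^n.+1 are the row spaces of square matrices. *)
Definition totally_isotropic (W : 'M[F]_n.+1) : bool :=
  (W <= orthomx idfun B W)%MS.

Definition witt_index : nat :=
  (\max_(W : 'M[F]_n.+1 | totally_isotropic W) \rank W)%N.

Definition orthogonal_group : {set GL} :=
  [set g : GL | [forall u : 'rV[F]_n.+1, forall v : 'rV[F]_n.+1,
                   '[u *m GLval g, v *m GLval g] == '[u, v]]].

Definition special_orthogonal_group : {set GL} :=
  [set g in orthogonal_group | \det (GLval g) == 1].

Definition is_reflection (a : 'rV[F]_n.+1) (g : GL) : bool :=
  ('[a, a] != 0) &&
  [forall x : 'rV[F]_n.+1,
     x *m GLval g == x - (2%:R * '[x, a] / '[a, a]) *: a].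

(* For B symmetric and nondegenerate and F of odd characteristic, every       *)
(* isometry g is a product of reflections in vectors a_1, ..., a_k, and its   *)
(* spinor norm is the class of \prod_i (a_i, a_i) modulo nonzero squares.     *)
(* spinor_graph is the set of all pairs (g, \prod_i (a_i, a_i)^(+/- 1)); the  *)
(* signs do not change the class modulo squares.                              *)
Definition spinor_graph : {set GL * {unit F}} :=
  <<[set x : GL * {unit F} |
       [exists a : 'rV[F]_n.+1,
          is_reflection a x.1 && (FinRing.uval x.2 == '[a, a])]]>>%g.

(* The kernel of the spinor norm on SO: since k is even there, normalising    *)
(* the spinor norm by (a, a) / 2 instead of (a, a) gives the same subgroup.   *)
Definition Omega : {set GL} :=
  [set g in special_orthogonal_group |
     [exists c : {unit F}, (g, c ^+ 2)%g \in spinor_graph]].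

Fact Omega_group_set : group_set Omega.
Proof.
have Oact (g : GL) : reflect (forall u v : 'rV_n.+1, '[u *m GLval g, v *m GLval g] = '[u, v])
                      (g \in orthogonal_group).
  rewrite inE; apply: (iffP forallP) => [h u v|h u].
    by move/forallP: (h u) => /(_ v)/eqP.
  by apply/forallP => v; rewrite h.
apply/group_setP; split=> [|g h].
  rewrite !inE det1 eqxx andbT; apply/andP; split.
    by apply/forallP=> u; apply/forallP=> v; rewrite !mulmx1.
  by apply/existsP; exists 1%g; rewrite expg1n group1.
rewrite inE [in X in _ -> X -> _]inE.
move=> /andP[/setIdP[/Oact Og /eqP dg] /existsP[c gc]].
move=> /andP[/setIdP[/Oact Oh /eqP dh] /existsP[d hd]].
rewrite inE; apply/andP; split.
  apply/setIdP; split; last by rewrite GL_MxE det_mulmx dg dh mulr1.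
  by apply/Oact=> u v; rewrite GL_MxE !mulmxA Oh Og.
apply/existsP; exists (c * d)%g; rewrite expgMn; last first.
  by apply: val_inj; rewrite /= mulrC.
exact: (groupM gc hd).
Qed.

Canonical Omega_group := Group Omega_group_set.

(* The elements of Omega acting as a scalar on some 2-dimensional subspace U  *)
(* of the orthogonal complement of v.                                         *)
Definition perp_eigenplane_set (v : 'rV[F]_n.+1) : {set GL} :=
  [set g in Omega |
     [exists U : 'M[F]_n.+1,
        [&& \rank U == 2%N, (U <= orthomx idfun B v)%MS
          & [exists l : F, U *m GLval g == l *: U]]]].

End OrthogonalSpace.

(* Main.v *)
From HB Require Import structures.
From mathcomp Require Import all_boot all_order all_fingroup all_algebra all_solvable
  all_field.
From mathcomp Require Import ring zify.
Require Import Defs.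
Set Implicit Arguments.
Unset Strict Implicit.
Unset Printing Implicit Defensive.
Import GRing.Theory.
Local Open Scope ring_scope.

(** Let L = F + F eps be the quadratic extension of F, with eps^2 = d a
    nonsquare, and let cj be its conjugation. Up to a factor ka of the form, V
    is the F-space of the 2x2 matrices X over L with cj X = adj X, that is
    X = a + eps M with a in F and M traceless over F; the quadratic form is the
    determinant and v is the identity matrix ([normal_form]). A matrix g in
    SL(2,L) acts by X |-> g^-1 X cj(g), and the reflection in A is
    X |-> - A cj(X) adj(cj A) / det A. Hence a product of reflections is carried
    by a matrix m whose determinant is the spinor norm up to squares and up to
    powers of ka, and elementary matrices are products of two reflections of
    equal norm; so Omega is the image of SL(2,L), with kernel {1, -1}
    ([Omega_rho], [rho_eq]).

    An element g acts on a plane of v^perp as a scalar l exactly when l = 1 or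
    l = -1 and cj(g) = l g^-1 ([planeE]); call such a g twisted. For each sign
    the twisted matrices are the solutions of a norm equation
    N(a) = k + k' x y, and N takes each nonzero value q + 1 times, which gives
    q^3 + q matrices for each sign, and the cardinality after division by the
    kernel ([card_plane]). Two planes of the 3-space v^perp share a line, while
    Omega fixes no line, so the set is a coclique ([plane_coclique]).

    For maximality, each g in SL(2,L) which is not twisted generates SL(2,L)
    together with a twisted transvection h ([generation]). After conjugation by
    a matrix over F, take h = [1, t eps; 0, 1] with t in F. If c is the lower
    left entry of g, the subfield of L attached to the transvections of <g, h>
    contains (t eps c)^2 and t eps c tr(g). When q > 3 and g is not twisted, the
    conjugation and t can be chosen so that one of these two elements lies in no
    proper subfield, by counting.

    What makes this work is a theorem of Dickson ([two_transvections]): if a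
    subgroup K of SL(2,L) contains an upper and a lower transvection, then, apart
    from a group of order 60 modulo the centre in characteristic 3, the
    parameters of its upper transvections form a multiple of a subfield.
    Commutation is transitive on noncentral elements, so K is partitioned by the
    conjugates of its centralizers, and the resulting class equation leaves only
    r + 1 for the number of centres of transvections of K, where r is the order
    of the group T of upper ones. Then both T and the set of inverses of its
    elements are closed under addition, and this makes a multiple of T a field. *)

(** * Two-by-two matrices and the group SL(2,L) *)

(** A record rather than a function on ordinals, so that entries of products
    compute and [ring] treats the entries as atoms. *)
Record m2 (R : Type) := Mk2 { e11 : R; e12 : R; e21 : R; e22 : R }.

Definition m2_prod R (x : m2 R) := ((e11 x, e12 x), (e21 x, e22 x)).
Definition prod_m2 R (x : (R * R) * (R * R)) :=
  Mk2 x.1.1 x.1.2 x.2.1 x.2.2.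
Lemma m2_prodK R : cancel (@m2_prod R) (@prod_m2 R). Proof. by case. Qed.

HB.instance Definition _ (R : eqType) :=
  Equality.copy (m2 R) (can_type (@m2_prodK R)).
HB.instance Definition _ (R : choiceType) :=
  Choice.copy (m2 R) (can_type (@m2_prodK R)).
HB.instance Definition _ (R : countType) :=
  Countable.copy (m2 R) (can_type (@m2_prodK R)).
HB.instance Definition _ (R : finType) :=
  Finite.copy (m2 R) (can_type (@m2_prodK R)).

(** Leaves to [ring] an identity that differs from a known one by a
    polynomial identity. *)
Lemma eq_by_sub (R : pzRingType) (c d a b : R) : c = d -> a - b = c - d -> a = b.
Proof. by move=> -> /eqP; rewrite subrr subr_eq0 => /eqP. Qed.

Section Mat2.
Variable R : comNzRingType.
Implicit Types x y : m2 R.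

Definition det2 x := e11 x * e22 x - e12 x * e21 x.
Definition tr2 x := e11 x + e22 x.
Definition mul2 x y :=
  Mk2 (e11 x * e11 y + e12 x * e21 y) (e11 x * e12 y + e12 x * e22 y)
      (e21 x * e11 y + e22 x * e21 y) (e21 x * e12 y + e22 x * e22 y).
Definition adj2 x := Mk2 (e22 x) (- e12 x) (- e21 x) (e11 x).
Definition one2 : m2 R := Mk2 1 0 0 1.

Lemma det2M x y : det2 (mul2 x y) = det2 x * det2 y.
Proof. by rewrite /det2 /=; ring. Qed.

End Mat2.

Section SL2.
Variable L : finFieldType.

Record sl2 := SL2 { sl2val :> m2 L; _ : det2 sl2val == 1 }.
HB.instance Definition _ := [isSub for sl2val].
HB.instance Definition _ := [Finite of sl2 by <:].

Lemma sl2_det (x : sl2) : e11 x * e22 x - e12 x * e21 x = 1.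
Proof. by case: x => x /= /eqP. Qed.

Lemma sl2_ext (x y : sl2) : e11 x = e11 y -> e12 x = e12 y ->
  e21 x = e21 y -> e22 x = e22 y -> x = y.
Proof.
by case: x y => [[a b c d] p] [[a' b' c' d'] p'] /= h1 h2 h3 h4; apply: val_inj => /=;
  rewrite h1 h2 h3 h4.
Qed.

Fact sl2_mul_subproof (x y : sl2) : det2 (mul2 x y) == 1.
Proof. by rewrite det2M /det2 !sl2_det mulr1. Qed.
Fact sl2_inv_subproof (x : sl2) : det2 (adj2 x) == 1.
Proof. by apply/eqP; rewrite -[RHS](sl2_det x) /det2 /=; ring. Qed.
Fact sl2_one_subproof : det2 (one2 L) == 1.
Proof. by rewrite /det2 /=; apply/eqP; ring. Qed.

Definition sl2_mul x y := SL2 (sl2_mul_subproof x y).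
Definition sl2_inv x := SL2 (sl2_inv_subproof x).
Definition sl2_one := SL2 sl2_one_subproof.

Fact sl2_mulA : associative sl2_mul.
Proof. by move=> x y z; apply: sl2_ext => /=; ring. Qed.
Fact sl2_mul1 : left_id sl2_one sl2_mul.
Proof. by move=> x; apply: sl2_ext => /=; ring. Qed.
Fact sl2_mulV : left_inverse sl2_one sl2_inv sl2_mul.
Proof.
by move=> x; apply: sl2_ext => /=; rewrite -?[1](sl2_det x); ring.
Qed.

HB.instance Definition _ :=
  Finite_isGroup.Build sl2 sl2_mulA sl2_mul1 sl2_mulV.

Lemma mulE (x y : sl2) : (x * y)%g = mul2 x y :> m2 L. Proof. by []. Qed.
Lemma invE (x : sl2) : (x^-1)%g = adj2 x :> m2 L. Proof. by []. Qed.
Lemma oneE : (1%g : sl2) = one2 L :> m2 L. Proof. by []. Qed.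
Lemma conjE (x y : sl2) : (x ^ y)%g = mul2 (adj2 y) (mul2 x y) :> m2 L.
Proof. by []. Qed.

Definition sl2E := (mulE, invE, oneE, conjE).

Fact sl2_neg_subproof : det2 (Mk2 (-1) 0 0 (-1) : m2 L) == 1.
Proof. by rewrite /det2 /=; apply/eqP; ring. Qed.
Definition sl2N1 : sl2 := SL2 sl2_neg_subproof.

Definition pm1 : {set sl2} := [set 1%g; sl2N1].

Lemma pm1P (x : sl2) :
  reflect (e12 x = 0 /\ e21 x = 0 /\ e11 x = e22 x) (x \in pm1).
Proof.
rewrite !inE; apply: (iffP orP) => [[]/eqP -> //|[h1 [h2 h3]]].
have := sl2_det x; rewrite h1 h2 h3 mul0r subr0 -expr2 => /eqP.
rewrite sqrf_eq1 => /orP[]/eqP h4; [left|right]; apply/eqP;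
  by apply: sl2_ext; rewrite ?h1 ?h2 ?h3 ?h4.
Qed.

Lemma pm1_central (x y : sl2) : x \in pm1 -> commute x y.
Proof.
by case/pm1P=> [h1 [h2 h3]]; apply: sl2_ext; rewrite !sl2E /= ?h1 ?h2 ?h3; ring.
Qed.

Lemma commuteP (x y : sl2) :
  commute x y <-> [/\ e12 x * e21 y = e21 x * e12 y,
                      e12 x * (e11 y - e22 y) = (e11 x - e22 x) * e12 y
                    & e21 x * (e11 y - e22 y) = (e11 x - e22 x) * e21 y].
Proof.
split=> [h|[h1 h2 h3]].
  have /(congr1 (fun z : sl2 => e11 z)) := h; rewrite !sl2E /= => h1.
  have /(congr1 (fun z : sl2 => e12 z)) := h; rewrite !sl2E /= => h2.
  have /(congr1 (fun z : sl2 => e21 z)) := h; rewrite !sl2E /= => h3.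
  split; [apply: (eq_by_sub h1) | apply: (eq_by_sub (esym h2))
         | apply: (eq_by_sub h3)]; ring.
by apply: sl2_ext; rewrite !sl2E /=; [apply: (eq_by_sub h1)
   | apply: (eq_by_sub (esym h2)) | apply: (eq_by_sub h3)
   | apply: (eq_by_sub (esym h1))]; ring.
Qed.

(** Commuting with x means having a traceless part proportional to that of x. *)
Lemma commute_proportional (x y : sl2) : x \notin pm1 -> commute x y ->
  exists2 l, e12 y = l * e12 x & e21 y = l * e21 x /\
             e11 y = e22 y + l * (e11 x - e22 x).
Proof.
move=> xZ /commuteP[h1 h2 h3].
suff [l [k1 k2 k3]] : exists l, [/\ e12 y = l * e12 x, e21 y = l * e21 x
            & e11 y - e22 y = l * (e11 x - e22 x)].
  by exists l => //; split=> //; rewrite -k3; ring.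
have [b0|b0] := eqVneq (e12 x) 0; last first.
  exists (e12 y / e12 x); split; apply: (mulfI b0); rewrite ?h1 ?h2; field => //.
have [c0|c0] := eqVneq (e21 x) 0; last first.
  exists (e21 y / e21 x); split; apply: (mulfI c0); rewrite -?h1 ?h3; field => //.
have [d0|d0] := eqVneq (e11 x - e22 x) 0.
  by case/pm1P: xZ; split=> //; split=> //; apply/eqP; rewrite -subr_eq0 d0.
exists ((e11 y - e22 y) / (e11 x - e22 x)).
by split; apply: (mulfI d0); rewrite -?h2 -?h3; field.
Qed.

(** Proportionality of traceless parts is transitive. So centralizers of
    noncentral elements are abelian and meet only in the centre. *)
Lemma comm_trans (x y z : sl2) : x \notin pm1 ->
  commute x y -> commute x z -> commute y z.
Proof.
move=> xZ /(commute_proportional xZ)[l h1 [h2 h3]] /(commute_proportional xZ)[k h4 [h5 h6]].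
by apply/commuteP; rewrite h1 h2 h3 h4 h5 h6; split; ring.
Qed.

Definition upper_sub (t : L) : det2 (Mk2 1 t 0 1) == 1.
Proof. by rewrite /det2 /=; apply/eqP; ring. Qed.
Definition upper t : sl2 := SL2 (upper_sub t).
Definition lower_sub (t : L) : det2 (Mk2 1 0 t 1) == 1.
Proof. by rewrite /det2 /=; apply/eqP; ring. Qed.
Definition lower t : sl2 := SL2 (lower_sub t).

Lemma upperD s t : upper (s + t) = (upper s * upper t)%g.
Proof. by apply: sl2_ext; rewrite !sl2E /=; ring. Qed.
Lemma upper0 : upper 0 = 1%g.
Proof. exact: sl2_ext. Qed.
Lemma upperV s : upper (- s) = (upper s)^-1%g.
Proof. by apply: sl2_ext; rewrite !sl2E /=; ring. Qed.
Lemma upperX s n : upper (s *+ n) = (upper s ^+ n)%g.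
Proof. by elim: n => [|n IH]; rewrite ?upper0 // mulrS expgS upperD IH. Qed.
Lemma upper_inj : injective upper.
Proof. by move=> s t /(congr1 (fun x : sl2 => e12 x)). Qed.
Lemma lowerD s t : lower (s + t) = (lower s * lower t)%g.
Proof. by apply: sl2_ext; rewrite !sl2E /=; ring. Qed.
Lemma lower0 : lower 0 = 1%g.
Proof. exact: sl2_ext. Qed.
Lemma lowerX s n : lower (s *+ n) = (lower s ^+ n)%g.
Proof. by elim: n => [|n IH]; rewrite ?lower0 // mulrS expgS lowerD IH. Qed.

Lemma tr2J (x y : sl2) : tr2 (x ^ y)%g = tr2 x.
Proof. by rewrite /tr2 conjE /= -[RHS]mul1r -(sl2_det y); ring. Qed.

Lemma tr2_disc (x : sl2) :
  tr2 x ^+ 2 - 4%:R = (e11 x - e22 x) ^+ 2 + 4%:R * e12 x * e21 x.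
Proof.
have h := congr1 ( *%R 4%:R) (sl2_det x).
by apply: (eq_by_sub h); rewrite /tr2; ring.
Qed.

Hypothesis two_neq0 : 2%:R != 0 :> L.

(** The elements commuting with x are the combinations of 1 and x; the trace
    and the determinant leave two of them when the discriminant is not 0. *)
Lemma commute_tr (x y : sl2) : tr2 x ^+ 2 != 4%:R ->
  commute x y -> tr2 y = tr2 x -> y = x \/ y = (x^-1)%g.
Proof.
move=> tx cxy ty.
have xZ : x \notin pm1.
  apply: contra tx => /pm1P[h1 [h2 h3]].
  by rewrite -subr_eq0 tr2_disc h1 h3; apply/eqP; ring.
have [l h1 [h2 h3]] := commute_proportional xZ cxy.
have d0 : (e11 x - e22 x) ^+ 2 + 4%:R * e12 x * e21 x != 0.
  by rewrite -tr2_disc subr_eq0.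
have : l ^+ 2 == 1.
  apply/eqP; apply: (mulIf d0); rewrite mul1r -[RHS]tr2_disc -ty tr2_disc h1 h2 h3.
  by ring.
have k : 2%:R * e22 y = (e11 x + e22 x) - l * (e11 x - e22 x).
  by rewrite -[e11 x + e22 x]/(tr2 x) -ty /tr2 h3; ring.
rewrite sqrf_eq1 => /orP[]/eqP l1; rewrite l1 in h1 h2 h3 k; [left|right].
  have e : e22 y = e22 x by apply: (mulfI two_neq0); rewrite k; ring.
  by apply: sl2_ext; rewrite ?h1 ?h2 ?h3 ?e //; ring.
have e : e22 y = e11 x by apply: (mulfI two_neq0); rewrite k; ring.
by apply: sl2_ext; rewrite ?sl2E /= ?h1 ?h2 ?h3 ?e //; ring.
Qed.

Lemma sl2N1_neq1 : sl2N1 != 1%g.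
Proof.
apply/negP => /eqP/(congr1 (fun x : sl2 => e11 x))/= /eqP.
by rewrite -subr_eq0 -opprD oppr_eq0 (negPf two_neq0).
Qed.

Lemma card_pm1 : #|pm1| = 2%N.
Proof. by rewrite cards2 eq_sym sl2N1_neq1. Qed.

Lemma pm1_group_set : group_set pm1.
Proof.
apply/group_setP; split=> [|x y]; first by rewrite !inE eqxx.
by case/pm1P=> [h1 [h2 h3]] /pm1P[k1 [k2 k3]]; apply/pm1P; rewrite mulE /= h1 h2 h3 k1 k2
  k3; split; [|split]; ring.
Qed.
Canonical pm1_group := Group pm1_group_set.

(** The conjugating matrix moves an eigenvector to the first basis vector. *)
Lemma unipotent_conj (x : sl2) : tr2 x = 2%:R -> exists t y, x = (upper t ^ y)%g.
Proof.
move=> tx; have e2 : e22 x = 2%:R - e11 x by rewrite -tx /tr2; ring.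
have := sl2_det x; rewrite e2 => dx.
have [c0|c0] := eqVneq (e21 x) 0.
  exists (e12 x), 1%g; rewrite conjg1.
  have : (e11 x - 1) ^+ 2 == 0.
    rewrite c0 in dx; apply/eqP; apply: (eq_by_sub (esym dx)); ring.
  rewrite sqrf_eq0 subr_eq0 => /eqP e1.
  by apply: sl2_ext => //=; rewrite ?e2 e1 //; ring.
have yP : det2 (Mk2 0 (e21 x)^-1 (- e21 x) (e11 x - 1) : m2 L) == 1.
  by rewrite /det2 /=; apply/eqP; field.
exists (- (e21 x)^-1), (SL2 yP).
apply: sl2_ext; rewrite conjE /= ?e2.
- by field.
- apply: (mulIf c0). apply: (eq_by_sub (esym dx)); field => //.
- by field.
by field.
Qed.

End SL2.

(** * Centralizers in a subgroup of SL(2,L) *)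

Section Classes.
Variables (L : finFieldType) (K : {group sl2 L}).
Hypothesis two_neq0 : 2%:R != 0 :> L.
Hypothesis K_pm1 : pm1 L \subset K.

Local Notation cent x := ('C_K[x])%g.
Local Notation Z := (pm1 L).

(** As commutation is transitive on noncentral elements, these sets partition
    the noncentral elements of K. *)
Definition cent_class x := class_support (cent x :\: Z) K.

Lemma in_cent x y : (y \in cent x) = (y \in K) && (y * x == x * y)%g.
Proof. by rewrite inE; congr andb; apply/cent1P/eqP. Qed.

Lemma cent_sub_cent x y : x \notin Z -> commute x y -> cent x \subset cent y.
Proof.
move=> xZ cxy; apply/subsetP => z; rewrite !in_cent => /andP[-> /eqP cxz] /=.
by apply/eqP; apply/esym; apply: (comm_trans xZ) => //; apply/esym.
Qed.

Lemma cent_eq x y : x \notin Z -> y \notin Z -> commute x y -> cent x = cent y.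
Proof.
move=> xZ yZ cxy; apply/eqP; rewrite eqEsubset !cent_sub_cent //.
Qed.

Lemma pm1_cent x : Z \subset cent x.
Proof.
apply/subsetP => z zZ; rewrite in_cent (subsetP K_pm1) //=.
by rewrite (pm1_central x zZ).
Qed.

Lemma cent_id x : x \in K -> x \in cent x.
Proof. by move=> xK; rewrite in_cent xK /=. Qed.

Lemma pm1J (k : sl2 L) : (Z :^ k)%g = Z.
Proof.
apply/setP => z; rewrite mem_conjg; apply/idP/idP => h.
  by rewrite -[z](conjgKV k) conjgE; have -> := pm1_central k h; rewrite mulKg.
by rewrite conjgE; have -> := pm1_central (k^-1)%g h; rewrite mulKg.
Qed.

Lemma centJ x k : k \in K -> cent (x ^ k)%g = (cent x :^ k)%g.
Proof. by move=> kK; rewrite conjIg cent1J (conjGid kK). Qed.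

Lemma cent_class_id x : x \in K -> x \notin Z -> x \in cent_class x.
Proof. by move=> xK xZ; apply: mem_class_support; rewrite inE xZ cent_id. Qed.

Lemma cent_classP y x : y \in cent_class x ->
  exists a k, [/\ a \in cent x, a \notin Z, k \in K & y = (a ^ k)%g].
Proof. by case/imset2P => a k /setDP[h1 h2] h3 ->; exists a, k. Qed.

Lemma cent_class_centJ x y : x \notin Z -> y \in cent_class x ->
  exists2 k, k \in K & cent y = (cent x :^ k)%g.
Proof.
move=> xZ /cent_classP[a [k [aC aZ kK ->]]]; exists k; rewrite ?centJ //; congr (_ :^ _)%g.
apply: cent_eq => //.
by move: aC; rewrite in_cent => /andP[_ /eqP].
Qed.

Lemma cent_class_eq x y : x \notin Z -> y \in cent_class x -> cent_class y = cent_class x.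
Proof.
move=> xZ yx; have [k kK e] := cent_class_centJ xZ yx.
by rewrite /cent_class e -{1}(pm1J k) -conjDg class_supportGidl.
Qed.

Lemma cent_class_sub x : cent_class x \subset K :\: Z.
Proof.
apply/subsetP => y /cent_classP[a [k [aC aZ kK ->]]].
rewrite inE -mem_conjgV pm1J aZ groupJ //.
by move: aC; rewrite in_cent => /andP[].
Qed.

(** Two conjugates of a centralizer with a common noncentral element are equal. *)
Lemma support_normedTI x : x \in K -> x \notin Z ->
  normedTI (cent x :\: Z) K 'N_K(cent x).
Proof.
move=> xK xZ; apply/normedTI_memJ_P; split.
- by apply/set0Pn; exists x; rewrite inE xZ cent_id.
- exact: subsetIl.
move=> a k /setDP[]; rewrite in_cent => /andP[aK /eqP cax] aZ kK.
have e : cent a = cent x by apply: cent_eq.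
rewrite inE -mem_conjgV pm1J aZ /= [in RHS]inE kK /=.
apply/idP/normP => h.
  rewrite -e -centJ //; apply: cent_eq => //; first by rewrite -mem_conjgV pm1J.
  by apply: (comm_trans xZ) => //; apply/esym/eqP; move: h; rewrite in_cent=> /andP[].
rewrite -h memJ_conjg in_cent aK cax eqxx //.
Qed.

Lemma card_cent_class x : x \in K -> x \notin Z ->
  #|cent_class x| = ((#|cent x| - 2) * #|K : 'N_K(cent x)|%g)%N.
Proof.
move=> xK xZ; rewrite (card_support_normedTI (support_normedTI xK xZ)).
by rewrite cardsD (setIidPr (pm1_cent x)) card_pm1.
Qed.

Lemma even_cent x : exists2 c, #|cent x| = (2 * c)%N & (0 < c)%N.
Proof.
have /dvdnP[c e] : (2 %| #|cent x|)%N.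
  by rewrite -(card_pm1 two_neq0); apply: cardSg (pm1_cent x).
by exists c; rewrite ?e 1?mulnC //; have := cardG_gt0 (cent x)%G; rewrite /= e; case: c {e}.
Qed.

Lemma even_cent2 x : x \in K -> x \notin Z ->
  exists2 c, #|cent x| = (2 * c)%N & (1 < c)%N.
Proof.
move=> xK xZ; have [c e c0] := even_cent x; exists c => //.
have : (#|x |: Z| <= #|cent x|)%N.
  by apply: subset_leq_card; rewrite subUset sub1set cent_id // pm1_cent.
rewrite cardsU1 xZ card_pm1 // e; lia.
Qed.

(** Here s is the index of the centralizer in its normalizer. It is at most 2
    because a conjugate of x commuting with x is x or its inverse. *)
Lemma semisimple_index x : x \in K -> tr2 x ^+ 2 != 4%:R ->
  exists c s m, [/\ #|cent x| = (2 * c)%N, #|K| = (2 * c * s * m)%N,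
     #|cent_class x| = (2 * (c - 1) * m)%N, (1 < c)%N & (0 < s <= 2)%N].
Proof.
move=> xK tx.
have xZ : x \notin Z.
  apply: contra tx => /pm1P[h1 [h2 h3]].
  by rewrite -subr_eq0 tr2_disc h1 h3; apply/eqP; ring.
have [c ec c1] := even_cent2 xK xZ.
have sN : (cent x \subset 'N_K(cent x))%g by rewrite subsetI subsetIl normG.
have eC : ('C_('N_K(cent x))[x] = cent x)%g.
  by apply/eqP; rewrite eqEsubset setSI ?subsetIl //= subsetI sN subsetIr.
exists c, #|'N_K(cent x) : cent x|%g, #|K : 'N_K(cent x)|%g; split => //.
- rewrite -ec -mulnA -(Lagrange (subsetIl K 'N(cent x)))%g -{1}(Lagrange sN).
  by rewrite mulnA.
- by rewrite card_cent_class // ec; set m := #|_ : _|%g; nia.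
rewrite indexg_gt0 /= -{2}eC index_cent1.
apply: leq_trans (_ : #|[set x; x^-1%g]| <= _)%N; last by rewrite cards2; case: eqP.
apply: subset_leq_card; apply/subsetP => y /imsetP[k kN ->].
have : (x ^ k)%g \in cent x.
  by move: kN; rewrite inE => /andP[_ /normP e]; rewrite -e memJ_conjg cent_id.
rewrite in_cent => /andP[_ /eqP h].
by have [->|->] := commute_tr two_neq0 tx (esym h) (tr2J _ _); rewrite !inE eqxx ?orbT.
Qed.

End Classes.

Local Close Scope ring_scope.

(** * Arithmetic of the class equation *)

(** In this part r counts the upper transvections of K and the trivial one, n is
    the number of centres of transvections, and |K| = 2 r e n. A centralizer of
    order 2 c, of index s in its normalizer, gives rise to 2 (c - 1) m noncentral
    elements, where |K| = 2 c s m. This first case is e = 1, where 2 (n - 1)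
    semisimple elements are left over. *)
Lemma count_no_torus r n c s m : 2 < r -> odd r -> 1 < n -> c * s * m = r * n ->
  (c - 1) * m <= n - 1 -> 1 < c -> 0 < s <= 2 ->
  r = 3 /\ 4 * m = 3 * n /\ c = 2.
Proof.
move=> r2 ro n1 e1 h c1 s2.
have h1 : c * m <= 2 * ((c - 1) * m) by nia.
have h2 : c * s * m <= 2 * (c * m) by nia.
have r3 : r = 3.
  have : r < 4 by nia.
  by move: r2; lia.
split => //. subst r.
have [s1|s1] : s = 1 \/ s = 2 by lia.
  subst s; nia.
subst s.
have h3 : n + 2 <= 2 * m by nia.
have c2 : c = 2 by nia.
subst c; split=> //; nia.
Qed.

(** If the torus of order 2 e has index 1 in its normalizer, only 2 (n - 1)
    semisimple elements are left, too few for another class. *)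
Lemma count_unswapped_torus r e n c s m : 2 < r -> 1 < e -> 1 < n ->
  c * s * m = r * e * n ->
  (c - 1) * m <= n - 1 -> 1 < c -> 0 < s <= 2 -> False.
Proof.
move=> r2 e1 n1 e2 h c1 s2.
have h1 : c * m <= 2 * ((c - 1) * m) by nia.
have h2 : c * s * m <= 2 * (c * m) by nia.
have h3 : 6 <= r * e by nia.
nia.
Qed.

(** A class of semisimple elements has at least |K| / 4 elements. *)
Lemma class_at_least_quarter r e n c s m : c * s * m = r * e * n ->
  1 < c -> 0 < s <= 2 -> r * e * n <= 2 * (2 * (c - 1) * m).
Proof.
move=> e2 c1 s2.
have h1 : c * m <= 2 * ((c - 1) * m) by nia.
have h2 : c * s * m <= 2 * (c * m) by nia.
lia.
Qed.

Lemma count_second_torus r e n c s m : 2 < r -> 1 < e -> 1 < n -> c * s * m = r * e * n ->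
  2 * (c - 1) * m <= r * e * n + 2 * n - 2 - r * n ->
  1 < c -> 0 < s <= 2 -> s = 2.
Proof.
move=> r2 e1 n1 e2 h c1 s2.
have [s1|//] : s = 1 \/ s = 2 by lia.
subst s.
have h1 : c * m <= 2 * ((c - 1) * m) by nia.
have h3 : 3 * n <= r * n by nia.
have h4 : r * n <= r * e * n by nia.
exfalso; nia.
Qed.

(** With k = c - e the hypotheses become k (1 + d (r - 2)) = 2 d e. As d is
    prime to 1 + d (r - 2), it divides k, and then e < r bounds d. *)
Lemma count_borel_index r e n c m d : 2 < r -> odd r -> 1 < e -> e < r -> 1 < n ->
  n = d * r + 1 -> 2 * c * m = r * e * n ->
  2 * (c - 1) * m = r * e * n + 2 * n - 2 - r * n -> 1 < c ->
  n = r + 1 \/ [/\ r = 3, e = 2, n = 10 & c = 5].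
Proof.
move=> r2 ro e1 er n1 en e2 h c1.
have d0 : 0 < d by case: d en => [|//]; lia.
have hm : 2 * m + 2 * n = r * n + 2.
  have h3 : 3 * n <= r * n by rewrite leq_mul2r r2 orbT.
  have h4 : r * n <= r * e * n by rewrite leq_mul2r leq_pmulr ?orbT // ltnW.
  have h5 : 2 * (c - 1) * m + 2 * m = 2 * c * m.
    by clear -c1; nia.
  lia.
have er2 : r = (r - 2) + 2 by lia.
have hm2 : 2 * m = r * (1 + d * (r - 2)).
  by move: hm; rewrite en; set q := r - 2 in er2 *; rewrite er2; clear; nia.
have hc : c * (1 + d * (r - 2)) = e * n.
  have : r * (c * (1 + d * (r - 2))) = r * (e * n).
    by rewrite mulnCA -hm2; lia.
  move/eqP; rewrite eqn_pmul2l; last by lia. by move/eqP.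
have q0 : 0 < 1 + d * (r - 2) by [].
have nq : n = 1 + d * (r - 2) + 2 * d.
  by rewrite en; set q := r - 2 in er2 *; rewrite er2; clear; lia.
have ce : e <= c by rewrite -(leq_pmul2r q0) hc nq leq_mul2l leq_addr orbT.
pose k := c - e.
have hk : k * (1 + d * (r - 2)) = 2 * d * e.
  by rewrite mulnBl hc {1}nq mulnDr addKn; clear; lia.
(* 1 + d (r - 2) is prime to d *)
have dk : d %| k.
  have : d %| k * (1 + d * (r - 2)) by rewrite hk mulnC mulnA dvdn_mull.
  rewrite Gauss_dvdl //.
  by rewrite /coprime addnC mulnC gcdnMDl gcdn1.
have [k' ek] := dvdnP dk.
have hk' : k' * (1 + d * (r - 2)) = 2 * e.
  have : d * (k' * (1 + d * (r - 2))) = d * (2 * e).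
    by move: hk; rewrite ek => hk; clear -hk; lia.
  by move/eqP; rewrite eqn_pmul2l // => /eqP.
have [d1|d1] : d = 1 \/ 2 <= d by lia.
  left; subst d; lia.
right.
have q2 : 2 * (r - 2) <= d * (r - 2) by rewrite leq_mul2r d1 orbT.
(* k' >= 2 would give 2 e >= 4 r - 6 > 2 (r - 1) *)
have k1 : k' = 1.
  case: k' hk' {ek} => [|[|k']] // hk'; first by clear -hk' e1; lia.
  have : 2 * (1 + d * (r - 2)) <= 2 * e by rewrite -hk' leq_mul2r orbT.
  clear -q2 er r2; lia.
rewrite k1 mul1n in hk'.
have [d2|d3] : d = 2 \/ 3 <= d by lia.
  exfalso; move: hk'; rewrite d2; move: ro; clear; lia.
have q3 : 3 * (r - 2) <= d * (r - 2) by rewrite leq_mul2r d3 orbT.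
have r3 : r = 3 by clear -q3 hk' er r2; lia.
have d3' : d = 3.
  by move: hk' er d3; rewrite r3 subSS subn1 muln1; clear; lia.
have n10 : n = 10 by rewrite en d3' r3.
have e2' : e = 2 by move: hk'; rewrite d3' r3; clear; lia.
split=> //; move: hc; rewrite d3' r3 n10 e2'; clear; lia.
Qed.

Local Open Scope ring_scope.

(** * Subgroups with an upper and a lower transvection *)

Definition is_subfield (L : finFieldType) (E : {set L}) : Prop :=
  [/\ 1 \in E, {in E &, forall x y, x - y \in E},
      {in E &, forall x y, x * y \in E} & {in E, forall x, x^-1 \in E}].

Section Dickson.
Variables (L : finFieldType) (K : {group sl2 L}) (p : nat).
Hypotheses (pL : p \in [pchar L]) (p_odd : odd p).
Hypothesis K_pm1 : pm1 L \subset K.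
Variables (b0 c0 : L).
Hypotheses (b0_neq0 : b0 != 0) (c0_neq0 : c0 != 0).
Hypotheses (b0K : upper b0 \in K) (c0K : lower c0 \in K).

Local Notation cent x := ('C_K[x])%g.
Local Notation Z := (pm1 L).

Lemma p_prime : prime p. Proof. exact: pcharf_prime pL. Qed.

Lemma two_neq0 : 2%:R != 0 :> L.
Proof.
rewrite -(dvdn_pcharf pL); apply: contraL p_odd => /(@dvdn_leq p 2 isT).
by have := p_prime; move: p => [|[|[|]]].
Qed.

Definition transl := [set t | upper t \in K].
Definition unip : {set sl2 L} := [set x in K | (e21 x == 0) && (e11 x == 1)].

Lemma unipP x : reflect (exists2 t, t \in transl & x = upper t) (x \in unip).
Proof.
apply: (iffP idP) => [|[t]]; rewrite !inE.
  case/and3P=> xK /eqP h1 /eqP h2; have := sl2_det x.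
  rewrite h1 h2 mul1r mulr0 subr0 => h3.
  have e : x = upper (e12 x) by apply: sl2_ext.
  by exists (e12 x); rewrite // inE -e.
by move=> tK ->; rewrite tK /= !eqxx.
Qed.

Lemma unip_group_set : group_set unip.
Proof.
apply/group_setP; split=> [|x y]; first by rewrite inE group1 /= !eqxx.
rewrite !inE ?mulE /= => /and3P[xK /eqP-> /eqP->] /and3P[yK /eqP-> /eqP->].
by rewrite groupM //= !mul0r !mulr0 mulr1 !addr0 !eqxx.
Qed.
Canonical unip_group : {group sl2 L} := @Group (sl2 L) unip unip_group_set.

Lemma card_unip : #|unip| = #|transl|.
Proof.
rewrite -(card_imset _ (@upper_inj L)); apply: eq_card => x.
by apply/unipP/imsetP => -[t h ->]; exists t.
Qed.

Lemma upper_p (t : L) : (upper t ^+ p)%g = 1%g.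
Proof. by rewrite -upperX mulrn_pchar // upper0. Qed.

Lemma unip_pgroup : (p.-group unip)%g.
Proof.
apply/pgroupP => l l_pr /(Cauchy l_pr)[x /unipP[t _ ->] ox].
have : (#[upper t]%g %| p)%N by rewrite order_dvdn upper_p.
by rewrite ox dvdn_prime2 // ?p_prime //= => /eqP->; rewrite inE.
Qed.

Local Notation u := (upper b0).
Local Notation C0 := (cent u).
Local Notation P := unip_group.

Lemma upper_notin_pm1 t : t != 0 -> upper t \notin Z.
Proof. by move=> t0; apply/pm1P => -[/= e]; rewrite e eqxx in t0. Qed.

Lemma u_unip : u \in unip.
Proof. by apply/unipP; exists b0; rewrite ?inE. Qed.

Lemma in_cent_unip (x : sl2 L) : (x \in C0) = [&& x \in K, e21 x == 0 & e11 x == e22 x].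
Proof.
rewrite in_cent; congr andb; apply/eqP/andP => [/esym/commuteP[/= h1 h2 h3]|[/eqP h1 /eqP
  h2]].
  split; apply/eqP; first by apply: (mulfI b0_neq0); rewrite h1; ring.
  by apply/eqP; rewrite -subr_eq0; apply/eqP; apply: (mulfI b0_neq0); rewrite h2; ring.
by apply/esym/commuteP; rewrite /= h1 h2; split; ring.
Qed.

Lemma sl2N1_K : sl2N1 L \in K.
Proof. by rewrite (subsetP K_pm1) // !inE eqxx orbT. Qed.

Lemma card_cent_unip : #|C0| = (2 * #|unip|)%N.
Proof.
have -> : C0 = unip :|: [set (sl2N1 L * x)%g | x in unip].
  apply/setP => x; rewrite in_cent_unip inE; apply/idP/orP.
    case/and3P=> xK h1 /eqP h2; have := sl2_det x.
    rewrite (eqP h1) mulr0 subr0 -h2 -expr2 => /eqP; rewrite sqrf_eq1.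
    case/orP=> h3; [left; by rewrite inE xK h1 h3|right].
    apply/imsetP; exists (sl2N1 L * x)%g; last by apply: sl2_ext; rewrite !sl2E /=; ring.
    rewrite inE groupM ?sl2N1_K //= (eqP h1) (eqP h3).
    by apply/andP; split; apply/eqP; ring.
  case=> [|/imsetP[y yP ->]].
    by case/unipP=> t; rewrite inE => tK ->; rewrite tK !eqxx.
  case/unipP: yP => t; rewrite inE => tK ->.
  rewrite groupM ?sl2N1_K //=.
  by apply/andP; split; apply/eqP; ring.
rewrite cardsU; have -> : unip :&: [set (sl2N1 L * x)%g | x in unip] = set0.
  apply/setP => x; rewrite !inE; apply/negP => /andP[/and3P[_ _ h1]].
  case/imsetP=> y /unipP[t _ ->] e; move: h1; rewrite e mulE /=.
  rewrite mulr1 mulr0 addr0 -subr_eq0 -opprD oppr_eq0.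
  by rewrite (negPf two_neq0).
by rewrite cards0 subn0 card_imset ?mul2n ?addnn //; apply: mulgI.
Qed.

Lemma upper_conj (t : L) (k : sl2 L) :
  [/\ e21 (upper t ^ k)%g = - (t * e21 k ^+ 2),
      e11 (upper t ^ k)%g = 1 + t * e21 k * e22 k &
      e22 (upper t ^ k)%g = 1 - t * e21 k * e22 k].
Proof.
rewrite conjE /=; split; last 2 first.
- by apply: (eq_by_sub (sl2_det k)); ring.
- by apply: (eq_by_sub (sl2_det k)); ring.
by ring.
Qed.

Local Notation B := ('N_K(C0))%g.

(** The normalizer is the stabilizer of the line fixed by the transvection. *)
Lemma in_borel (k : sl2 L) : (k \in B) = (k \in K) && (e21 k == 0).
Proof.
have uZ := upper_notin_pm1 b0_neq0.
have [kK|kK] /= := boolP (k \in K); last by rewrite inE (negPf kK).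
have /normedTI_memJ_P[_ _ /(_ u k)] := support_normedTI b0K uZ.
rewrite inE uZ cent_id // => <- //.
rewrite inE -mem_conjgV pm1J uZ andTb in_cent_unip groupJ //.
have [-> -> ->] := upper_conj b0 k.
rewrite oppr_eq0 mulf_eq0 (negPf b0_neq0) sqrf_eq0 /=.
by case: eqP => //= ->; apply/eqP; ring.
Qed.

Lemma in_unip_borel x : x \in B -> (x \in unip) = (e11 x == 1).
Proof. by rewrite in_borel !inE => /andP[-> ->]. Qed.

Lemma unip_sub_cent : unip \subset C0.
Proof.
by apply/subsetP => x /unipP[t]; rewrite inE => tK ->; rewrite in_cent_unip tK !eqxx.
Qed.

Lemma cent_sub_borel : C0 \subset B.
Proof. by apply/subsetP => x; rewrite in_cent_unip in_borel => /and3P[-> ->]. Qed.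

Lemma unip_sub_K : unip \subset K.
Proof. by apply/subsetP => x; rewrite inE => /andP[]. Qed.

Lemma unip_sub_borel : unip \subset B.
Proof. exact: subset_trans unip_sub_cent cent_sub_borel. Qed.

Lemma unipJ x k : x \in unip -> k \in B -> (x ^ k)%g \in unip.
Proof.
case/unipP=> t; rewrite inE => tK -> kB.
move: (kB); rewrite in_borel => /andP[kK /eqP k0].
rewrite inE groupJ // andTb; have [-> -> _] := upper_conj t k.
by rewrite k0; apply/andP; split; apply/eqP; ring.
Qed.

(** The normalizer permutes the nontrivial upper transvections, and the
    centralizer is the stabilizer of one of them. *)
Lemma borel_torus_lt : (#|B : C0|%g < #|unip|)%N.
Proof.
have {2}-> : C0 = ('C_B[u])%g.
  apply/eqP; rewrite eqEsubset subsetI cent_sub_borel subsetIr /=.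
  by rewrite setSI // subsetIl.
rewrite index_cent1 [X in (_ < X)%N](cardsD1 1%g) group1 ltnS.
apply: subset_leq_card; apply/subsetP => x /imsetP[k kB ->].
by rewrite in_setD1 conjg_eq1 -upper0 (inj_eq (@upper_inj L)) b0_neq0 unipJ // u_unip.
Qed.

Lemma card_borel : #|B| = (2 * #|unip| * #|B : C0|%g)%N.
Proof. by rewrite -(Lagrange cent_sub_borel) card_cent_unip. Qed.

Lemma card_by_borel : #|K| = (2 * #|unip| * #|B : C0|%g * #|K : B|%g)%N.
Proof. by rewrite -card_borel Lagrange ?subsetIl. Qed.

Lemma card_unip_odd : odd #|unip|.
Proof.
have [k ->] := p_natP unip_pgroup.
by rewrite oddX p_odd orbT.
Qed.

Lemma card_unip_ge3 : (2 < #|unip|)%N.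
Proof.
have := card_unip_odd.
have : (1 < #|unip|)%N.
  rewrite cardG_gt1; apply/trivgPn; exists u; rewrite ?u_unip //.
  by rewrite -upper0 (inj_eq (@upper_inj L)).
by case: #|unip| => [|[|[|]]].
Qed.

Lemma card_cent_class_unip : #|cent_class K u| = ((2 * #|unip| - 2) * #|K : B|%g)%N.
Proof. by rewrite card_cent_class ?card_cent_unip ?upper_notin_pm1 // two_neq0. Qed.

Lemma borel_proper : (1 < #|K : B|%g)%N.
Proof.
rewrite indexg_gt1; apply/subsetPn; exists (lower c0) => //.
by rewrite in_borel c0K.
Qed.

Lemma sl2N1_sqr : (sl2N1 L ^+ 2)%g = 1%g.
Proof. by apply: sl2_ext; rewrite expgS expg1 !sl2E /=; ring. Qed.

Lemma sl2N1_not_p (S : {group sl2 L}) : (p.-group S)%g -> sl2N1 L \notin S.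
Proof.
move=> pS; apply/negP => NS.
have o2 : (#[sl2N1 L]%g %| 2)%N by rewrite order_dvdn sl2N1_sqr.
have : odd #[sl2N1 L]%g.
  have [k ->] := p_natP (mem_p_elt pS NS).
  by rewrite oddX p_odd orbT.
have := order_gt1 (sl2N1 L); rewrite (sl2N1_neq1 two_neq0).
by move: o2 => /(@dvdn_leq _ 2 isT); case: #[_]%g => [|[|[|?]]].
Qed.

Lemma sl2N1X : (sl2N1 L ^+ p)%g = sl2N1 L.
Proof.
rewrite -(odd_double_half p) p_odd -mul2n expgD expgM sl2N1_sqr expg1n.
by rewrite mulg1 expg1.
Qed.

(** A Sylow subgroup S above the group of upper transvections has a central
    element z; since S and the upper transvections commute with z, transitivity of
    commutation puts S in the centralizer of one upper transvection. *)
Lemma unip_Sylow : (p.-Sylow(K) unip)%g.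
Proof.
have [S sylS PS] := Sylow_superset unip_sub_K unip_pgroup.
have pS : (p.-group S)%g := pHall_pgroup sylS.
have /trivgPn[z zZ z1] : ('Z(S) != 1)%g.
  rewrite center_nil_eq1 ?(pgroup_nil pS) // -cardG_gt1.
  by apply: leq_trans (subset_leq_card PS); apply: leq_trans card_unip_ge3.
have zS : z \in S by move: zZ; rewrite inE => /andP[].
have zC x : x \in S -> commute z x.
  by move=> xS; move: zZ; rewrite inE => /andP[_ /centP h]; apply: h.
have zN : z \notin Z.
  by rewrite !inE (negPf z1) /=; apply: contraNneq (sl2N1_not_p pS) => <-.
suff e : S = unip_group by rewrite -[unip]/(gval unip_group) -e.
apply/val_inj/eqP; rewrite /= eqEsubset PS andbT; apply/subsetP => x xS.
have xK : x \in K := subsetP (pHall_sub sylS) x xS.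
have : x \in C0.
  rewrite in_cent xK; apply/eqP; apply: (comm_trans zN); apply: zC => //.
  by apply: (subsetP PS); apply: u_unip.
rewrite in_cent_unip => /and3P[_ x0 x1]; rewrite inE xK x0 /=.
have := sl2_det x; rewrite (eqP x0) mulr0 subr0 -(eqP x1) -expr2 => /eqP.
rewrite sqrf_eq1 => /orP[// | /eqP xN]; case/negP: (sl2N1_not_p pS).
have e : upper (- e12 x) = (sl2N1 L * x)%g.
  by apply: sl2_ext; rewrite !sl2E /= ?(eqP x0) -?(eqP x1) ?xN; ring.
have := upper_p (- e12 x); rewrite e expgMn ?sl2N1X; last first.
  by apply: pm1_central; rewrite !inE eqxx orbT.
move/(congr1 (mulg (sl2N1 L))); rewrite mulgA -expg2 sl2N1_sqr mul1g mulg1 => <-.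
exact: groupX.
Qed.

(** Elements of trace 2 have order p, so Sylow's theorem applies to them. *)
Lemma unipotent_in_class x : x \in K -> tr2 x = 2%:R -> x \notin Z -> x \in cent_class K u.
Proof.
move=> xK tx xZ.
have px : (p.-group <[x]>)%g.
  have [t [y e]] := unipotent_conj tx.
  have : (#[x]%g %| p)%N by rewrite order_dvdn e -conjXg upper_p conj1g.
  by rewrite /pgroup -orderE => /pnat_dvd -> //; rewrite pnat_id // p_prime.
have xK' : <[x]>%G \subset K by rewrite cycle_subG.
have [k kK] := Sylow_subJ unip_Sylow xK' px.
rewrite cycle_subG mem_conjg => xP.
rewrite -(conjgKV k x); apply: memJ_class_support => //.
rewrite inE (subsetP unip_sub_cent _ xP) andbT.
by rewrite -mem_conjg pm1J.
Qed.

Lemma trace4_in_class x : x \in K -> tr2 x ^+ 2 = 4%:R -> x \notin Z -> x \in cent_class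
  K u.
Proof.
move=> xK tx xZ.
have : (tr2 x - 2%:R) * (tr2 x + 2%:R) == 0.
  by apply/eqP; apply: (eq_by_sub tx); ring.
rewrite mulf_eq0 subr_eq0 addr_eq0 => /orP[]/eqP h; first exact: unipotent_in_class.
have NZ : sl2N1 L \in Z by rewrite !inE eqxx orbT.
have : (sl2N1 L * x)%g \in cent_class K u.
  apply: unipotent_in_class; last by rewrite groupMl.
    by rewrite groupM ?sl2N1_K.
  by rewrite /tr2 mulE /= !mul0r addr0 add0r !mulN1r -opprD -[_ + _]/(tr2 x) h opprK.
case/cent_classP=> a [k [aC aZ kK e]].
have -> : x = ((sl2N1 L * a) ^ k)%g.
  rewrite conjMg -e conjgE; have -> := pm1_central k NZ.
  by rewrite mulKg mulgA -expg2 sl2N1_sqr mul1g.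
apply: memJ_class_support => //; rewrite inE groupMl // aZ.
by rewrite groupM // (subsetP (pm1_cent K_pm1 _)).
Qed.

Lemma trace_off_class x : x \in K -> x \notin Z -> x \notin cent_class K u -> tr2 x ^+ 2
  != 4%:R.
Proof. by move=> xK xZ; apply: contra => /eqP h; apply: trace4_in_class. Qed.

(** The coset of k modulo the upper triangular matrices is the point of the
    projective line given by the second row of k; this is its affine coordinate. *)
Definition slope (k : sl2 L) := e22 k / e21 k.
Definition centres := [set slope k | k in K :\: B].

Lemma slope_eq k l : k \in K :\: B -> l \in K :\: B ->
  (slope k == slope l) = (l * k^-1 \in B)%g.
Proof.
rewrite !in_setD !in_borel !negb_and.
case/andP=> /orP[/negP//|k0] kK /andP[/orP[/negP//|l0] lK].
rewrite groupM ?groupV //= /slope eqr_div // -subr_eq0.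
by congr (_ == 0); ring.
Qed.

Lemma card_centres : #|centres| = (#|K : B|%g - 1)%N.
Proof.
have : (#|K :\: B| = #|centres| * #|B|)%N.
  rewrite -sum1_card (partition_big_imset slope) /= -sum_nat_const.
  apply: eq_bigr => d /imsetP[k kD ->].
  rewrite sum1_card -(card_rcoset B k); apply: eq_card => l.
  rewrite mem_rcoset unfold_in /=; apply/andP/idP => [[lD h]|h].
    by rewrite -slope_eq // eq_sym.
  have lD : l \in K :\: B.
    have [kK kB] := setDP kD.
    rewrite inE -(groupMr _ (groupVr kK)).
    apply/andP; split; last by rewrite (subsetP (subsetIl K 'N(C0)%g)).
    apply: contra kB => lB; rewrite -(mulgKV l k) groupM //.
    by rewrite -[k]invgK -invMg groupV.
  by rewrite lD eq_sym slope_eq.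
rewrite cardsD (setIidPr (subsetIl _ _)) -[in LHS](Lagrange (subsetIl K 'N(C0)))%g.
rewrite -{2}[#|B|]muln1 -mulnBr mulnC => /eqP.
by rewrite eqn_pmul2r ?cardG_gt0 // => /eqP.
Qed.

Lemma translD s t : s \in transl -> t \in transl -> s + t \in transl.
Proof. by rewrite !inE upperD => *; rewrite groupM. Qed.
Lemma translN s : s \in transl -> - s \in transl.
Proof. by rewrite !inE upperV groupV. Qed.
Lemma transl0 : 0 \in transl. Proof. by rewrite inE upper0. Qed.

Lemma centresD d t : d \in centres -> t \in transl -> d + t \in centres.
Proof.
case/imsetP=> k kD ->; rewrite inE => tK; apply/imsetP; exists (k * upper t)%g.
  move: kD; rewrite !in_setD !in_borel => /andP[h kK]; rewrite groupM //=.
  by move: h; rewrite kK /= mulr1 mulr0 addr0 => ->.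
move: kD; rewrite !in_setD !in_borel => /andP[h kK]; rewrite kK /= in h.
by rewrite /slope /=; field.
Qed.

Definition block d := [set y in centres | d - y \in transl].

Lemma card_block d : d \in centres -> #|block d| = #|transl|.
Proof.
move=> dD; rewrite -[RHS](card_imset _ (subrI d)); apply: eq_card => y.
rewrite inE; apply/andP/imsetP => [[yD h]|[t tT ->]].
  by exists (d - y); rewrite // subKr.
by rewrite subKr; split => //; apply: centresD => //; apply: translN.
Qed.

(** The group of translations acts freely on the affine line. *)
Lemma dvd_centres : (#|transl| %| #|centres|)%N.
Proof.
pose R x y := x - y \in transl.
have eqR : {in centres & &, equivalence_rel R}.
  move=> x y z _ _ _; rewrite /R subrr transl0; split=> // h.
  apply/idP/idP => h'.
    by have := translD (translN h) h'; rewrite opprB addrA subrK.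
  by have := translD h h'; rewrite addrA subrK.
rewrite (card_uniform_partition _ (equivalence_partitionP eqR) (n := #|transl|)).
  exact: dvdn_mull.
by move=> A /imsetP[d dD ->]; apply: card_block.
Qed.

(** An upper triangular y with distinct eigenvalues commutes with no
    transvection of K, so all elements of its coset modulo upper transvections are
    conjugate to it under them, and its centralizer is a complement to them. *)
Lemma borel_torus : (1 < #|B : C0|%g)%N ->
  exists y, [/\ y \in K, tr2 y ^+ 2 != 4%:R & #|cent y| = (2 * #|B : C0|%g)%N].
Proof.
rewrite indexg_gt1 => /subsetPn[y yB]; move: (yB); rewrite in_cent_unip in_borel =>
  /andP[yK /eqP y0].
rewrite yK y0 eqxx /= => y1.
have d0 : e11 y - e22 y != 0 by rewrite subr_eq0.
have ty : tr2 y ^+ 2 != 4%:R.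
  by rewrite -subr_eq0 tr2_disc y0 mulr0 addr0 sqrf_eq0.
exists y; split => //.
have yP x : x \in B -> (y^-1 * y ^ x)%g \in unip.
  move=> xB.
  have zB : (y^-1 * y ^ x)%g \in B by rewrite groupM ?groupV // groupJ.
  move: xB; rewrite in_borel => /andP[_ /eqP x0].
  rewrite in_unip_borel // sl2E conjE /= y0 x0; apply/eqP.
  have := sl2_det x; have := sl2_det y; rewrite x0 y0 !mulr0 !subr0 => hy hx.
  have h : (e11 y * e22 y) * (e11 x * e22 x) = 1 by rewrite hx hy mulr1.
  by apply: (eq_by_sub h); ring.
have C_B : cent y \subset B.
  apply/subsetP => z; rewrite in_cent in_borel => /andP[-> /eqP/esym/commuteP[_ _]].
  by rewrite y0 mul0r => /esym/eqP; rewrite mulf_eq0 (negPf d0).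
have TI x : x \in unip -> commute x y -> x = 1%g.
  case/unipP=> t _ -> /esym/commuteP[/= _ + _]; rewrite subrr mulr0.
  by move/esym/eqP; rewrite mulf_eq0 (negPf d0) /= => /eqP->; rewrite upper0.
have TIC : (cent y :&: unip = 1)%g.
  apply/trivgP/subsetP => x; rewrite in_setI in_cent => /andP[/andP[_ /eqP cxy] xP].
  by rewrite inE (TI x).
have eP : (y ^: unip = y *: unip)%g.
  apply/eqP; rewrite eqEcard; apply/andP; split.
    by apply/subsetP => _ /imsetP[x xP ->]; rewrite mem_lcoset yP // (subsetP
      unip_sub_borel).
  rewrite card_lcoset -index_cent1 (_ : 'C_unip[y] = 1)%g ?indexg1 //.
  apply/eqP; rewrite eqEsubset sub1G andbT; apply/subsetP => x.
  by rewrite inE => /andP[xP /cent1P cxy]; rewrite inE (TI x).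
(* a conjugate of y under B is a conjugate under unip *)
have BC : (cent y * unip = B)%g.
  apply/eqP; rewrite eqEsubset mul_subG ?unip_sub_borel //=.
  apply/subsetP => z zB.
  have : (y ^ z \in y ^: unip)%g.
    by rewrite eP mem_lcoset yP.
  case/imsetP=> x xP e; apply/mulsgP; exists (z * x^-1)%g x; rewrite ?mulgKV //.
  rewrite in_cent groupM ?groupV; last 2 first.
  - by move: zB; rewrite in_borel => /andP[].
  - exact: (subsetP unip_sub_K).
  have h : (y ^ (z * x^-1) = y)%g by rewrite conjgM e conjgK.
  by apply/eqP; rewrite -[in LHS]h conjgE mulKVg.
have := TI_cardMg TIC; rewrite BC card_borel.
have := card_unip_ge3; clear; move: #|unip| #|_ : _|%g #|cent y|; nia.
Qed.

Lemma cent_class_disjoint x y : x \notin Z -> y \in K -> y \notin Z -> y \notin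
  cent_class K x -> cent_class K x :&: cent_class K y = set0.
Proof.
move=> xZ yK yZ; apply: contraNeq => /set0Pn[z]; rewrite inE => /andP[zx zy].
by rewrite -(cent_class_eq xZ zx) (cent_class_eq yZ zy) cent_class_id.
Qed.

Definition semisimples := K :\: Z :\: cent_class K u.

Lemma semisimplesP x : x \in semisimples ->
  [/\ x \in K, x \notin Z, tr2 x ^+ 2 != 4%:R & cent_class K x \subset semisimples].
Proof.
rewrite !in_setD => /and3P[xu xZ xK].
split=> //; first exact: trace_off_class.
rewrite subsetD cent_class_sub // -setI_eq0 setIC cent_class_disjoint ?eqxx //.
exact: (upper_notin_pm1 b0_neq0).
Qed.

Lemma card_semisimples :
  #|semisimples| = (2 * #|unip| * #|B : C0|%g * #|K : B|%g - 2 - (2 * #|unip| - 2) * #|K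
    : B|%g)%N.
Proof.
rewrite cardsD (setIidPr (cent_class_sub K u)) card_cent_class_unip cardsD.
by rewrite (setIidPr K_pm1) card_pm1 ?two_neq0 // card_by_borel.
Qed.

Lemma semisimples_pick (S : {set sl2 L}) : S \subset semisimples -> (#|S| <
  #|semisimples|)%N ->
  exists2 x, x \in semisimples & x \notin S.
Proof.
move=> sS ltS; have /subsetPn[x] : ~~ (semisimples \subset S); last by exists x.
by apply: contraL ltS => /subset_leq_card; rewrite -leqNgt.
Qed.

Lemma semisimples_two x y : x \in semisimples -> y \in semisimples -> y \notin cent_class
  K x ->
  (#|cent_class K x| + #|cent_class K y| <= #|semisimples|)%N.
Proof.
move=> xR yR yx.
have [xK xZ _ sx] := semisimplesP xR; have [yK yZ _ sy] := semisimplesP yR.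
have := cardsUI (cent_class K x) (cent_class K y); rewrite cent_class_disjoint // cards0
  addn0 => <-.
by apply: subset_leq_card; rewrite subUset sx.
Qed.

(** The class of the transvections has (2 r - 2) n elements, which leaves room
    for few classes of semisimple elements: one if e = 1, and otherwise the class
    of the torus of order 2 e and one more. The sizes of these classes then
    determine n, up to one exceptional solution of order 120. *)
Lemma borel_index_dichotomy : #|K : B|%g = (#|unip| + 1)%N \/
  #|unip| = 3%N /\ forall x, x \in K -> [\/ x \in Z, x \in cent_class K u,
     #|cent x| = 4%N | #|cent x| = 10%N].
Proof.
have r2 := card_unip_ge3; have ro := card_unip_odd.
have n1 := borel_proper; have er := borel_torus_lt.
have e0 : (0 < #|B : C0|%g)%N := indexg_gt0 _ _.
have eR := card_semisimples; have eK := card_by_borel.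
have dn : exists d, #|K : B|%g = (d * #|unip| + 1)%N.
  have /dvdnP[d] := dvd_centres; rewrite -card_unip card_centres => h.
  by exists d; rewrite -h subnK // ltnW.
have tor := borel_torus.
have pick := semisimples_pick; have two := semisimples_two.
have semi x : x \in semisimples -> exists c s m, [/\ #|cent x| = (2 * c)%N,
   (c * s * m = #|unip| * #|B : C0|%g * #|K : B|%g)%N,
     #|cent_class K x| = (2 * (c - 1) * m)%N, (1 < c)%N & (0 < s <= 2)%N].
  move=> /semisimplesP[xK _ tx _].
  have [c [s [m [h1 h2 h3 h4 h5]]]] := semisimple_index two_neq0 K_pm1 xK tx.
  exists c, s, m; split => //; move: h2; rewrite eK; clear; lia.
have sub x : x \in semisimples -> cent_class K x \subset semisimples by case/semisimplesP.
move: eR dn er n1 e0 tor semi; clear eK.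
set r := #|unip|; set e := #|B : C0|%g; set n := #|K : B|%g.
move=> eR [d dn] er n1 e0 tor semi; rewrite -/r in r2 ro.
have [e1|e1] : e = 1%N \/ (1 < e)%N by clear -e0; lia.
  have eR' : #|semisimples| = (2 * n - 2)%N.
    rewrite eR e1; clear -r2 n1; have : (3 * n <= r * n)%N by rewrite leq_mul2r r2 orbT.
    by rewrite mulnBl; lia.
  have [|x xR _] := pick set0 (sub0set _); first by rewrite cards0 eR'; clear -n1; lia.
  have [c [s [m [h1 h2 h3 h4 h5]]]] := semi x xR.
  rewrite e1 muln1 in h2.
  have lex := subset_leq_card (sub x xR); rewrite h3 eR' in lex.
  have lex' : ((c - 1) * m <= n - 1)%N by clear -lex; lia.
  have [r3 [hm c2]] := count_no_torus r2 ro n1 h2 lex' h4 h5.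
  left; rewrite r3.
  have [eqx|ltx] : #|cent_class K x| = #|semisimples| \/ (#|cent_class K x| <
    #|semisimples|)%N.
    by rewrite h3 eR'; clear -lex; lia.
    move: eqx; rewrite h3 eR' c2; clear -hm n1; lia.
  have [y yR yx] := pick _ (sub x xR) ltx.
  have [c' [s' [m' [k1 k2 k3 k4 k5]]]] := semi y yR.
  rewrite e1 muln1 in k2.
  have ley := subset_leq_card (sub y yR); rewrite k3 eR' in ley.
  have ley' : ((c' - 1) * m' <= n - 1)%N by clear -ley; lia.
  have [_ [hm' c2']] := count_no_torus r2 ro n1 k2 ley' k4 k5.
  have := two x y xR yR yx; rewrite h3 k3 eR' c2 c2'; clear -hm hm' n1; lia.
have [y0 [yK ty hy0]] := tor e1; rewrite -/e in hy0.
have yR : y0 \in semisimples.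
  have yZ : y0 \notin Z.
    apply: contra ty => /pm1P[h1 [h2 h3]].
    by rewrite -subr_eq0 tr2_disc h1 h3; apply/eqP; ring.
  rewrite !in_setD yK yZ !andbT.
  apply/negP => /cent_classP[a [k [+ aZ kK e2]]]; rewrite in_cent_unip => /and3P[_ /eqP
    a0 /eqP a1].
  case/eqP: ty; rewrite e2 tr2J; apply/eqP; rewrite -subr_eq0 tr2_disc a0 a1.
  by apply/eqP; ring.
have [c [s [m [h1 h2 h3 h4 h5]]]] := semi y0 yR.
have ce : c = e by move: h1; rewrite hy0; clear; lia.
subst c.
have hsm : (s * m = r * n)%N.
  apply/eqP; rewrite -(eqn_pmul2l e0); apply/eqP; move: h2; clear; lia.
have len : (3 * n <= r * n)%N by rewrite leq_mul2r r2 orbT.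
have le2 : (2 * (r * n) <= r * e * n)%N.
  by rewrite -[(r * e)%N]mulnC -mulnA leq_mul2r e1 orbT.
have eR' : #|semisimples| = (2 * (r * e * n) + 2 * n - 2 - 2 * (r * n))%N.
  by rewrite eR mulnBl; move: len le2; clear; lia.
have hrsm : (e * (s * m) = r * e * n)%N by rewrite hsm; clear; lia.
have cly0 : #|cent_class K y0| = (2 * (e * m) - 2 * m)%N.
  by rewrite h3; clear -e1; nia.
have [s1|s2] : s = 1%N \/ s = 2%N by clear -h5; lia.
  have em : m = (r * n)%N by rewrite -hsm s1 mul1n.
  have cly1 : #|cent_class K y0| = (2 * (r * e * n) - 2 * (r * n))%N.
    by rewrite cly0 em; clear; lia.
  have lt0 : (#|cent_class K y0| < #|semisimples|)%N.
    by rewrite cly1 eR'; move: len le2 n1; clear; lia.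
  have [x xR xy] := pick _ (sub y0 yR) lt0.
  have [c [s' [m' [k1 k2 k3 k4 k5]]]] := semi x xR.
  have le3 := two _ _ yR xR xy.
  exfalso; apply: (count_unswapped_torus r2 e1 n1 k2 _ k4 k5).
  move: le3; rewrite cly1 eR' k3; move: len le2 n1; clear; lia.
have em : (2 * m = r * n)%N by rewrite -hsm s2.
have cly1 : #|cent_class K y0| = (r * e * n - r * n)%N.
  by rewrite cly0 -hrsm s2 -em; clear; lia.
have lt0 : (#|cent_class K y0| < #|semisimples|)%N.
  by rewrite cly1 eR'; move: len le2 n1; clear; lia.
have [x xR xy] := pick _ (sub y0 yR) lt0.
have [c [s' [m' [k1 k2 k3 k4 k5]]]] := semi x xR.
have le3 := two _ _ yR xR xy.
rewrite cly1 eR' k3 in le3.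
have s2' : s' = 2%N.
  by apply: (count_second_torus r2 e1 n1 k2 _ k4 k5); move: le3 len le2 n1; clear; lia.
have eU : #|cent_class K y0 :|: cent_class K x| = (#|cent_class K y0| + #|cent_class K
  x|)%N.
  have [yK' yZ' _ _] := semisimplesP yR; have [xK' xZ' _ _] := semisimplesP xR.
  by rewrite -cardsUI cent_class_disjoint // cards0 addn0.
have sU : cent_class K y0 :|: cent_class K x \subset semisimples by rewrite subUset !sub.
have [ltU|geU] := ltnP #|cent_class K y0 :|: cent_class K x| #|semisimples|.
  have [z zR] := pick _ sU ltU.
  rewrite inE negb_or => /andP[zy zx].
  have [c' [s'' [m'' [l1 l2 l3 l4 l5]]]] := semi z zR.
  have [zK' zZ' _ _] := semisimplesP zR.
  have [yK' yZ' _ _] := semisimplesP yR; have [xK' xZ' _ _] := semisimplesP xR.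
  have : (#|(cent_class K y0 :|: cent_class K x) :|: cent_class K z| <= #|semisimples|)%N.
    by apply: subset_leq_card; rewrite subUset sU sub.
  rewrite -[X in (X <= _)%N](addn0 _) -[X in (_ + X <= _)%N](cards0 (sl2 L)).
  have -> : set0 = (cent_class K y0 :|: cent_class K x) :&: cent_class K z.
    by rewrite setIUl !cent_class_disjoint // setU0.
  rewrite cardsUI eU cly1 k3 l3 eR'.
  have a1 := class_at_least_quarter k2 k4 k5; have a2 := class_at_least_quarter l2 l4 l5.
  by move: a1 a2 len le2 n1; clear; lia.
have eqU : (#|cent_class K y0| + #|cent_class K x| = #|semisimples|)%N.
  by apply/eqP; rewrite eqn_leq -{2}eU geU andbT -eU subset_leq_card.
have f1 : (2 * c * m' = r * e * n)%N by rewrite -k2 s2'; clear; lia.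
have f2 : (2 * (c - 1) * m' = r * e * n + 2 * n - 2 - r * n)%N.
  by move: eqU; rewrite cly1 eR' k3; move: len le2 n1; clear; lia.
have [->|[r3 ee2 n10 c5]] := count_borel_index r2 ro e1 er n1 dn f1 f2 k4; first by left.
right; split=> // w wK.
have [wZ|wZ] := boolP (w \in Z); first by apply: Or41.
have [wu|wu] := boolP (w \in cent_class K u); first by apply: Or42.
have : w \in cent_class K y0 :|: cent_class K x.
  have /eqP-> : cent_class K y0 :|: cent_class K x == semisimples by rewrite eqEcard sU geU.
  by rewrite !in_setD wu wZ wK.
have [yK' yZ' _ _] := semisimplesP yR; have [xK' xZ' _ _] := semisimplesP xR.
rewrite inE => /orP[] /cent_class_centJ.
  by case=> // k kK ->; apply: Or43; rewrite cardJg hy0 ee2.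
by case=> // k kK ->; apply: Or44; rewrite cardJg k1 c5.
Qed.

(** If x^4 = 1 or x^10 = 1 then x^9 is x or x^-1, and in characteristic 3 the
    trace of x^9 is the ninth power of the trace of x. If tr(x)^2 = 4 = 1, the
    claim is immediate. *)
Lemma exceptional_trace : #|unip| = 3%N ->
  (forall x, x \in K -> [\/ x \in Z, x \in cent_class K u,
     #|cent x| = 4%N | #|cent x| = 10%N]) ->
  p = 3%N /\ forall x, x \in K -> tr2 x ^+ 9 = tr2 x.
Proof.
move=> r3 cases.
have p3 : p = 3%N.
  have [k e] := p_natP unip_pgroup; rewrite r3 in e.
  have : (p %| 3)%N by case: k e => [//|k] ->; rewrite expnS dvdn_mulr.
  by rewrite dvdn_prime2 ?p_prime // => /eqP.
split=> // x xK.
have three0 : 3%:R = 0 :> L by have := pcharf0 pL; rewrite p3.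
have trX3 (y : sl2 L) : tr2 (y ^+ 3)%g = tr2 y ^+ 3.
  have h : tr2 y ^+ 3 = tr2 (y ^+ 3)%g + 3%:R * tr2 y.
    have hd := congr1 ( *%R (3%:R * tr2 y)) (sl2_det y).
    rewrite mulr1 in hd; rewrite -{}hd !expgS expg0 mulg1 /tr2 !mulE /=; ring.
  by rewrite h three0 mul0r addr0.
have trX9 (y : sl2 L) : tr2 (y ^+ 9)%g = tr2 y ^+ 9.
  by rewrite -[9%N]/(3 * 3)%N expgM !trX3 exprM.
have trV (y : sl2 L) : tr2 (y^-1)%g = tr2 y by rewrite /tr2 /= addrC.
have f3 : (3%:R : L) = 1 + 2%:R by ring.
have two1 : 2%:R = -1 :> L by apply/eqP; rewrite -addr_eq0 addrC -f3 three0.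
have tr4 (y : sl2 L) : tr2 y ^+ 2 = 4%:R -> tr2 y ^+ 9 = tr2 y.
  have -> : 4%:R = 1 :> L by rewrite -[4%N]/(3 + 1)%N natrD three0 add0r.
  move=> h; rewrite -[9%N]/(2 * 4 + 1)%N exprD exprM h expr1n mul1r //.
have ord : (x ^+ #|cent x|)%g = 1%g by apply: expg_cardG; apply: cent_id.
case: (cases x xK) => h.
- apply: tr4; case/pm1P: h => [h1 [h2 h3]]; apply/eqP; rewrite -subr_eq0 tr2_disc h1 h3.
  by apply/eqP; ring.
- apply: tr4; case/cent_classP: h => a [k [+ aZ kK e2]]; rewrite in_cent_unip => /and3P[_
    /eqP a0 /eqP a1].
  rewrite e2 tr2J; apply/eqP; rewrite -subr_eq0 tr2_disc a0 a1.
  by apply/eqP; ring.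
- rewrite h in ord; rewrite -trX9 -[9%N]/(4 * 2 + 1)%N expgD expgM ord expg1n mul1g //.
rewrite h in ord; rewrite -trX9 -trV; congr (tr2 (sl2val _)); apply/eqP.
by rewrite eq_invg_mul -expgSr ord.
Qed.

Section FieldCase.
Hypothesis index_eq : #|K : B|%g = (#|unip| + 1)%N.

(** A lower transvection of K is conjugate in K to an upper one by Sylow's
    theorem; its centre is the point 0. *)
Lemma zero_centre : exists2 k, k \in K :\: B & e22 k = 0.
Proof.
have cZ : lower c0 \notin Z.
  by apply/pm1P => -[_ [/= e _]]; move: c0_neq0; rewrite e eqxx.
have : lower c0 \in cent_class K u by apply: unipotent_in_class; rewrite /tr2 //= -natrD.
case/cent_classP=> a [k [+ aZ kK e]]; rewrite in_cent_unip => /and3P[aK /eqP a0 /eqP a1].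
have a1' : e11 a = 1.
  have := congr1 (fun x : sl2 L => tr2 x) e; rewrite tr2J /tr2 /= -a1 => h.
  by apply: (mulfI two_neq0); rewrite mulr2n mulrDl mul1r mulrDl mul1r -h.
have ea : a = upper (e12 a) by apply: sl2_ext; rewrite -?a1.
have [h1 h2 h3] := upper_conj (e12 a) k; rewrite -ea -e /= in h1 h2 h3.
have ck : e12 a * e21 k != 0.
  apply: contraNneq c0_neq0 => h; rewrite h1 expr2 mulrA h mul0r oppr0 //.
exists k.
  by rewrite in_setD in_borel kK andbT /=; move: ck; rewrite mulf_eq0 negb_or => /andP[].
apply: (mulfI ck); rewrite mulr0; apply: (addrI 1); rewrite addr0 -h2 //.
Qed.

(** There are r centres besides infinity, so they form a single orbit of the
    translations, that of 0. *)
Lemma slope_transl k : k \in K -> e21 k != 0 -> slope k \in transl.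
Proof.
move=> kK k0.
have [k1 k1D k10] := zero_centre.
have d0 : 0 \in centres by apply/imsetP; exists k1; rewrite // /slope k10 mul0r.
(* the translates of 0 already exhaust the centres *)
have e : block 0 = centres.
  apply/eqP; rewrite eqEcard card_block // card_centres index_eq addnK card_unip leqnn
    andbT.
  by apply/subsetP => y; rewrite inE => /andP[].
have : slope k \in block 0.
  by rewrite e; apply/imsetP; exists k; rewrite // in_setD in_borel kK k0.
by rewrite inE sub0r => /andP[_ /translN]; rewrite opprK.
Qed.

(** The slope of [lower t] is t^-1, which gives one direction. The upper and the
    lower transvections form conjugate groups, so counting gives the other. *)
Lemma lower_inv t : (lower t \in K) = (t^-1 \in transl).
Proof.
pose low := [set c | lower c \in K].
suff e : [set t^-1 | t in low] = transl.
  apply/idP/idP => [tK|]; first by rewrite -e imset_f // inE.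
  by rewrite -e => /imsetP[c]; rewrite inE => cK /invr_inj->.
apply/eqP; rewrite eqEcard card_imset; last exact: invr_inj.
apply/andP; split.
  apply/subsetP => x /imsetP[c cL ->]; have cK : lower c \in K by rewrite inE in cL.
  have [->|cn] := eqVneq c 0; first by rewrite invr0 transl0.
  by have := slope_transl cK cn; rewrite /slope /= div1r.
have [k kD k0] := zero_centre.
move: kD; rewrite in_setD in_borel => /andP[+ kK]; rewrite kK /= => k1.
have c1 : - e21 k ^+ 2 != 0 by rewrite oppr_eq0 sqrf_eq0.
rewrite -(card_imset _ (mulIf c1)); apply: subset_leq_card; apply/subsetP => x /imsetP[t0
  tT ->].
have tK : upper t0 \in K by rewrite inE in tT.
rewrite inE; suff -> : lower (t0 * - e21 k ^+ 2) = (upper t0 ^ k)%g by rewrite groupJ.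
have [h1 h2 h3] := upper_conj t0 k.
apply: sl2_ext; rewrite ?h1 ?h2 ?h3 /= ?k0; ring.
Qed.

(** Both T and the set of inverses of elements of T are additive groups, and
    a - a^2 / c is the inverse of 1/a + 1/(c - a). *)
Lemma transl_sqdiv a c : a \in transl -> c \in transl -> a ^+ 2 / c \in transl.
Proof.
move=> aT cT.
have [->|c_n0] := eqVneq c 0; first by rewrite invr0 mulr0 transl0.
have [->|a_n0] := eqVneq a 0; first by rewrite expr0n mul0r transl0.
have [<-|ac] := eqVneq a c; first by rewrite expr2 mulfK.
have d0 : c - a != 0 by rewrite subr_eq0 eq_sym.
have : a - a ^+ 2 / c \in transl.
  have -> : a - a ^+ 2 / c = (a^-1 + (c - a)^-1)^-1.
    by field; rewrite d0 a_n0 subrK c_n0.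
  rewrite -lower_inv lowerD groupM // lower_inv invrK //.
  by rewrite translD // translN.
by move=> h; have := translD aT (translN h); rewrite opprB addrC subrK.
Qed.

Definition fieldset := [set x | x * b0 \in transl].
Local Notation E := fieldset.

Lemma fieldset1 : 1 \in E. Proof. by rewrite inE mul1r inE. Qed.
Lemma fieldsetB x y : x \in E -> y \in E -> x - y \in E.
Proof. by rewrite !(in_set (fun x => x * b0 \in _)) mulrBl => *; rewrite translD //
  translN. Qed.
Lemma fieldset_sqdiv x y : x \in E -> y \in E -> x ^+ 2 / y \in E.
Proof.
rewrite !(in_set (fun x => x * b0 \in _)) => hx hy.
have [->|y0] := eqVneq y 0; first by rewrite invr0 mulr0 mul0r transl0.
suff -> : x ^+ 2 / y * b0 = (x * b0) ^+ 2 / (y * b0) by apply: transl_sqdiv.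
by field; rewrite b0_neq0.
Qed.
Lemma fieldsetV x : x \in E -> x^-1 \in E.
Proof. by move/(fieldset_sqdiv fieldset1); rewrite expr1n div1r. Qed.
Lemma fieldset0 : 0 \in E.
Proof. by rewrite -(subrr 1) fieldsetB // fieldset1. Qed.
Lemma fieldsetD x y : x \in E -> y \in E -> x + y \in E.
Proof. by move=> hx hy; rewrite -[y]opprK -[- y]sub0r fieldsetB // fieldsetB //
  fieldset0. Qed.
(** Division by 2 is multiplication by (p + 1) / 2. *)
Lemma fieldsetM x y : x \in E -> y \in E -> x * y \in E.
Proof.
move=> hx hy.
have sq z : z \in E -> z ^+ 2 \in E.
  by move/fieldset_sqdiv => /(_ _ fieldset1); rewrite divr1.
have h2 : (x * y) *+ 2 \in E.
  rewrite (_ : _ *+ 2 = (x + y) ^+ 2 - x ^+ 2 - y ^+ 2); last by ring.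
  by rewrite !fieldsetB ?sq // fieldsetD.
have hn n : (x * y) *+ 2 *+ n \in E.
  by elim: n => [|n IH]; rewrite ?mulr0n ?fieldset0 // mulrS fieldsetD.
have := hn (uphalf p); rewrite -mulrnA mul2n.
have -> : (uphalf p).*2 = p.+1 by rewrite uphalfE odd_uphalfK // .
by rewrite mulrS mulrn_pchar // addr0.
Qed.

End FieldCase.

(** The exceptional case is that of SL(2,5) inside SL(2,9); it is described by
    the only property that matters later, that all traces lie in the field with 9
    elements. *)
Lemma two_transvections :
  (exists E : {set L},
    [/\ (p.-nat #|E|)%N /\ is_subfield E,
        forall t, (upper t \in K) = (t / b0 \in E),
        forall t, (lower t \in K) = (t * b0 \in E) &
        {in K, forall k : sl2 L, e21 k != 0 -> e22 k / e21 k / b0 \in E}])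
  \/ (p = 3%N /\ {in K, forall x : sl2 L, tr2 x ^+ 9 = tr2 x}).
Proof.
have [eI|[r3 h]] := borel_index_dichotomy; last by right; apply: exceptional_trace.
left; exists fieldset; split; first (split; last split).
- rewrite (_ : #|_| = #|unip|); first exact: unip_pgroup.
  rewrite card_unip -(card_imset _ (mulIf b0_neq0)); apply: eq_card => t.
  apply/imsetP/idP => [[x + ->]|tT]; first by rewrite inE.
  by exists (t / b0); rewrite ?inE ?divfK //; move: tT; rewrite inE.
- exact: fieldset1.
- exact: fieldsetB.
- exact: fieldsetM.
- exact: fieldsetV.
- by move=> t; rewrite !inE divfK.
- move=> t; rewrite lower_inv //; apply/idP/idP => h.
    rewrite -[_ * _]invrK; apply: fieldsetV => //; rewrite inE invfM.
    by rewrite mulfVK.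
  have := fieldsetV eI h; rewrite !inE invfM mulfVK //.
move=> k kK k0; rewrite inE divfK //.
exact: slope_transl.
Qed.

End Dickson.

(** * Generation of SL(2,L) by a transvection and another element *)

Section Subfields.
Variable L : finFieldType.

(** Lagrange's theorem in the multiplicative group of the subfield. *)
Lemma subfield_expf (E : {set L}) : is_subfield E ->
  {in E, forall x, x ^+ #|E| = x}.
Proof.
move=> [E1 EB EM EV] x xE.
have E0 : 0 \in E by rewrite -(subrr 1) EB.
pose S := [set u : {unit L} | val u \in E].
have gS : group_set S.
  apply/group_setP; split=> [|u v]; first by rewrite inE.
  by rewrite !inE => uE vE; rewrite /= EM.
have cS : #|S|.+1 = #|E|.
  rewrite (cardsD1 0 E) E0 add1n; congr _.+1.
  rewrite -(card_imset _ val_inj); apply: eq_card => y; rewrite !inE.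
  apply/imsetP/andP => [[u + ->]|[y0 yE]].
    by rewrite inE => uE; split=> //; rewrite -unitfE; apply: (valP u).
  by exists (FinRing.unit L (etrans (unitfE y) y0)); rewrite ?inE.
have [->|x0] := eqVneq x 0; first by rewrite -cS expr0n.
pose u := FinRing.unit L (etrans (unitfE x) x0).
have : (u ^+ #|S|)%g = 1%g.
  by apply: (@expg_cardG _ (Group gS)); rewrite inE.
have vX n : val (u ^+ n)%g = x ^+ n.
  by elim: n => [//|n IH]; rewrite expgS exprS -IH.
move/(congr1 val); rewrite vX /= => h.
by rewrite -cS exprS h mulr1.
Qed.

Lemma card_exp_eq (m : nat) (c : L) : (0 < m)%N ->
  (#|[set t : L | t ^+ m == c]| <= m)%N.
Proof.
move=> m0; rewrite cardE; have sz := size_XnsubC c m0.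
rewrite -ltnS -sz; apply: max_poly_roots; rewrite ?enum_uniq //.
  by rewrite -size_poly_eq0 sz.
apply/allP => t; rewrite mem_enum inE => /eqP h.
by rewrite rootE !hornerE h subrr.
Qed.

Lemma card_expf_fix n : (1 < n)%N -> (#|[set t : L | t ^+ n == t]| <= n)%N.
Proof.
move=> n1; rewrite cardE.
have sz : size ('X^n - 'X : {poly L}) = n.+1.
  by rewrite size_polyDl size_polyXn // size_polyN size_polyX.
rewrite -ltnS -sz; apply: max_poly_roots; rewrite ?enum_uniq //.
  by rewrite -size_poly_eq0 sz.
apply/allP => t; rewrite mem_enum inE => /eqP h.
by rewrite rootE !hornerE h subrr.
Qed.

Lemma card_bigcup_leq (I : Type) (r : seq I) (P : pred I) (T : finType) (A : I -> {set T}) :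
  (#|\bigcup_(i <- r | P i) A i| <= \sum_(i <- r | P i) #|A i|)%N.
Proof.
elim/big_ind2: _ => [|a m b n ha hb|//]; first by rewrite cards0.
by apply: leq_trans (leq_add ha hb); rewrite cardsU leq_subr.
Qed.

End Subfields.

Section Generation.
Variables (L : finFieldType) (cj : {rmorphism L -> L}) (p k : nat).
Hypotheses (pL : p \in [pchar L]) (p_odd : odd p).
Local Notation q := (p ^ k)%N.
Definition fixed := [set t : L | cj t == t].
Hypotheses (card_L : #|L| = (q ^ 2)%N) (card_fixed : #|fixed| = q) (q_gt3 : (3 < q)%N).

Let p_pr : prime p := pcharf_prime pL.
Let p_gt2 : (2 < p)%N.
Proof. by move: p_pr p_odd; case: (p) => [|[|[|]]]. Qed.

Lemma fixedP t : reflect (cj t = t) (t \in fixed).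
Proof. by rewrite inE; apply: eqP. Qed.

Lemma fixed_subfield : is_subfield fixed.
Proof.
split; first by rewrite inE rmorph1.
- by move=> x y /fixedP hx /fixedP hy; apply/fixedP; rewrite rmorphB hx hy.
- by move=> x y /fixedP hx /fixedP hy; apply/fixedP; rewrite rmorphM hx hy.
by move=> x /fixedP hx; apply/fixedP; rewrite fmorphV hx.
Qed.

Lemma fixed_expq x : x ^+ q = x -> x \in fixed.
Proof.
have q1 : (1 < q)%N by apply: leq_trans q_gt3.
move=> xq.
suff -> : fixed = [set t : L | t ^+ q == t] by rewrite inE xq.
apply/eqP; rewrite eqEcard card_fixed card_expf_fix // andbT.
apply/subsetP => t tF; rewrite inE -card_fixed.
by rewrite (subfield_expf fixed_subfield).
Qed.

(** Since L has p^(2k) elements, a proper subfield has p^j elements with j < k,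
    or is the fixed field of the involution. The powers x^(p^j) exclude the former. *)
Definition generic (x : L) := x \notin fixed /\
  forall j, (0 < j < k)%N -> x ^+ (p ^ j) != x.

Lemma generic_subfield (E : {set L}) x : is_subfield E -> (p.-nat #|E|)%N ->
  x \in E -> generic x -> E = setT.
Proof.
move=> sE pE xE [xF gx]; have [E1 EB EM EV] := sE.
have E0 : 0 \in E by rewrite -(subrr 1) EB.
have [lt|gt|e] := ltngtP #|E| q; last 2 first.
- apply/eqP; rewrite eqEsubset subsetT /=; apply/subsetP => y _.
  apply: contraLR gt => yE; rewrite -leqNgt.
  rewrite -leq_sqr -card_L -cardsT -mulnn -cardsX.
  pose f (z : L * L) := z.1 + y * z.2.
  rewrite -(card_in_imset (f := f)); first by apply: subset_leq_card; apply: subsetT.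
  move=> [a b] [c d]; rewrite !inE /f /= => /andP[aE bE] /andP[cE dE] h.
  have [bd|bd] := eqVneq b d.
    by move: h; rewrite bd => /addIr->.
  case/negP: yE; have -> : y = (a - c) * (d - b)^-1.
    have db : d - b != 0 by rewrite subr_eq0 eq_sym.
    apply: (mulIf db); rewrite mulfVK //; apply: (eq_by_sub (esym h)); ring.
  by apply: EM; [apply: EB | apply: EV; apply: EB].
- by case/negP: xF; apply: fixed_expq; rewrite -{1}e (subfield_expf sE).
have [j ej] := p_natP pE.
have j0 : (0 < j)%N.
  rewrite lt0n; apply/eqP => j0; move: ej; rewrite j0 expn0 => /eqP.
  by rewrite (cardsD1 0 E) E0 (cardsD1 1) !inE oner_eq0 E1.
have jk : (j < k)%N by move: lt; rewrite ej ltn_exp2l // prime_gt1.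
have := gx j; rewrite j0 jk => /(_ isT).
by rewrite -ej (subfield_expf sE) // eqxx.
Qed.

(** For each j at most m (p^j - 1) values of t are bad, which is at most
    (p - 1) p^j; these numbers add up to less than q - 1. *)
Lemma exists_generic_multiple (x : L) (m : nat) : (0 < m <= 2)%N -> x \notin fixed ->
  exists t, [/\ t != 0, t \in fixed & generic (t ^+ m * x)].
Proof.
move=> m12 xF.
have x0 : x != 0 by apply: contraNneq xF => ->; rewrite inE rmorph0.
pose bad j := [set t : L | t ^+ (m * (p ^ j - 1)) == (x ^+ (p ^ j - 1))^-1].
have cbad : (#|\bigcup_(j < k | (0 < j)%N) bad j| < q.-1)%N.
  apply: leq_ltn_trans (card_bigcup_leq _ _ _) _.
  have le1 : (\sum_(j < k | (0 < j)%N) #|bad j| <=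
              \sum_(j < k | (0 < j)%N) (p - 1) * p ^ j)%N.
    apply: leq_sum => j j0.
    have pj : (0 < p ^ j - 1)%N by rewrite subn_gt0 -{1}(expn0 p) ltn_exp2l // prime_gt1.
    apply: leq_trans (card_exp_eq _ _) _; first by rewrite muln_gt0 pj; case/andP: m12 =>
      ->.
    apply: leq_mul; last exact: leq_subr.
    by apply: leq_trans (proj2 (andP m12)) _; rewrite subn1 -ltnS prednK // ltnW // ltnW.
  apply: leq_ltn_trans le1 _.
  have := predn_exp p k; rewrite -subn1 => ->.
  case: k q_gt3 => [//|k' _].
  rewrite [X in (_ < _ * X)%N](bigD1 (ord0 : 'I_k'.+1)) //= expn0 mulnDr muln1 subn1.
  rewrite -big_distrr /= (eq_bigl (fun j : 'I_k'.+1 => j != ord0)); last first.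
    by move=> j; rewrite lt0n.
  by rewrite -[X in (X < _)%N]add0n ltn_add2r -subn1 subn_gt0 prime_gt1.
have : ~~ (fixed :\ 0 \subset \bigcup_(j < k | (0 < j)%N) bad j).
  apply: contraL cbad => /subset_leq_card; rewrite -leqNgt.
  by have := cardsD1 0 fixed; rewrite card_fixed inE rmorph0 eqxx => ->.
case/subsetPn => t; rewrite in_setD1 => /andP[t0 tF] tb.
exists t; split=> //; split.
  move/fixedP: tF => tF.
  apply: contra xF => /fixedP; rewrite rmorphM rmorphXn tF => /mulfI h.
  by apply/fixedP; apply: h; rewrite expf_neq0.
move=> j j0k; apply: contra tb => /eqP h.
case/andP: j0k => j0 jk; apply/bigcupP; exists (Ordinal jk) => //=.
have z0 : t ^+ m * x != 0 by rewrite mulf_neq0 // expf_neq0.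
rewrite inE exprM -[_ == _](inj_eq (mulIf (expf_neq0 (p ^ j - 1) x0))).
rewrite -exprMn mulVf ?expf_neq0 //; apply/eqP; apply: (mulfI z0).
by rewrite -exprS mulr1 subn1 prednK // expn_gt0 prime_gt0.
Qed.

Definition cj2 (x : m2 L) := Mk2 (cj (e11 x)) (cj (e12 x)) (cj (e21 x)) (cj (e22 x)).
Fact cjs_subproof (g : sl2 L) : det2 (cj2 g) == 1.
Proof. by rewrite /det2 /= -!rmorphM -rmorphB sl2_det rmorph1. Qed.
Definition cjs (g : sl2 L) : sl2 L := SL2 (cjs_subproof g).

Lemma cjsM : {morph cjs : x y / (x * y)%g}.
Proof. by move=> x y; apply: sl2_ext; rewrite /= rmorphD !rmorphM. Qed.
Lemma cjs1 : cjs 1%g = 1%g.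
Proof. by apply: sl2_ext; rewrite /= ?rmorph1 ?rmorph0. Qed.
Lemma cjsV g : cjs g^-1%g = (cjs g)^-1%g.
Proof. by apply: (mulgI (cjs g)); rewrite -cjsM !mulgV cjs1. Qed.

(** The condition cj(g) = g^-1 or cj(g) = - g^-1. *)
Definition twisted (g : sl2 L) :=
  (cjs g == g^-1)%g || (cjs g == sl2N1 L * g^-1)%g.

Lemma twistedJ g y : cjs y = y -> twisted (g ^ y)%g = twisted g.
Proof.
move=> hy; rewrite /twisted -conjVg conjgE !cjsM cjsV hy -conjgE.
rewrite (inj_eq (conjg_inj y)); congr (_ || _).
have -> : (sl2N1 L * (g^-1) ^ y = (sl2N1 L * g^-1) ^ y)%g.
  have NZ : sl2N1 L \in pm1 L by rewrite !inE eqxx orbT.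
  by rewrite conjMg (conjgE (sl2N1 L)); have -> := pm1_central y NZ; rewrite mulKg.
by rewrite (inj_eq (conjg_inj y)).
Qed.

(** A matrix whose lower left entry is not 0 is a product of three elementary
    ones. *)
Lemma sl2_generated (K : {group sl2 L}) : (forall t, upper t \in K) ->
  (forall t, lower t \in K) -> K = [set: sl2 L] :> {set _}.
Proof.
move=> hu hl; apply/eqP; rewrite eqEsubset subsetT /=; apply/subsetP => x _.
have gen (y : sl2 L) : e21 y != 0 -> y \in K.
  move=> y0.
  suff -> : y = (upper ((e11 y - 1) / e21 y)%R * lower (e21 y) * upper ((e22 y - 1) / e21
    y)%R)%g by rewrite !groupM.
  apply: sl2_ext; rewrite !sl2E /=; try by field.
  by apply: (mulIf y0); apply: (eq_by_sub (esym (sl2_det y))); field.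
have [x0|] := eqVneq (e21 x) 0; last exact: gen.
rewrite -(groupMl _ (hl 1)); apply: gen; rewrite mulE /= x0 mul1r mulr0 addr0.
by apply: contra_eq_neq (sl2_det x) => ->; rewrite x0 mul0r mulr0 subrr eq_sym oner_eq0.
Qed.

Lemma generic_pow9 x : generic x -> p = 3%N -> x ^+ 9 != x.
Proof.
move=> [xF gx] p3; have [k2|k2] : k = 2%N \/ (2 < k)%N.
  by move: q_gt3; rewrite p3; by case: (k) => [|[|[|k']]] // _; [left|right].
  apply: contra xF => /eqP h; apply: fixed_expq.
  by rewrite p3 k2.
by have := gx 2%N; rewrite k2 p3; apply.
Qed.

(** A conjugation by an upper transvection commutes with [upper b] and makes the
    first diagonal entry of g vanish. Then g conjugates [upper b] to a lower
    transvection, and both its slope and the parameter of this transvection are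
    visible to [two_transvections]. *)
Lemma generic_generates (g : sl2 L) (b : L) : b != 0 -> e21 g != 0 ->
  generic ((b * e21 g) ^+ 2) \/ generic (b * e21 g * tr2 g) ->
  <<[set g; upper b]>>%g = [set: sl2 L].
Proof.
move=> b0 c0 gen.
set c := e21 g in c0 gen *; set d := tr2 g in gen *.
pose x := upper (e11 g / c).
pose g1 := (g ^ x)%g.
have g1c : e21 g1 = c by rewrite conjE /= -/c; ring.
have g1a : e11 g1 = 0 by rewrite conjE /= -/c; field.
have g1d : e22 g1 = d by rewrite /d -(tr2J g x) -/g1 /tr2 g1a add0r.
have ubx : (upper b ^ x)%g = upper b.
  by rewrite conjgE -upperV -!upperD; congr upper; ring.
pose H := <<[set g1; upper b]>>%g.
suff HT : H = [set: sl2 L].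
  apply/eqP; rewrite eqEsubset subsetT /= -(conjSg _ _ x) -genJ.
  rewrite conjUg !conjg_set1 -/g1 ubx -/H HT.
  by apply: subsetT.
clearbody g1.
have g1H : g1 \in H by rewrite mem_gen // !inE eqxx.
have uH : upper b \in H by rewrite mem_gen // !inE eqxx orbT.
pose K := (H * pm1 L)%G.
have HK : H \subset K by rewrite joing_subl.
have ZK : pm1 L \subset K by rewrite joing_subr.
have two0 := two_neq0 pL p_odd.
have cK : lower (- (b * c ^+ 2)) \in K.
  suff <- : (upper b ^ (g1^-1))%g = lower (- (b * c ^+ 2)).
    by rewrite (subsetP HK) // groupJ // groupV.
  have [h1 h2 h3] := upper_conj b (g1^-1)%g.
  apply: sl2_ext; rewrite ?h1 ?h2 ?h3 /= ?g1a ?g1c ?g1d; ring.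
have cn0 : - (b * c ^+ 2) != 0 by rewrite oppr_eq0 mulf_neq0 // expf_neq0.
have := two_transvections pL p_odd ZK b0 cn0 (subsetP HK _ uH) cK.
case=> [[E [[pE sE] hu hl hs]] | [p3 h9]]; last first.
  exfalso.
  have d9 : d ^+ 9 = d by rewrite -g1d -[e22 g1]add0r -g1a -[_ + _]/(tr2 g1) h9 //
    (subsetP HK).
  (* the ninth power is additive, and g1 * upper b has trace d + b c *)
  have cb9 : (b * c) ^+ 9 = b * c.
    have := h9 (g1 * upper b)%g; rewrite groupM ?(subsetP HK) // => /(_ isT).
    rewrite /tr2 mulE /= g1a g1c g1d.
    rewrite (_ : _ + _ = d + b * c); last by ring.
    have c9 : ([pchar L].-nat 9)%N by rewrite (pnatX _ 3 2) pnatE // -[3%N]p3 pL.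
    by rewrite exprDn_pchar // d9 => /addrI.
  case: gen => /generic_pow9 /(_ p3) /eqP; apply.
    by rewrite exprAC cb9.
  by rewrite exprMn cb9 d9.
have [E1 EB EM EV] := sE.
have EN y : y \in E -> - y \in E.
  by move=> yE; rewrite -sub0r EB // -(subrr 1) EB.
(* the parameter of the lower transvection in K *)
have chi1 : (b * c) ^+ 2 \in E.
  by move: cK; rewrite hl => /EN; rewrite (_ : - _ = (b * c) ^+ 2) //; ring.
(* the slope of g1, scaled by the previous element *)
have chi2 : b * c * d \in E.
  have := hs g1 (subsetP HK _ g1H); rewrite g1c g1d => /(_ c0) h.
  have := EM _ _ h chi1; rewrite (_ : d / c / b * _ = b * c * d) //.
  by field; rewrite b0.
have ET : E = setT.
  by case: gen => gen; apply: (generic_subfield sE pE _ gen).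
have NZ : sl2N1 L \in pm1 L by rewrite !inE eqxx orbT.
(* adding -1 to H creates no new element of order p *)
have KH y : y \in K -> (y ^+ p)%g = 1%g -> y \in H.
  rewrite /K /= cent_joinEr => [|]; last first.
    by apply/subsetP => z zZ; apply/centP => h _; apply: pm1_central.
  case/mulsgP=> h z hH; rewrite !inE => /orP[]/eqP-> ->; first by rewrite mulg1.
  have -> : (h * sl2N1 L = sl2N1 L * h)%g by apply/esym; apply: pm1_central.
  rewrite expgMn; last exact: pm1_central.
  rewrite (sl2N1X L p_odd).
  move=> e; rewrite groupMr //; suff <- : (h ^+ p)%g = sl2N1 L by apply: groupX.
  apply: (mulgI (sl2N1 L)); rewrite e; apply: sl2_ext; rewrite mulE /=; ring.
have up t : upper t \in H.
  by apply: KH; rewrite ?hu ?ET ?inE // -upperX mulrn_pchar // upper0.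
have lo t : lower t \in H.
  by apply: KH; rewrite ?hl ?ET ?inE // -lowerX mulrn_pchar // lower0.
exact: (sl2_generated (K := [group of H]) up lo).
Qed.

Variable eps : L.
Hypotheses (eps0 : eps != 0) (cj_eps : cj eps = - eps).

Let two0 : 2%:R != 0 :> L := two_neq0 pL p_odd.

(** A square x^2 is fixed when cj x = x or cj x = - x. So the product of two
    polynomials of degree at most 2 vanishes on the fixed field, which has more than
    4 elements because q is odd and q > 3. *)
Lemma quadratic_sqr_fixed c e b :
  (forall z, z \in fixed -> (c + e * z - b * z ^+ 2) ^+ 2 \in fixed) ->
  exists2 s, s = 1 \/ s = -1 & [/\ cj c = s * c, cj e = s * e & cj b = s * b].
Proof.
move=> h.
pose P s : {poly L} := Poly [:: cj c - s * c; cj e - s * e; - (cj b - s * b)].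
have szP s : (size (P s) <= 3)%N by apply: size_Poly.
have P0 s : P s = 0 -> [/\ cj c = s * c, cj e = s * e & cj b = s * b].
  move=> e0; split; apply/eqP; rewrite -subr_eq0.
  - by have := coef_Poly [:: cj c - s * c; cj e - s * e; - (cj b - s * b)] 0; rewrite
      -/(P s) e0 coef0 /= => <-.
  - by have := coef_Poly [:: cj c - s * c; cj e - s * e; - (cj b - s * b)] 1; rewrite
      -/(P s) e0 coef0 /= => <-.
  by rewrite -oppr_eq0; have := coef_Poly [:: cj c - s * c; cj e - s * e; - (cj b - s *
    b)] 2; rewrite -/(P s) e0 coef0 /= => <-.
suff /eqP : P 1 * P (-1) = 0.
  by rewrite mulf_eq0 => /orP[]/eqP/P0 ?; [exists 1; [left|] | exists (-1); [right|]].
apply/eqP; apply: contraTT q_gt3 => PP0.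
suff q4 : (q <= 4)%N.
  have : odd q by rewrite oddX p_odd orbT.
  by case: q q4 => [|[|[|[|[|?]]]]].
have sz5 : (size (P 1%R * P (-1)%R)%R <= 5)%N.
  apply: leq_trans (size_polyMleq _ _) _.
  by have := leq_add (szP 1) (szP (-1)); case: (_ + _)%N.
rewrite -card_fixed cardE -ltnS; apply: leq_trans sz5.
apply: max_poly_roots; rewrite ?enum_uniq //.
apply/allP => z; rewrite mem_enum => zF.
have hP s : (P s).[z] = cj (c + e * z - b * z ^+ 2) - s * (c + e * z - b * z ^+ 2).
  rewrite horner_Poly /= rmorphB rmorphD !rmorphM ?rmorphXn (fixedP _ zF).
  by ring.
rewrite rootE hornerM !hP mulN1r opprK mul1r -subr_sqr.
by rewrite -rmorphXn (fixedP _ (h z zF)) subrr.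
Qed.

Lemma twisted_sign (g : sl2 L) s : s = 1 \/ s = -1 ->
  [/\ cj (tr2 g) = s * tr2 g, cj (e21 g) = - s * e21 g,
      cj (e22 g - e11 g) = - s * (e22 g - e11 g) & cj (e12 g) = - s * e12 g] ->
  twisted g.
Proof.
move=> hs [hD hc he hb].
have ha : cj (e11 g) = s * e22 g.
  apply: (mulfI two0); rewrite -{1}(rmorph_nat cj 2) -rmorphM.
  have -> : 2%:R * e11 g = tr2 g - (e22 g - e11 g) by rewrite /tr2; ring.
  by rewrite rmorphB hD he /tr2; ring.
have hd : cj (e22 g) = s * e11 g.
  have -> : e22 g = (e22 g - e11 g) + e11 g by rewrite subrK.
  by rewrite rmorphD he ha; ring.
rewrite /twisted; case: hs => hs; rewrite hs in hD hc hb ha hd; apply/orP; [left|right];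
  apply/eqP; apply: sl2_ext; rewrite !sl2E /= ?hc ?hb ?ha ?hd; ring.
Qed.

Lemma e21_lowerJ (g : sl2 L) z : e21 (g ^ lower z)%g =
   e21 g + (e22 g - e11 g) * z - e12 g * z ^+ 2.
Proof. by rewrite conjE /=; ring. Qed.

(** Conjugation by [lower z] replaces the lower left entry of g by a quadratic
    polynomial in z. If all its values are bad, its coefficients, which are the
    entries of the traceless part of g, satisfy the equations of twisted elements. *)
Lemma twisted_or_generic (g : sl2 L) : ~~ twisted g ->
  exists z, [/\ z \in fixed, e21 (g ^ lower z)%g != 0 &
     (e21 (g ^ lower z)%g ^+ 2 \notin fixed) || (eps * e21 (g ^ lower z)%g * tr2 g \notin
       fixed)].
Proof.
move=> ng.
pose f z := e21 g + (e22 g - e11 g) * z - e12 g * z ^+ 2.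
have [/existsP[z /andP[zF hz]]|no] := boolP [exists z, (z \in fixed) && (((f z) ^+ 2
  \notin fixed) || (eps * f z * tr2 g \notin fixed))].
  exists z; rewrite e21_lowerJ -/(f z); split=> //.
  apply: contraTneq hz => ->; rewrite expr2 !(mulr0, mul0r) negb_or !negbK.
  by rewrite inE rmorph0 eqxx.
case/negP: ng.
have {no} hf z : z \in fixed -> f z ^+ 2 \in fixed /\ eps * f z * tr2 g \in fixed.
  move=> zF; move/existsP: no => no; apply/andP.
  by apply: contraPT no => no; rewrite negb_and in no; case; exists z; rewrite zF.
have [s hs [hc he hb]] := quadratic_sqr_fixed (fun z zF => proj1 (hf z zF)).
have ss : s * s = 1 by case: hs => ->; ring.
have [D0|D0] := eqVneq (tr2 g) 0.
  apply: (twisted_sign (s := - s)).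
    by case: hs => ->; [right|left]; rewrite ?opprK.
  by rewrite D0 rmorph0 mulr0 opprK.
have [/existsP[z /andP[zF fz]]|no] := boolP [exists z, (z \in fixed) && (f z != 0)].
  apply: (twisted_sign (s := - s)).
    by case: hs => ->; [right|left]; rewrite ?opprK.
  rewrite opprK; split=> //.
  have [_ /fixedP h] := hf z zF.
  have hfz : cj (f z) = s * f z.
    rewrite /f rmorphB rmorphD !rmorphM ?rmorphXn (fixedP _ zF) hc he hb.
    by ring.
  apply: (mulfI (mulf_neq0 eps0 fz)).
  move: h; rewrite !rmorphM cj_eps hfz => h.
  have : s * (- eps * (s * f z) * cj (tr2 g)) = s * (eps * f z * tr2 g) by rewrite h.
  move=> h'; apply: (eq_by_sub (esym h')).
  rewrite (_ : s * (- eps * (s * f z) * cj (tr2 g)) = (s * s) * (- eps * f z * cj (tr2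
    g))); last by ring.
  by rewrite ss; ring.
have f0 z : z \in fixed -> f z = 0.
  by move=> zF; apply/eqP; apply: contraNT no => fz; apply/existsP; exists z; rewrite zF.
have c0 : e21 g = 0.
  by rewrite -(f0 0) ?inE ?rmorph0 // /f; ring.
have f1 := f0 1; have fN := f0 (-1).
rewrite /f c0 in f1 fN.
have {}f1 : e22 g - e11 g = e12 g.
  by apply/eqP; rewrite -subr_eq0 -{1}(f1 _) ?inE ?rmorph1 //; apply/eqP; ring.
have {}fN : 2%:R * e12 g = 0.
  by rewrite -oppr0 -{1}(fN _) ?inE ?rmorphN ?rmorph1 // f1; ring.
have b0 : e12 g = 0 by apply: (mulfI two0); rewrite mulr0.
have : g \in pm1 L.
  apply/pm1P; split=> //; split=> //; apply/eqP.
  by rewrite eq_sym -subr_eq0 f1 b0.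
rewrite !inE => /orP[]/eqP->; apply: (twisted_sign (s := 1)); try by left.
  by rewrite /tr2 /= subrr !rmorph0 rmorphD rmorph1 !mulr0 mul1r.
by rewrite /tr2 /= subrr !rmorph0 rmorphD !rmorphN rmorph1 !mulr0 mul1r.
Qed.

Theorem generation (g : sl2 L) : ~~ twisted g ->
  exists2 h, twisted h & <<[set g; h]>>%g = [set: sl2 L].
Proof.
move=> /twisted_or_generic[z [zF c0 hz]].
set g1 := (g ^ lower z)%g in c0 hz *.
set c := e21 g1 in c0 hz *.
have [t [t0 tF gt]] : exists t, [/\ t != 0, t \in fixed &
   generic ((t * eps * c) ^+ 2) \/ generic (t * eps * c * tr2 g1)].
  case/orP: hz => hz.
    have [|t [t0 tF gt]] := @exists_generic_multiple ((eps * c) ^+ 2) 2 isT; last first.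
      by exists t; split=> //; left; rewrite -mulrA exprMn.
    rewrite exprMn inE rmorphM rmorphXn cj_eps sqrrN (inj_eq (mulfI _)) ?expf_neq0 //.
    by move: hz; rewrite inE.
  have [|t [t0 tF gt]] := @exists_generic_multiple (eps * c * tr2 g) 1 isT; last first.
    by exists t; split=> //; right; rewrite tr2J -!mulrA; rewrite expr1 -!mulrA in gt.
  by [].
pose h1 := upper (t * eps).
have hl : cjs (lower z) = lower z.
  by move/fixedP: zF => zF; apply: sl2_ext; rewrite /= ?rmorph1 ?rmorph0.
exists (h1 ^ (lower z)^-1)%g.
  rewrite twistedJ; last by rewrite cjsV hl.
  apply/orP; left; apply/eqP; rewrite -upperV; move/fixedP: tF => tF.
  by apply: sl2_ext; rewrite /= ?rmorph1 ?rmorph0 ?rmorphM ?tF ?cj_eps ?mulrN.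
have te0 : t * eps != 0 by rewrite mulf_neq0.
have := generic_generates te0 c0 gt.
move=> hT; apply/eqP; rewrite eqEsubset subsetT /= -(conjSg _ _ (lower z)) -genJ.
rewrite conjUg !conjg_set1 -/g1 conjgKV -/h1 hT.
exact: subsetT.
Qed.

End Generation.

(** * Quadratic extensions of a finite field *)

Section QuadExt.
Variables (F : finFieldType) (d : F).
Hypothesis d_nonsquare : forall x : F, x ^+ 2 != d.

(** The pair (x, y) stands for x + y sqrt(d). The nonsquare hypothesis is a
    parameter of the type so that the field structure can be inferred from it. *)
Definition quad of (forall x : F, x ^+ 2 != d) : Type := (F * F)%type.
Local Notation L := (quad d_nonsquare).
HB.instance Definition _ := Finite.copy L (F * F)%type.
HB.instance Definition _ := GRing.Zmodule.copy L (F * F)%type.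

Definition quad_mul (x y : L) : L := (x.1 * y.1 + d * x.2 * y.2, x.1 * y.2 + x.2 * y.1).
Definition quad_one : L := (1, 0).
Definition quad_inv (x : L) : L :=
  let n := x.1 ^+ 2 - d * x.2 ^+ 2 in (x.1 / n, - x.2 / n).

Lemma quad_ext (x y : L) : x.1 = y.1 -> x.2 = y.2 -> x = y.
Proof. by case: x y => [a b] [c e] /= -> ->. Qed.

Fact qmulA : associative quad_mul.
Proof. by move=> x y z; apply: quad_ext => /=; ring. Qed.
Fact qmulC : commutative quad_mul.
Proof. by move=> x y; apply: quad_ext => /=; ring. Qed.
Fact qmul1 : left_id quad_one quad_mul.
Proof. by move=> x; apply: quad_ext => /=; ring. Qed.
Fact qmulD : left_distributive quad_mul +%R.
Proof. by move=> x y z; apply: quad_ext => /=; ring. Qed.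
Fact qone0 : quad_one != 0.
Proof. by apply/eqP => /(congr1 fst)/= /eqP; rewrite oner_eq0. Qed.

HB.instance Definition _ :=
  GRing.Zmodule_isComNzRing.Build L qmulA qmulC qmul1 qmulD qone0.

Lemma quad_norm_eq0 (a b : F) : a ^+ 2 - d * b ^+ 2 = 0 -> a = 0 /\ b = 0.
Proof.
move=> h; have [b0|b0] := eqVneq b 0.
  move: h; rewrite b0 expr0n mulr0 subr0 => /eqP; rewrite sqrf_eq0 => /eqP.
  by [].
case/eqP: (d_nonsquare (a / b)); rewrite expr_div_n.
apply: (mulIf (expf_neq0 2 b0)); rewrite divfK ?expf_neq0 //.
by apply/eqP; rewrite -subr_eq0 h.
Qed.

Fact qmulV : forall x : L, x != 0 -> quad_inv x * x = 1.
Proof.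
move=> x x0.
have n0 : x.1 ^+ 2 - d * x.2 ^+ 2 != 0.
  apply: contra x0 => /eqP/quad_norm_eq0[h1 h2]; apply/eqP.
  exact: quad_ext.
by apply: quad_ext => /=; field.
Qed.
Fact qinv0 : quad_inv 0 = 0.
Proof. by apply: quad_ext; rewrite /= ?oppr0 mul0r. Qed.

HB.instance Definition _ := GRing.ComNzRing_isField.Build L qmulV qinv0.

Definition quad_in (a : F) : L := (a, 0).
Definition quad_cj (x : L) : L := (x.1, - x.2).
Definition quad_eps : L := (0, 1).

Fact qin_zmod : zmod_morphism quad_in.
Proof. by move=> a b; apply: quad_ext => /=; ring. Qed.
HB.instance Definition _ := GRing.isZmodMorphism.Build F L quad_in qin_zmod.
Fact qin_monoid : monoid_morphism quad_in.
Proof. by split=> [|a b]; apply: quad_ext => /=; ring. Qed.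
HB.instance Definition _ := GRing.isMonoidMorphism.Build F L quad_in qin_monoid.

Fact qcj_zmod : zmod_morphism quad_cj.
Proof. by move=> a b; apply: quad_ext => /=; ring. Qed.
HB.instance Definition _ := GRing.isZmodMorphism.Build L L quad_cj qcj_zmod.
Fact qcj_monoid : monoid_morphism quad_cj.
Proof. by split=> [|a b]; apply: quad_ext => /=; ring. Qed.
HB.instance Definition _ := GRing.isMonoidMorphism.Build L L quad_cj qcj_monoid.

Lemma quad_cj_in a : quad_cj (quad_in a) = quad_in a.
Proof. by apply: quad_ext => /=; ring. Qed.
Lemma quad_cj_eps : quad_cj quad_eps = - quad_eps.
Proof. by apply: quad_ext => /=; ring. Qed.
Lemma quad_eps_sqr : quad_eps ^+ 2 = quad_in d.
Proof. by rewrite expr2; apply: quad_ext => /=; ring. Qed.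
Lemma quad_decomp (x : L) : x = quad_in x.1 + quad_eps * quad_in x.2.
Proof. by apply: quad_ext => /=; ring. Qed.
Lemma card_quad : #|(L : finFieldType)| = (#|F| ^ 2)%N.
Proof. by rewrite card_prod mulnn. Qed.
End QuadExt.

(** * Matrix identities, and quadratic equations over a finite field *)

Section Mat2More.
Variable R : comNzRingType.
Definition add2 (x y : m2 R) :=
  Mk2 (e11 x + e11 y) (e12 x + e12 y) (e21 x + e21 y) (e22 x + e22 y).
Definition scale2 a (x : m2 R) := Mk2 (a * e11 x) (a * e12 x) (a * e21 x) (a * e22 x).
Lemma m2_ext (x y : m2 R) : e11 x = e11 y -> e12 x = e12 y ->
  e21 x = e21 y -> e22 x = e22 y -> x = y.
Proof. by case: x y => [a b c d] [a' b' c' d'] /= -> -> -> ->. Qed.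
Lemma mul2A (x y z : m2 R) : mul2 x (mul2 y z) = mul2 (mul2 x y) z.
Proof. by apply: m2_ext => /=; ring. Qed.
Lemma mul2Zl a (x y : m2 R) : mul2 (scale2 a x) y = scale2 a (mul2 x y).
Proof. by apply: m2_ext => /=; ring. Qed.
Lemma mul2Zr a (x y : m2 R) : mul2 x (scale2 a y) = scale2 a (mul2 x y).
Proof. by apply: m2_ext => /=; ring. Qed.
Lemma scale2A a b (x : m2 R) : scale2 a (scale2 b x) = scale2 (a * b) x.
Proof. by apply: m2_ext => /=; ring. Qed.
Lemma adj2M (x y : m2 R) : adj2 (mul2 x y) = mul2 (adj2 y) (adj2 x).
Proof. by apply: m2_ext => /=; ring. Qed.
End Mat2More.

(** Row and column operations turn a block triangular matrix with diagonal blocks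
    1 + u v and 1 into one with diagonal blocks 1 and 1 + v u. *)
Lemma det_rank1 (R : fieldType) n (u : 'cV[R]_n) (v : 'rV[R]_n) :
  \det (1%:M + u *m v) = 1 + (v *m u) 0 0.
Proof.
have h : block_mx 1%:M 0 v 1%:M *m block_mx (1%:M + u *m v) u 0 (1%:M : 'M_1)
    *m block_mx 1%:M 0 (- v) 1%:M = block_mx 1%:M u 0 (1%:M + v *m u).
  rewrite !mulmx_block !(mul1mx, mul0mx, mulmx1, mulmx0, addr0, add0r).
  congr block_mx; rewrite ?mulmxN.
  - by rewrite addrK.
  - by rewrite mulmxDr mulmxDl mulmx1 mul1mx mulmxA [_ + v]addrC subrr.
  by rewrite addrC.
have := congr1 determinant h; rewrite !det_mulmx !det_lblock !det_ublock !det1 !mul1r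
  !mulr1 => ->.
by rewrite det_mx11 mxE mxE.
Qed.

Section FiniteField.
Variable F : finFieldType.

(** Each square has at most two roots, and 0 has one. *)
Lemma card_squares : (#|F| < 2 * #|[set x ^+ 2 | x : F]|)%N.
Proof.
set S := [set x ^+ 2 | x : F].
have S0 : 0 \in S by apply/imsetP; exists 0; rewrite ?expr0n.
have -> : #|F| = (\sum_(s in S) #|[set x : F | x ^+ 2 == s]|)%N.
  rewrite -sum1_card (partition_big_imset (fun x : F => x ^+ 2)) /=.
  by apply: eq_bigr => s _; rewrite -sum1_card; apply: eq_bigl => x; rewrite inE.
rewrite (bigD1 0) //=.
have -> : #|[set x : F | x ^+ 2 == 0]| = 1%N.
  by rewrite -[RHS](cards1 (0 : F)); apply: eq_card => x; rewrite in_set sqrf_eq0 in_set1.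
have : (\sum_(s in S | s != 0%R) #|[set x : F | x ^+ 2 == s]| <= \sum_(s in S | s != 0%R)
  2)%N.
  by apply: leq_sum => s _; apply: card_exp_eq.
rewrite sum_nat_const (cardsD1 0 S) S0 add1n.
have -> : #|[pred s | (s \in S) & s != 0]| = #|S :\ 0|.
  by apply: eq_card => s; rewrite !inE andbC.
move: (\sum_(_ in _ | _) _)%N #|_ :\ _| => X n; clear; lia.
Qed.

(** The sets of values of a x^2 and c - b y^2 are too large to be disjoint. *)
Lemma conic (a b c : F) : a != 0 -> b != 0 -> exists x y, a * x ^+ 2 + b * y ^+ 2 = c.
Proof.
move=> a0 b0; set S := [set x ^+ 2 | x : F].
pose S1 := [set a * s | s in S]; pose S2 := [set c - b * s | s in S].
have c1 : #|S1| = #|S| by rewrite card_imset //; apply: mulfI.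
have c2 : #|S2| = #|S|.
  by rewrite card_imset // => s t /addrI/oppr_inj/(mulfI b0).
have : S1 :&: S2 != set0.
  rewrite -card_gt0; have := cardsUI S1 S2; rewrite c1 c2 addnn -mul2n => h.
  have := leq_ltn_trans (max_card (mem (S1 :|: S2))) card_squares.
  by rewrite -/S -h -[X in (X < _)%N]addn0 ltn_add2l.
case/set0Pn=> z; rewrite inE => /andP[/imsetP[s /imsetP[x _ ->] ->] /imsetP[t /imsetP[y _
  ->] h]].
by exists x, y; rewrite h subrK.
Qed.

Lemma card_hyperbola (a b : F) : a != 0 -> b != 0 ->
  #|[set w : F * F | a + b * w.1 * w.2 == 0]| = (#|F| - 1)%N.
Proof.
move=> a0 b0.
have <- : #|[set x : F | x != 0]| = (#|F| - 1)%N.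
  have := cardsC1 (0 : F); rewrite subn1 => <-.
  by apply: eq_card => x; rewrite !inE.
pose f x := (x, - a / (b * x)).
rewrite -(card_imset (f := f) _ (fun x y => fun e => congr1 fst e)).
apply: eq_card => -[x y]; rewrite inE /=; apply/eqP/imsetP => [h|[z]].
  have x0 : x != 0 by apply: contra_eq_neq h => ->; rewrite mulr0 mul0r addr0.
  exists x; rewrite ?inE //; congr (_, _).
  apply: (mulfI (mulf_neq0 b0 x0)); apply: (eq_by_sub h); field.
  by rewrite ?b0 ?x0.
by rewrite inE => z0 [-> ->]; field; rewrite ?b0 ?z0.
Qed.
End FiniteField.

(** * The orthogonal space as a space of matrices *)

Notation i0 := (@Ordinal 4 0 isT).
Notation i1 := (@Ordinal 4 1 isT).
Notation i2 := (@Ordinal 4 2 isT).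
Notation i3 := (@Ordinal 4 3 isT).

Section Model.
Variables (F L : finFieldType) (inj : {rmorphism F -> L}) (cj : {rmorphism L -> L}).
Variables (eps : L) (d : F) (re im : L -> F).
Hypotheses (cj_inj : forall a, cj (inj a) = inj a) (cj_eps : cj eps = - eps).
Hypothesis eps_sqr : eps ^+ 2 = inj d.
Hypothesis decomp : forall x, x = inj (re x) + eps * inj (im x).
Hypothesis two0 : 2%:R != 0 :> L.
Hypothesis eps0 : eps != 0.

Lemma cjK : involutive cj.
Proof. by move=> x; rewrite (decomp x) !(rmorphD, rmorphM, rmorphN, cj_inj, cj_eps)
  opprK. Qed.

Lemma re_im a b : re (inj a + eps * inj b) = a /\ im (inj a + eps * inj b) = b.
Proof.
set x := (X in re X).
have h := decomp x; have h' := congr1 cj h.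
rewrite {1}/x in h; rewrite {1}/x !(rmorphD, rmorphM, cj_inj, cj_eps) in h'.
split; apply: (fmorph_inj inj).
  apply: (mulfI two0); apply: (eq_by_sub (congr2 +%R (esym h) (esym h'))); ring.
apply: (mulfI (mulf_neq0 two0 eps0)); apply: (eq_by_sub (congr2 (fun x y => x - y) (esym
  h) (esym h'))); ring.
Qed.

Lemma cj_fix x : cj x = x -> x = inj (re x).
Proof.
move=> h; have := h; rewrite {1 2}(decomp x) !(rmorphD, rmorphM, cj_inj, cj_eps) => h'.
apply: (mulfI two0); rewrite {1}(decomp x).
by apply: (eq_by_sub (esym h')); ring.
Qed.

Lemma cj_anti x : cj x = - x -> x = eps * inj (im x).
Proof.
move=> h; have := h; rewrite {1 2}(decomp x) !(rmorphD, rmorphM, cj_inj, cj_eps) => h'.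
apply: (mulfI two0); rewrite {1}(decomp x).
by apply: (eq_by_sub h'); ring.
Qed.

Local Notation cj2 := (cj2 cj).
Lemma cj2M x y : cj2 (mul2 x y) = mul2 (cj2 x) (cj2 y).
Proof. by apply: m2_ext; rewrite /= rmorphD !rmorphM. Qed.
(** These matrices are a + eps M with a in F and M traceless over F; they make
    up the 4-dimensional F-space that models V. *)
Definition herm (m : m2 L) := cj2 m = adj2 m.

Variables (B Pm : 'M[F]_4) (ka : F).
Hypotheses (Pm_unit : Pm \in unitmx) (ka0 : ka != 0).
Local Notation "''[' u , v ]" := (form idfun B u v) : ring_scope.

Definition co (i : 'I_4) (x : 'rV[F]_4) := (x *m invmx Pm) 0 i.
Hypothesis formco : forall x y, '[x, y] = ka * (co i0 x * co i0 y
   - d * co i1 x * co i1 y - d / 2%:R * (co i2 x * co i3 y + co i3 x * co i2 y)).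

Lemma coD i x y : co i (x + y) = co i x + co i y.
Proof. by rewrite /co mulmxDl mxE. Qed.
Lemma coZ i a x : co i (a *: x) = a * co i x.
Proof. by rewrite /co -scalemxAl mxE. Qed.

(** The matrix with coordinates those of x in the basis given by the rows of Pm. *)
Definition phi x : m2 L :=
  Mk2 (inj (co i0 x) + eps * inj (co i1 x)) (eps * inj (co i2 x))
      (eps * inj (co i3 x)) (inj (co i0 x) - eps * inj (co i1 x)).
Definition psi (m : m2 L) : 'rV[F]_4 :=
  (\row_(j < 4) nth 0 [:: re (e11 m); im (e11 m); im (e12 m); im (e21 m)] j) *m Pm.

Lemma phiD x y : phi (x + y) = add2 (phi x) (phi y).
Proof. by apply: m2_ext; rewrite /= !coD !rmorphD; ring. Qed.
Lemma phiZ a x : phi (a *: x) = scale2 (inj a) (phi x).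
Proof. by apply: m2_ext; rewrite /= !coZ !rmorphM; ring. Qed.

Lemma phi0 : phi 0 = Mk2 0 0 0 0.
Proof. by apply: m2_ext; rewrite /= /co mul0mx !mxE rmorph0; ring. Qed.

Lemma phi_herm x : herm (phi x).
Proof. by apply: m2_ext; rewrite /= !(rmorphD, rmorphN, rmorphM, cj_inj, cj_eps); ring. Qed.

Lemma co_psi m i : co i (psi m) = nth 0 [:: re (e11 m); im (e11 m); im (e12 m); im (e21
  m)] i.
Proof. by rewrite /co /psi mulmxK // mxE. Qed.

Lemma psiK m : herm m -> phi (psi m) = m.
Proof.
case: m => a b c e [h1 h2 h3 h4]; rewrite /phi !co_psi /= -decomp -(@cj_anti b) //
  -(@cj_anti c) //.
have ha : cj a = inj (re a) - eps * inj (im a).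
  by rewrite [in LHS](decomp a) !(rmorphD, rmorphM, cj_inj, cj_eps) mulNr.
by rewrite -ha h1.
Qed.

Lemma coP x y : (forall i, co i x = co i y) -> x = y.
Proof.
move=> h; rewrite -[x](mulmxKV Pm_unit) -[y](mulmxKV Pm_unit); congr (_ *m _).
by apply/rowP => i; apply: h.
Qed.

Lemma phiK x : psi (phi x) = x.
Proof.
apply: coP => i; rewrite co_psi /=.
have hr y : im (eps * inj y) = y by have [_] := re_im 0 y; rewrite rmorph0 add0r.
rewrite (re_im _ _).1 (re_im _ _).2 !hr.
by case: i => -[|[|[|[|]]]] //= p; congr co; apply: val_inj.
Qed.

Lemma phi_inj x y : phi x = phi y -> x = y.
Proof. by move=> h; rewrite -(phiK x) h phiK. Qed.

Lemma two_inj : inj 2%:R = 2%:R. Proof. exact: rmorph_nat. Qed.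
Lemma two0F : 2%:R != 0 :> F.
Proof. by rewrite -(fmorph_eq0 inj) two_inj. Qed.

Lemma formE x y : 2%:R * inj '[x, y] = inj ka * tr2 (mul2 (phi x) (adj2 (phi y))).
Proof.
rewrite formco /tr2 /= -{1}two_inj -rmorphM.
have -> : 2%:R * (ka * (co i0 x * co i0 y - d * co i1 x * co i1 y -
   d / 2%:R * (co i2 x * co i3 y + co i3 x * co i2 y))) =
  ka * (2%:R * co i0 x * co i0 y - 2%:R * d * co i1 x * co i1 y -
   d * (co i2 x * co i3 y + co i3 x * co i2 y)) by field; apply: two0F.
rewrite !(rmorphM, rmorphB, rmorphD, rmorph1) -eps_sqr; ring.
Qed.

Lemma formxx x : inj '[x, x] = inj ka * det2 (phi x).
Proof.
apply: (mulfI two0); rewrite formE /tr2 /det2 /=; ring.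
Qed.

Local Notation GL := {'GL_4[F]}.

Lemma GL_ext (S T : GL) : (forall x : 'rV_4, x *m GLval S = x *m GLval T) -> S = T.
Proof.
move=> h; apply/val_inj/row_matrixP => i; rewrite !rowE.
exact: h.
Qed.

Lemma herm_act m X : herm X -> herm (mul2 m (mul2 X (adj2 (cj2 m)))).
Proof.
case: X => a b c e [h1 h2 h3 h4].
by apply: m2_ext; rewrite /= !(rmorphD, rmorphM, rmorphN) !cjK ?h1 ?h2 ?h3 ?h4; ring.
Qed.

(** * The group Omega as the image of SL(2,L) *)

Definition act (g : sl2 L) (x : 'rV[F]_4) : 'rV[F]_4 :=
  psi (mul2 (adj2 g) (mul2 (phi x) (cj2 g))).

Lemma phi_act g x : phi (act g x) = mul2 (adj2 g) (mul2 (phi x) (cj2 g)).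
Proof.
rewrite /act psiK //.
have -> : cj2 g = adj2 (cj2 (adj2 g)) by apply: m2_ext; rewrite //= ?rmorphN opprK.
by apply: herm_act; apply: phi_herm.
Qed.

Fact act_linear g : linear (act g).
Proof.
move=> a x y; apply: phi_inj; rewrite phiD phiZ !phi_act phiD phiZ.
by apply: m2_ext; rewrite /=; ring.
Qed.
HB.instance Definition _ g :=
  GRing.isLinear.Build F 'rV[F]_4 'rV[F]_4 *:%R (act g) (act_linear g).

Definition rhomx g : 'M[F]_4 := lin1_mx (act g).
Lemma rhomxE g x : x *m rhomx g = act g x.
Proof. by rewrite /rhomx mul_rV_lin1. Qed.

Lemma actM g h x : act h (act g x) = act (g * h)%g x.
Proof.
apply: phi_inj; rewrite !phi_act; apply: m2_ext; rewrite /= !(rmorphD, rmorphM); ring.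
Qed.
Lemma act1 x : act 1%g x = x.
Proof.
by apply: phi_inj; rewrite phi_act; apply: m2_ext; rewrite /= !(rmorph0, rmorph1); ring.
Qed.

Lemma rhomx_unit g : rhomx g \in unitmx.
Proof.
suff /mulmx1_unit[] : rhomx g *m rhomx g^-1%g = 1%:M by [].
apply/row_matrixP => i; rewrite !rowE mulmxA !rhomxE actM mulgV act1 mulmx1 //.
Qed.

Definition rho g : GL := FinRing.unit 'M[F]_4 (rhomx_unit g).

Lemma rhoE g x : x *m GLval (rho g) = act g x.
Proof. exact: rhomxE. Qed.

Lemma rho_morph : {in [set: sl2 L] &, {morph rho : g h / (g * h)%g}}.
Proof. by move=> g h _ _; apply: GL_ext => x; rewrite GL_MxE mulmxA !rhoE actM. Qed.
Canonical rho_morphism := Morphism rho_morph.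
Lemma rhoM g h : rho (g * h)%g = (rho g * rho h)%g.
Proof. by rewrite rho_morph ?inE. Qed.

(** For b true this is the reflection in the identity matrix. *)
Definition flip (b : bool) (X : m2 L) := if b then scale2 (-1) (cj2 X) else X.

(** The shape of a product T of reflections; b is the parity of their number, and
    nu gives the spinor norm. *)
Definition acts_by (b : bool) (T : GL) (m : m2 L) (nu : F) : Prop :=
  [/\ nu != 0, det2 m = inj nu & forall x, phi (x *m GLval T) =
    scale2 (inj nu)^-1 (mul2 m (mul2 (flip b (phi x)) (adj2 (cj2 m))))].

(** Moving m across a reflection in the identity matrix conjugates it. *)
Definition cjif (b : bool) (m : m2 L) := if b then cj2 m else m.

Lemma flipZ b u X : cj u = u -> flip b (scale2 u X) = scale2 u (flip b X).
Proof.
by move=> cu; case: b => //=; apply: m2_ext; rewrite /= rmorphM cu; ring.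
Qed.

Lemma flipM b m X : flip b (mul2 m (mul2 X (adj2 (cj2 m)))) =
  mul2 (cjif b m) (mul2 (flip b X) (adj2 (cj2 (cjif b m)))).
Proof.
by case: b => //=; apply: m2_ext; rewrite /= !(rmorphD, rmorphM, rmorphN, cjK); ring.
Qed.

Lemma flip_flip b c X : flip c (flip b X) = flip (b (+) c) X.
Proof.
by case: b c => [] [] //=; apply: m2_ext; rewrite /= rmorphM rmorphN rmorph1 cjK; ring.
Qed.

Lemma acts_byM b c S T m n mu nu : acts_by b S m mu -> acts_by c T n nu ->
  acts_by (b (+) c) (S * T)%g (mul2 n (cjif c m)) (mu * nu).
Proof.
move=> [mu0 dm hS] [nu0 dn hT]; split.
- by rewrite mulf_neq0.
- rewrite det2M dn rmorphM mulrC; congr (_ * _).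
  by case: c {hT} => //=; rewrite /det2 /= -!rmorphM -rmorphB -/(det2 m) dm cj_inj.
move=> x; rewrite GL_MxE mulmxA hT hS rmorphM invfM.
rewrite flipZ ?fmorphV ?cj_inj // flipM flip_flip cj2M adj2M.
by rewrite mul2Zl mul2Zr !mul2A scale2A mulrC.
Qed.

Lemma formTE x y : '[x, y] = (x *m B *m y^T) 0 0.
Proof. by rewrite /form map_mx_id. Qed.

(** The matrix of a reflection is a perturbation of rank one of the identity, so
    [det_rank1] computes its determinant. *)
Lemma reflection_mx a : '[a, a] != 0 ->
  exists2 T : GL, is_reflection B a T & \det (GLval T) = -1.
Proof.
move=> a0; pose c := 2%:R / '[a, a].
pose M : 'M[F]_4 := 1%:M + (- c *: (B *m a^T)) *m a.
have hM x : x *m M = x - (2%:R * '[x, a] / '[a, a]) *: a.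
  rewrite mulmxDr mulmx1 -scalemxAl -scalemxAr scaleNr; congr (_ - _).
  rewrite !mulmxA [x *m B *m _]mx11_scalar mul_scalar_mx scalerA; congr (_ *: _).
  by rewrite -formTE /c mulrAC.
have MM : M *m M = 1%:M.
  apply/row_matrixP => i; rewrite !rowE mulmxA hM hM mulmx1.
  set x := delta_mx _ _; rewrite formDl -scaleN1r scalerA formZl -scaleNr.
  rewrite -addrA -scalerDl [X in X *: _](_ : _ = 0) ?scale0r ?addr0 //.
  by field.
have [uM _] := mulmx1_unit MM.
exists (FinRing.unit 'M[F]_4 uM).
  by rewrite /is_reflection a0; apply/forallP => x; rewrite /GLval /= hM.
rewrite /GLval /= det_rank1 -scalemxAr mxE mulmxA.
rewrite -formTE.
by rewrite /c mulNr divfK //; ring.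
Qed.

Lemma reflection_uniq a (S T : GL) : is_reflection B a S -> is_reflection B a T -> S = T.
Proof.
move=> /andP[_ /forallP hS] /andP[_ /forallP hT]; apply: GL_ext => x.
by rewrite (eqP (hS x)) (eqP (hT x)).
Qed.

Lemma reflection_det a T : is_reflection B a T -> \det (GLval T) = -1.
Proof.
move=> hT; have [a0 _] := andP hT; have [S hS <-] := reflection_mx a0.
by rewrite (reflection_uniq hT hS).
Qed.

Lemma reflection_acts_by a T : is_reflection B a T -> acts_by true T (phi a) ('[a, a] / ka).
Proof.
case/andP=> a0 /forallP hT.
have ik0 : inj ka != 0 by rewrite fmorph_eq0.
have ha := formxx a.
have da0 : det2 (phi a) != 0.
  by apply: contraNneq a0 => h; rewrite -(fmorph_eq0 inj) ha h mulr0.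
have hd : inj ('[a, a] / ka) = det2 (phi a).
  by rewrite fmorph_div ha mulrC mulKf.
split; first by rewrite mulf_neq0 ?invr_neq0.
  by rewrite hd.
move=> x; rewrite (eqP (hT x)) -scaleNr phiD phiZ hd.
have -> : inj (- (2%:R * '[x, a] / '[a, a])) =
    - (tr2 (mul2 (phi x) (adj2 (phi a))) / det2 (phi a)).
  rewrite rmorphN fmorph_div rmorphM two_inj formE ha.
  by congr (- _); field; rewrite ik0 da0.
have hx := phi_herm x; have hA := phi_herm a.
rewrite /= hx hA; move: da0; rewrite /det2 /tr2.
move: (phi x) (phi a) => [a1 b1 c1 d1] [a2 b2 c2 d2] /= da0.
by apply: m2_ext => /=; field.
Qed.

Lemma form_sym x y : '[x, y] = '[y, x].
Proof. by rewrite !formco; ring. Qed.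

Lemma reflection_orth a T : is_reflection B a T -> T \in orthogonal_group B.
Proof.
case/andP=> a0 /forallP hT; rewrite inE; apply/forallP => x; apply/forallP => y.
rewrite (eqP (hT x)) (eqP (hT y)) -!scaleNr !formDl !formDr !formZl !formZr.
by apply/eqP; rewrite (form_sym a y) /=; field.
Qed.

Lemma orthP (T : GL) : reflect (forall x y : 'rV_4, '[x *m GLval T, y *m GLval T] = '[x, y])
   (T \in orthogonal_group B).
Proof.
rewrite inE; apply: (iffP forallP) => [h x y|h x].
  by move/forallP: (h x) => /(_ y) /eqP.
by apply/forallP => y; rewrite h.
Qed.

(** Induction on a word in the generators; the factor ka accounts for the
    difference between the form and the determinant. *)
Lemma spinor_graph_acts_by T n : (T, n) \in spinor_graph B ->
  exists b m nu s, [/\ acts_by b T m nu, s != 0, FinRing.uval n = ka ^+ b * nu * s ^+ 2 &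
    \det (GLval T) = (-1) ^+ b].
Proof.
case/gen_prodgP => k [c hc hp].
suff: forall r : seq 'I_k, exists b m nu s, [/\ acts_by b (\prod_(i <- r) c i)%g.1 m nu,
  s != 0,
   FinRing.uval (\prod_(i <- r) c i)%g.2 = ka ^+ b * nu * s ^+ 2 &
    \det (GLval (\prod_(i <- r) c i)%g.1) = (-1) ^+ b].
  by move=> /(_ (index_enum 'I_k)); rewrite -hp.
elim=> [|i r [b [m [nu [s [h1 h2 h3 h4]]]]]].
  exists false, (one2 L), 1, 1; rewrite big_nil; split; rewrite ?oner_eq0 ?det1 //=.
    split; rewrite ?oner_eq0 // ?rmorph1 /det2 /=; first by ring.
    move=> x; rewrite mulmx1 /= invr1; apply: m2_ext; rewrite /= !(rmorph0, rmorph1); ring.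
  by ring.
rewrite big_cons.
have := hc i; rewrite inE => /existsP[a /andP[ha /eqP hn]].
have sa := reflection_acts_by ha; have da := reflection_det ha.
have [a0 _] := andP ha.
exists (true (+) b), (mul2 m (cjif b (phi a))), ('[a, a] / ka * nu), (if b then s * ka
  else s).
split.
- exact: acts_byM sa h1.
- by case: b {h1 h3 h4} => //; rewrite mulf_neq0.
- rewrite /= hn h3; case: b {h1 h3 h4} => /=; field; exact: ka0.
by rewrite GL_MxE det_mulmx h4 da; case: b {h1 h3 h4} => /=; ring.
Qed.

(** A determinant 1 makes the number of reflections even. Then nu is a square,
    and dividing m by its root gives a matrix in SL(2,L). *)
Lemma Omega_sub_rho T : T \in Omega B -> exists g, T = rho g.
Proof.
case/setIdP=> /setIdP[_ /eqP dT] /existsP[c hc].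
have [b [m [nu [s [[nu0 dm hm] s0 hn hd]]]]] := spinor_graph_acts_by hc.
have b0 : b = false.
  case: b {hm hn} hd => //; rewrite dT expr1 => h; move: two0F.
  by rewrite -[2%:R]/(1 + 1) {1}h addNr eqxx.
rewrite b0 expr0 mul1r /= in hn hm.
pose r := FinRing.uval c / s.
have hr : nu = r ^+ 2.
  rewrite /r expr_div_n; apply: (mulIf (expf_neq0 2 s0)); rewrite divfK ?expf_neq0 //.
have r0 : inj r != 0.
  by rewrite fmorph_eq0; apply: contraNneq nu0 => h; rewrite hr h expr0n.
clearbody r.
have dg : det2 (adj2 (scale2 (inj r)^-1 m)) == 1.
  have -> : det2 (adj2 (scale2 (inj r)^-1 m)) = (inj r)^-1 ^+ 2 * det2 m.
    by rewrite /det2 /=; ring.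
  by rewrite dm hr rmorphXn -exprMn mulVf // expr1n.
exists (SL2 dg); apply: GL_ext => x; apply: phi_inj; rewrite rhoE phi_act hm hr rmorphXn.
have cr : cj (inj r)^-1 = (inj r)^-1 by rewrite fmorphV cj_inj.
apply: m2_ext; rewrite /= !(rmorphD, rmorphM, rmorphN) cr; field; exact: r0.
Qed.

(** As w2 adj(w1) = det(w1) g^-1, the matrix of g is the product of the reflections
    in w1 and w2, whose norms are equal. *)
Lemma rho_two_reflections (g : sl2 L) w1 w2 : herm w1 -> herm w2 -> det2 w1 != 0 ->
  w2 = mul2 (adj2 g) w1 -> rho g \in Omega B.
Proof.
move=> hw1 hw2 d0 e.
have dw : det2 w2 = det2 w1.
  by rewrite e det2M; have /eqP-> := sl2_inv_subproof g; rewrite mul1r.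
have f1 : inj '[psi w1, psi w1] = inj ka * det2 w1 by rewrite formxx psiK.
have f2 : '[psi w2, psi w2] = '[psi w1, psi w1].
  by apply: (fmorph_inj inj); rewrite !formxx !psiK // dw.
have n1 : '[psi w1, psi w1] != 0.
  by rewrite -(fmorph_eq0 inj) f1 mulf_neq0 // fmorph_eq0.
have n2 : '[psi w2, psi w2] != 0 by rewrite f2.
have [S1 r1 d1] := reflection_mx n1; have [S2 r2 d2] := reflection_mx n2.
have [nu0 dnu hp] := acts_byM (reflection_acts_by r1) (reflection_acts_by r2).
have e12 : rho g = (S1 * S2)%g.
  apply: GL_ext => x; apply: phi_inj; rewrite rhoE phi_act hp.
  pose D := inj ('[psi w1, psi w1] / ka).
  have eD : D = det2 w1 by rewrite /D fmorph_div f1 mulrC mulKf // fmorph_eq0.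
  have D0 : D != 0 by rewrite eD.
  have cD : cj D = D by rewrite /D cj_inj.
  have -> : mul2 (phi (psi w2)) (cjif true (phi (psi w1))) = scale2 D (adj2 g).
    by rewrite /= !psiK // hw1 e eD /det2; apply: m2_ext; rewrite /=; ring.
  rewrite f2 rmorphM -/D /=; clearbody D.
  by apply: m2_ext; rewrite /= !(rmorphM, rmorphN) cD; field.
have uN : '[psi w1, psi w1] \is a GRing.unit by rewrite unitfE.
pose N := FinRing.unit F uN.
have g1 : (S1, N) \in spinor_graph B.
  by apply: mem_gen; rewrite inE; apply/existsP; exists (psi w1); rewrite r1 /=.
have g2 : (S2, N) \in spinor_graph B.
  by apply: mem_gen; rewrite inE; apply/existsP; exists (psi w2); rewrite r2 f2 /=.
apply/setIdP; split.
  apply/setIdP; split.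
    apply/orthP => x y; rewrite e12 GL_MxE !mulmxA.
    by rewrite (orthP _ (reflection_orth r2)) (orthP _ (reflection_orth r1)).
  by rewrite e12 GL_MxE det_mulmx d1 d2 mulrNN mulr1.
apply/existsP; exists N; rewrite e12 expgS expg1.
exact: (groupM g1 g2).
Qed.

(** It suffices to treat elementary matrices. *)
Lemma rho_in_Omega g : rho g \in Omega B.
Proof.
suff H : (rho @*^-1 (Omega_group B))%G = [set: sl2 L] :> {set _}.
  have : g \in (rho @*^-1 (Omega_group B))%g by rewrite /= H inE.
  by case/morphpreP.
have dN (b : L) : b != 0 -> - (eps ^+ 2 * (b * cj b)) != 0.
  by move=> b0; rewrite oppr_eq0 !mulf_neq0 ?expf_neq0 // fmorph_eq0.
apply: sl2_generated => b; apply/morphpreP; (split; first by rewrite inE).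
  have [->|b0] := eqVneq b 0; first by rewrite upper0 morph1 group1.
  pose w1 := Mk2 (- (eps * b)) 0 0 (eps * cj b).
  apply: (@rho_two_reflections _ w1 (mul2 (adj2 (upper b)) w1)) => //.
  - by apply: m2_ext; rewrite /= ?(rmorphN, rmorphM, rmorph0, cjK, cj_eps); ring.
  - by apply: m2_ext; rewrite /= !(rmorphD, rmorphN, rmorphM, rmorph0, rmorph1, cjK,
      cj_eps); ring.
  rewrite (_ : det2 _ = - (eps ^+ 2 * (b * cj b))) ?dN //.
  by rewrite /det2 /=; ring.
have [->|b0] := eqVneq b 0; first by rewrite lower0 morph1 group1.
pose w1 := Mk2 (eps * cj b) 0 0 (- (eps * b)).
apply: (@rho_two_reflections _ w1 (mul2 (adj2 (lower b)) w1)) => //.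
- by apply: m2_ext; rewrite /= ?(rmorphN, rmorphM, rmorph0, cjK, cj_eps); ring.
- by apply: m2_ext; rewrite /= !(rmorphD, rmorphN, rmorphM, rmorph0, rmorph1, cjK,
    cj_eps); ring.
rewrite (_ : det2 _ = - (eps ^+ 2 * (b * cj b))) ?dN //.
by rewrite /det2 /=; ring.
Qed.

Lemma Omega_rho : Omega B = (rho @* [set: sl2 L])%g.
Proof.
apply/setP => T; apply/idP/idP => [/Omega_sub_rho[g ->]|/morphimP[g _ _ ->]].
  by rewrite mem_morphim ?inE.
exact: rho_in_Omega.
Qed.

(** * Elements with an eigenplane orthogonal to v *)

(** Put D = k - l adj(g). As X adj(g) = g X - tr(X g) for traceless X, both X D
    and Y D are scalar. Since X is invertible and X^2 is scalar, D is a multiple of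
    X; then Y D is a multiple of Y X, which has trace 0 by orthogonality, so the
    scalar Y D is 0 and so is D. *)
Lemma eigenplane_eq (X Y g k : m2 L) l : e22 X = - e11 X -> e22 Y = - e11 Y ->
  mul2 X k = scale2 l (mul2 g X) -> mul2 Y k = scale2 l (mul2 g Y) ->
  det2 X != 0 -> 2%:R * e11 X * e11 Y + e12 X * e21 Y + e21 X * e12 Y = 0 ->
  Y <> Mk2 0 0 0 0 -> k = scale2 l (adj2 g).
Proof.
case: X Y g k => [x y z ?] [x' y' z' ?] [a b c e] [a1 b1 c1 e1] /= -> ->.
move=> [h1 h2 h3 h4] [k1 k2 k3 k4]; rewrite /det2 /= => dX o Y0.
pose t := l * (x * a + y * c + z * b - x * e).
have D1 : (a1 - l * e) * (x * - x - y * z) = - (t * x).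
  apply: (eq_by_sub (congr2 (fun u v => - (x * u + y * v)) h1 h3)); rewrite /t; ring.
have D2 : (b1 + l * b) * (x * - x - y * z) = - (t * y).
  apply: (eq_by_sub (congr2 (fun u v => - (x * u + y * v)) h2 h4)); rewrite /t; ring.
have D3 : (c1 + l * c) * (x * - x - y * z) = - (t * z).
  apply: (eq_by_sub (congr2 (fun u v => - (z * u - x * v)) h1 h3)); rewrite /t; ring.
have D4 : (e1 - l * a) * (x * - x - y * z) = t * x.
  apply: (eq_by_sub (congr2 (fun u v => - (z * u - x * v)) h2 h4)); rewrite /t; ring.
suff t0 : t = 0.
  rewrite t0 !mul0r ?oppr0 in D1 D2 D3 D4.
  have z0 u : u * (x * - x - y * z) = 0 -> u = 0.
    by move/eqP; rewrite mulf_eq0 (negPf dX) orbF => /eqP.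
  move: (z0 _ D1) (z0 _ D2) (z0 _ D3) (z0 _ D4) => /eqP; rewrite subr_eq0 => /eqP-> /eqP.
  rewrite addr_eq0 => /eqP-> /eqP; rewrite addr_eq0 => /eqP-> /eqP; rewrite subr_eq0 =>
    /eqP->.
  by apply: m2_ext; rewrite /=; ring.
apply/eqP; apply: contra_notT Y0 => t0.
have Y12 : x' * (b1 + l * b) + y' * (e1 - l * a) = 0 by apply: (eq_by_sub k2); ring.
have Y21 : z' * (a1 - l * e) - x' * (c1 + l * c) = 0 by apply: (eq_by_sub k3); ring.
have Ytr : x' * (a1 - l * e) + y' * (c1 + l * c) = z' * (b1 + l * b) - x' * (e1 - l * a).
  by apply: (eq_by_sub (congr2 (fun u v => u - v) k1 k4)); ring.
have P1 : x * y' = x' * y.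
  move/(congr1 ( *%R^~ (x * - x - y * z))): Y12; rewrite mulrDl -!mulrA D2 D4 mul0r => h.
  by apply: (mulfI t0); apply: (eq_by_sub h); ring.
have P2 : x' * z = x * z'.
  move/(congr1 ( *%R^~ (x * - x - y * z))): Y21; rewrite mulrBl -!mulrA D1 D3 mul0r => h.
  by apply: (mulfI t0); apply: (eq_by_sub h); ring.
have P3 : z' * y = y' * z.
  move/(congr1 ( *%R^~ (x * - x - y * z))): Ytr; rewrite mulrDl mulrBl -!mulrA D1 D2 D3
    D4 => h.
  by apply: (mulfI t0); apply: (eq_by_sub h); ring.
have P4 : x * x' + y * z' = 0.
  by apply: (mulfI two0); rewrite mulr0; apply: (eq_by_sub (congr2 +%R o P3)); ring.
have dX' : x * x + y * z != 0.
  by rewrite -oppr_eq0; apply: contraNneq dX => h; apply/eqP; rewrite -[RHS]h; ring.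
have z0 u : (x * x + y * z) * u = 0 -> u = 0.
  by move/eqP; rewrite mulf_eq0 (negPf dX') => /eqP.
have x0 : x' = 0.
  apply: z0; apply: (eq_by_sub (congr2 (fun u v => x * u + y * v) P4 P2)); ring.
rewrite x0 !mul0r mulr0 add0r in P1 P2 P3 P4.
have y0 : y' = 0.
  apply: z0; apply: (eq_by_sub (congr2 +%R (congr2 (fun u v => x * u - y * v) P1 P3)
    (congr1 ( *%R y) P4))); ring.
have zz : z' = 0.
  by apply: z0; apply: (eq_by_sub (congr2 (fun u v => z * u - x * v) P4 P2)); ring.
by rewrite x0 y0 zz oppr0.
Qed.

Lemma perpE x v : (x <= orthomx idfun B v)%MS = ('[x, v] == 0).
Proof.
apply/sub_kermxP/eqP => h; rewrite map_mx_id // in h *.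
  by rewrite formTE -mulmxA h mxE.
by apply/matrixP => a b; rewrite !ord1 mulmxA -formTE h mxE.
Qed.

Lemma sub_perpP (U : 'M[F]_4) v :
  reflect (forall x, (x <= U)%MS -> '[x, v] = 0) (U <= orthomx idfun B v)%MS.
Proof.
apply: (iffP idP) => [h x xU|h].
  by apply/eqP; rewrite -perpE (submx_trans xU).
by apply/rV_subP => x /h; rewrite perpE => ->.
Qed.

Hypothesis witt : witt_index B = 1%N.

(** A totally isotropic plane contradicts the Witt index. *)
Lemma witt_rank (U : 'M[F]_4) : (1 < \rank U)%N ->
  exists2 x, (x <= U)%MS & '[x, x] != 0.
Proof.
move=> rU; have [/existsP[x /andP[xU x0]]|no] := boolP [exists x : 'rV_4, (x <= U)%MS &&
  ('[x, x] != 0)].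
  by exists x.
have h x : (x <= U)%MS -> '[x, x] = 0.
  move=> xU; apply/eqP; apply: contraNT no => x0.
  by apply/existsP; exists x; rewrite xU.
suff h1 : (\rank U <= witt_index B)%N by move: rU; rewrite ltnNge (leq_trans h1) // witt.
apply: (leq_bigmax_cond (F := fun W : 'M[F]_4 => \rank W)).
rewrite /totally_isotropic; apply/rV_subP => x xU.
apply/sub_kermxP; rewrite map_mx_id // mulmxA; apply/matrixP => a j.
have yU := row_sub j U; set y := row j U in yU.
have -> : (x *m B *m U^T) a j = '[x, y].
  by rewrite !ord1 formTE !mxE; apply: eq_bigr => k _; rewrite !mxE.
rewrite [RHS]mxE.
have := h _ (addmx_sub xU yU); rewrite formDl !formDr h // (h y yU) (form_sym y x) => /eqP.
by rewrite add0r addr0 -mulr2n -mulr_natl mulf_eq0 (negPf two0F) => /eqP.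
Qed.

Variable v : 'rV[F]_4.
Hypothesis phi_v : phi v = one2 L.

Lemma perp_tr x : ('[x, v] == 0) = (tr2 (phi x) == 0).
Proof.
rewrite -(fmorph_eq0 inj) -(inj_eq (mulfI two0)) formE mulr0 mulf_eq0 fmorph_eq0 (negPf
  ka0) /=.
by congr (_ == 0); rewrite phi_v /tr2 /=; ring.
Qed.

Lemma mul2_adjK (g : sl2 L) X : mul2 (adj2 g) (mul2 g X) = X.
Proof.
by apply: m2_ext; rewrite /= -[RHS]mul1r -(sl2_det g); ring.
Qed.
Lemma mul2_adjKV (g : sl2 L) X : mul2 g (mul2 (adj2 g) X) = X.
Proof.
by apply: m2_ext; rewrite /= -[RHS]mul1r -(sl2_det g); ring.
Qed.

Lemma twistedP (g : sl2 L) : reflect (exists2 s, s = 1 \/ s = -1 & cj2 g = scale2 s (adj2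
  g))
  (twisted cj g).
Proof.
apply: (iffP orP) => [[]/eqP h|[s [] ->]].
- exists 1; [by left | have := congr1 (@sl2val L) h => /= ->].
  by apply: m2_ext => /=; ring.
- exists (-1); [by right | have := congr1 (@sl2val L) h => /= ->].
  by apply: m2_ext => /=; ring.
- move=> h; left; apply/eqP/val_inj => /=; rewrite h.
  by apply: m2_ext => /=; ring.
move=> h; right; apply/eqP/val_inj => /=; rewrite h.
by apply: m2_ext => /=; ring.
Qed.

(** The plane contains a nonisotropic vector x1, on which l^2 = 1 can be read
    off, and a nonzero vector orthogonal to x1. *)
Lemma plane_twisted g : rho g \in perp_eigenplane_set B v -> twisted cj g.
Proof.
case/setIdP => /setIdP[/setIdP[/orthP og _] _] /existsP[U /and3P[/eqP rU UP /existsP[l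
  /eqP hl]]].
have hU (x : 'rV_4) : (x <= U)%MS -> x *m GLval (rho g) = l *: x.
  by case/submxP=> D ->; rewrite -mulmxA hl scalemxAr.
have [|x1 x1U n1] := @witt_rank U; first by rewrite rU.
have : ~~ (U <= x1)%MS.
  by apply/negP => /mxrankS; rewrite rU leqNgt ltnS rank_leq_row.
case/row_subPn => i yx1.
set y0 := row i U in yx1; have y0U : (y0 <= U)%MS := row_sub i U.
pose x2 := y0 - ('[y0, x1] / '[x1, x1]) *: x1.
have x2U : (x2 <= U)%MS by rewrite addmx_sub ?eqmx_opp ?scalemx_sub.
have o12 : '[x2, x1] = 0.
  by rewrite /x2 -scaleNr formDl formZl mulNr divfK // subrr.
have x20 : x2 != 0.
  by apply: contraNneq yx1 => /eqP; rewrite subr_eq0 => /eqP->; rewrite scalemx_sub.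
have l2 : l ^+ 2 = 1.
  have := og x1 x1; rewrite hU // formZl formZr mulrA -expr2 => h.
  by apply: (mulIf n1); rewrite mul1r.
have ktr x : (x <= U)%MS -> e22 (phi x) = - e11 (phi x).
  by move=> /(sub_perpP _ _ UP) /eqP; rewrite perp_tr /tr2 addrC addr_eq0 => /eqP.
have kx x : (x <= U)%MS -> mul2 (phi x) (cj2 g) = scale2 (inj l) (mul2 g (phi x)).
  move=> xU; have := congr1 (mul2 g \o phi) (hU x xU).
  by rewrite /= rhoE phi_act mul2_adjKV phiZ mul2Zr.
have dX : det2 (phi x1) != 0.
  by apply: contraNneq n1 => h; rewrite -(fmorph_eq0 inj) formxx h mulr0.
have h := eigenplane_eq (ktr _ x1U) (ktr _ x2U) (kx _ x1U) (kx _ x2U) dX _ _.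
apply/twistedP; exists (inj l).
  move/eqP: l2; rewrite sqrf_eq1 => /orP[]/eqP->; [left|right]; by rewrite ?rmorphN rmorph1.
apply: h.
  have := formE x2 x1; rewrite o12 rmorph0 mulr0 => /esym/eqP.
  rewrite mulf_eq0 fmorph_eq0 (negPf ka0) => /eqP.
  move: (ktr _ x1U) (ktr _ x2U).
  move: (phi x1) (phi x2) => [a1 b1 c1 e1] [a2 b2 c2 e2]; rewrite /tr2 /= => -> -> h'.
  by apply/eqP; rewrite -oppr_eq0; apply/eqP; apply: (eq_by_sub h'); ring.
by move=> e; case/eqP: x20; apply: phi_inj; rewrite e phi0.
Qed.

(** For traceless X with tr(X g) = 0 one has X adj(g) = g X, so a twisted g acts
    on X as the scalar s. The condition tr(X g) = 0 is orthogonality to adj(g), or to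
    eps adj(g) if s = -1. *)
Lemma twisted_plane g : twisted cj g -> rho g \in perp_eigenplane_set B v.
Proof.
case/twistedP=> s hs hg; apply/setIdP; split; first exact: rho_in_Omega.
(* the factor t makes t adj(g) a vector of the model *)
pose t : L := if s == 1 then 1 else eps.
have t0 : t != 0 by rewrite /t; case: ifP => _ //; apply: oner_neq0.
have hW : herm (scale2 t (adj2 g)).
  case: hg => h1 h2 h3 h4.
  have ct : cj t * s = t.
    rewrite /t; case: hs => ->; first by rewrite eqxx rmorph1 mulr1.
    by rewrite eq_sym -addr_eq0 (negPf two0) cj_eps mulrN1 opprK.
  by apply: m2_ext; rewrite /= rmorphM ?rmorphN ?h1 ?h2 ?h3 ?h4 -{2}ct; ring.
pose w := psi (scale2 t (adj2 g)).
pose K := orthomx idfun B (col_mx v w).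
have rK : (1 < \rank K)%N.
  rewrite mxrank_ker; have := rank_leq_col (B *m map_mx idfun (col_mx v w)^T).
  by move: (\rank _) => [|[|[|?]]].
(* K has dimension 3 when g is central, so a plane is cut out of it *)
pose U : 'M[F]_4 := (pid_mx 2 : 'M_(4, \rank K)) *m row_base K.
have UK : (U <= K)%MS by rewrite (submx_trans (submxMl _ _)) // eq_row_base.
have hU (x : 'rV_4) : (x <= U)%MS -> '[x, v] = 0 /\ '[x, w] = 0.
  move=> xU; have := submx_trans xU UK => /sub_kermxP.
  rewrite map_mx_id // tr_col_mx mul_mx_row mul_mx_row -[0]row_mx0 => /eq_row_mx[h1 h2].
  by rewrite !formTE -!mulmxA h1 h2 mxE.
apply/existsP; exists U; apply/and3P; split.
- by rewrite mxrankMfree ?row_base_free // rank_pid_mx.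
- by apply/sub_perpP => x /hU[].
apply/existsP; exists (if s == 1 then 1 else -1).
apply/eqP/row_matrixP => i; rewrite row_mul rhoE linearZ /=.
set x := row i U; have [xv xw] := hU x (row_sub i U).
apply: phi_inj; rewrite phi_act phiZ.
have -> : inj (if s == 1 then 1 else -1) = s.
  case: hs => ->; first by rewrite eqxx rmorph1.
  by rewrite eq_sym -addr_eq0 (negPf two0) rmorphN rmorph1.
have tx : e22 (phi x) = - e11 (phi x).
  by move/eqP: xv; rewrite perp_tr /tr2 addrC addr_eq0 => /eqP.
rewrite hg mul2Zr mul2Zr; congr scale2.
suff -> : mul2 (phi x) (adj2 g) = mul2 g (phi x) by rewrite mul2_adjK.
have := formE x w; rewrite xw rmorph0 mulr0 psiK // => /esym/eqP.
rewrite mulf_eq0 fmorph_eq0 (negPf ka0) => /eqP.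
move: tx; move: (phi x) => [a b c e] /= -> h.
have {}h : a * e11 g + b * e21 g + c * e12 g - a * e22 g = 0.
  apply: (mulfI t0); apply: (eq_by_sub h); rewrite /tr2 /=; ring.
apply: m2_ext; rewrite /=; [apply: (eq_by_sub (esym h)) | | | apply: (eq_by_sub (esym
  h))]; ring.
Qed.

Lemma planeE g : (rho g \in perp_eigenplane_set B v) = twisted cj g.
Proof. by apply/idP/idP; [apply: plane_twisted | apply: twisted_plane]. Qed.

(** * The coclique and its maximality *)

(** A line fixed by all unipotent elements is spanned by a matrix with zero
    entries off the diagonal; the parameters 1 and eps then annihilate the diagonal. *)
Lemma no_fixed_line (w : 'rV[F]_4) : w != 0 ->
  exists g, ~~ (w *m GLval (rho g) <= w)%MS.
Proof.
move=> w0; apply/existsP; apply: contraNT w0; rewrite negb_exists => /forallP h.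
have hl g : exists l, phi (act g w) = scale2 (inj l) (phi w).
  by have := h g; rewrite negbK rhoE => /sub_rVP[l ->]; exists l; rewrite phiZ.
have hu b : exists l, mul2 (adj2 (upper b)) (mul2 (phi w) (cj2 (upper b))) = scale2 (inj
  l) (phi w).
  by have [l e] := hl (upper b); exists l; rewrite -e phi_act.
have hw b : exists l, mul2 (adj2 (lower b)) (mul2 (phi w) (cj2 (lower b))) = scale2 (inj
  l) (phi w).
  by have [l e] := hl (lower b); exists l; rewrite -e phi_act.
suff h0 : phi w = Mk2 0 0 0 0 by apply/eqP; apply: phi_inj; rewrite h0 phi0.
clear hl h; case: (phi w) hu hw => x y z t hu hw.
have lin b : cj b = b -> b != 0 -> z = 0 /\ y = 0.
  move=> cb b0; split; apply/eqP.
    have [l [k1 k2 k3 k4]] := hu b; rewrite /= !(rmorph0, rmorph1) cb in k1 k2 k3 k4.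
    apply/idPn => z0.
    have l1 : inj l = 1 by apply: (mulIf z0); apply: (eq_by_sub (esym k3)); ring.
    rewrite l1 in k4; case/negP: z0; rewrite -(mulrI_eq0 _ (lregP (mulf_neq0 b0
      (oner_neq0 L)))) mulr1; apply/eqP.
    by apply: (eq_by_sub k4); ring.
  have [l [k1 k2 k3 k4]] := hw b; rewrite /= !(rmorph0, rmorph1) cb in k1 k2 k3 k4.
  apply/idPn => y0.
  have l1 : inj l = 1 by apply: (mulIf y0); apply: (eq_by_sub (esym k2)); ring.
  rewrite l1 in k1; case/negP: y0; rewrite -(mulrI_eq0 _ (lregP (mulf_neq0 b0 (oner_neq0
    L)))) mulr1; apply/eqP.
  by apply: (eq_by_sub k1); ring.
have [z0 y0] := lin 1 (rmorph1 cj) (oner_neq0 L).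
have xt b : x * cj b = b * t.
  have [l [k1 k2 k3 k4]] := hu b; rewrite /= !(rmorph0, rmorph1) z0 y0 in k1 k2 k3 k4.
  by apply: (eq_by_sub k2); ring.
have := xt 1; rewrite rmorph1 mulr1 mul1r => e.
have := xt eps; rewrite cj_eps e => e'.
have t0 : t = 0.
  by apply: (mulfI (mulf_neq0 two0 eps0)); apply: (eq_by_sub (esym e')); ring.
by rewrite t0 z0 y0.
Qed.

Lemma rank_perp : \rank (orthomx idfun B v) = 3%N.
Proof.
have : (\rank (B *m map_mx idfun v^T) <= 1)%N := rank_leq_col _.
rewrite mxrank_ker leq_eqVlt ltnS leqn0 => /orP[/eqP-> //|].
rewrite mxrank_eq0 map_mx_id // => /eqP h.
have := perp_tr v; rewrite formTE -mulmxA h mulmx0 mxE eqxx phi_v /tr2 /=.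
by rewrite -[1 + 1]/(2%:R) (negPf two0).
Qed.

Lemma plane_coclique : coclique (Omega_group B) (perp_eigenplane_set B v).
Proof.
split; first by apply/subsetP => T /setIdP[].
move=> S T /setIdP[SO /existsP[U /and3P[/eqP rU UP /existsP[l /eqP hl]]]].
move=> /setIdP[TO /existsP[W /and3P[/eqP rW WP /existsP[k /eqP hk]]]] e.
have : (0 < \rank (U :&: W))%N.
  have := mxrank_sum_cap U W; rewrite rU rW.
  have := mxrankS (_ : U + W <= orthomx idfun B v)%MS; rewrite rank_perp addsmx_sub UP WP
    => /(_ isT).
  by move: (\rank _) (\rank _) => a b; clear; lia.
rewrite lt0n mxrank_eq0 => /rowV0Pn[w]; rewrite sub_capmx => /andP[wU wW] w0.
have [g /negP hg] := no_fixed_line w0; apply: hg.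
pose St : {set {'GL_4[F]}} := [set X : {'GL_4[F]} | (w *m GLval X <= w)%MS].
have gSt : group_set St.
  apply/group_setP; split=> [|X Y]; first by rewrite inE mulmx1.
  rewrite !inE => hX hY; rewrite GL_MxE mulmxA (submx_trans _ hY) //.
  by rewrite submxMr.
suff /subsetP/(_ _ (rho_in_Omega g)) : Omega B \subset Group gSt by rewrite inE.
have -> : Omega B = <<[set S; T]>>%g by [].
rewrite gen_subG; apply/subsetP => X; rewrite !inE => /orP[]/eqP->.
  by case/submxP: wU => D ->; rewrite -mulmxA hl -scalemxAr scalemx_sub.
by case/submxP: wW => D ->; rewrite -mulmxA hk -scalemxAr scalemx_sub.
Qed.

Hypothesis generationH : forall g, ~~ twisted cj g ->
  exists2 h, twisted cj h & <<[set g; h]>>%g = [set: sl2 L].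

Lemma plane_maximal : maximal_coclique (Omega_group B) (perp_eigenplane_set B v).
Proof.
split=> [|C [CO hC] AC]; first exact: plane_coclique.
apply/eqP; rewrite eqEsubset AC /=; apply/subsetP => T TC.
have [g e] := Omega_sub_rho (subsetP CO T TC).
rewrite e planeE; apply: contraT => /generationH[h th hgen].
have hCC : rho h \in C by apply: (subsetP AC); rewrite planeE.
have himg : (rho @* <<[set g; h]>> = <<[set T; rho h]>>)%g.
  by rewrite morphim_gen ?subsetT // morphimU !morphim_set1 ?inE // e.
by case: (hC _ _ TC hCC); rewrite -himg hgen /= Omega_rho.
Qed.

Lemma rho_eq g h : rho g = rho h -> (g * h^-1)%g \in pm1 L.
Proof.
move=> e; set k := (g * h^-1)%g.
have k1 : rho k = 1%g by rewrite rhoM e -rhoM mulgV morph1.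
clearbody k.
have ak X : herm X -> mul2 X (cj2 k) = mul2 k X.
  move=> hX; have := phi_act k (psi X); rewrite -rhoE k1 mulmx1 psiK // => h1.
  by rewrite {2}h1 mul2_adjKV.
have h1 : herm (one2 L) by apply: m2_ext; rewrite /= ?(rmorph0, rmorph1); ring.
have h2 : herm (Mk2 0 eps 0 0) by apply: m2_ext; rewrite /= ?(rmorph0, rmorph1, cj_eps);
  ring.
have h3 : herm (Mk2 0 0 eps 0) by apply: m2_ext; rewrite /= ?(rmorph0, rmorph1, cj_eps);
  ring.
have := ak _ h1; have := ak _ h2; have := ak _ h3.
move=> [a1 a2 a3 a4] [b1 b2 b3 b4] [c1 c2 c3 c4].
apply/pm1P; split; [|split]; apply: (mulfI eps0).
- by apply: (eq_by_sub (esym a1)); ring.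
- by apply: (eq_by_sub (esym b4)); ring.
apply: (eq_by_sub (congr2 (fun u w => eps * u - w) (esym c1) (esym a3))); ring.
Qed.

Hypothesis card_L : #|L| = (#|F| ^ 2)%N.

(** * Counting *)

Definition Nm (a : L) : F := re (a * cj a).

Lemma NmE a : inj (Nm a) = a * cj a.
Proof. by apply/esym/cj_fix; rewrite rmorphM cjK mulrC. Qed.

Lemma NmM a b : Nm (a * b) = Nm a * Nm b.
Proof. by apply: (fmorph_inj inj); rewrite rmorphM !NmE rmorphM; ring. Qed.

Lemma Nm_eq0 a : (Nm a == 0) = (a == 0).
Proof. by rewrite -(fmorph_eq0 inj) NmE mulf_eq0 fmorph_eq0 orbb. Qed.

Lemma Nm_surj k : exists a, Nm a = k.
Proof.
have d0 : - d != 0.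
  by rewrite oppr_eq0 -(fmorph_eq0 inj) -eps_sqr expf_neq0.
have [x [y h]] := conic k (oner_neq0 F) d0.
exists (inj x + eps * inj y); apply: (fmorph_inj inj); rewrite NmE -h.
by rewrite !(rmorphD, rmorphM, rmorphN, rmorph1, cj_inj, cj_eps) -eps_sqr; ring.
Qed.

(** The norm is multiplicative and surjective, so its nonzero fibres have the
    same number of elements. *)
Lemma card_Nm k : k != 0 -> #|[set a | Nm a == k]| = #|F|.+1.
Proof.
have cst l : l != 0 -> #|[set a | Nm a == l]| = #|[set a | Nm a == 1]|.
  move=> l0; have [b hb] := Nm_surj l.
  have b0 : b != 0 by rewrite -Nm_eq0 hb.
  rewrite -[RHS](card_imset _ (mulfI b0)); apply: eq_card => a; rewrite inE.
  apply/eqP/imsetP => [h|[c + ->]]; last by rewrite inE NmM hb => /eqP->; rewrite mulr1.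
  exists (b^-1 * a); rewrite ?mulVKf // inE NmM h.
  have : Nm b^-1 * Nm b == 1.
    by rewrite -NmM mulVf // -(inj_eq (fmorph_inj inj)) NmE !rmorph1 mulr1.
  by rewrite hb.
move=> k0; rewrite cst //.
have : #|L| = (1 + (#|F| - 1) * #|[set a | Nm a == 1%R]|)%N.
  rewrite -[LHS]sum1_card (partition_big Nm xpredT) //= (bigD1 0) //=; congr (_ + _)%N.
    rewrite sum1_card -[RHS](cards1 (0 : L)); apply: eq_card => a.
    by rewrite in_set1 -Nm_eq0.
  have -> : (#|F| - 1)%N = #|[set x : F | x != 0]|.
    have := cardsC1 (0 : F); rewrite subn1 => <-.
    by apply: eq_card => x; rewrite !inE.
  rewrite -sum_nat_const; apply: eq_big => [x|x x0]; first by rewrite inE.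
  rewrite -(cst x) // sum1_card; apply: eq_card => a.
  by rewrite inE unfold_in.
rewrite card_L; have := card_finNzRing_gt1 F; move: #|F| #|_| => q c q1 h.
have : ((q - 1) * c = (q - 1) * q.+1)%N by clear k0 k; nia.
by move/eqP; rewrite eqn_pmul2l ?subn_gt0 // => /eqP.
Qed.

(** Sum over the pairs (x, y): the norm takes the value 0 once and each other
    value q + 1 times. *)
Lemma card_triples (a b : F) : a != 0 -> b != 0 ->
  #|[set z : L * (F * F) | Nm z.1 == a + b * z.2.1 * z.2.2]| = (#|F| ^ 3 + #|F|)%N.
Proof.
move=> a0 b0; set T := [set z | _].
have -> : #|T| = (\sum_(w : F * F) #|[set c | Nm c == (a + b * w.1 * w.2)%R]|)%N.
  rewrite -sum1_card (partition_big snd xpredT) //=; apply: eq_bigr => w _.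
  rewrite -(card_imset (f := fun c => (c, w)) _ (fun x y e => congr1 fst e)) -sum1_card.
  apply: eq_bigl => -[c w']; rewrite inE /=.
  apply/andP/imsetP => [[h /eqP<-]|[c']]; first by exists c; rewrite ?inE.
  by rewrite inE => h [-> ->].
rewrite (bigID (fun w : F * F => a + b * w.1 * w.2 == 0)) /=.
have -> : (\sum_(w : F * F | (a + b * w.1 * w.2 == 0)%R) #|[set c | Nm c == (a + b * w.1
  * w.2)%R]| = #|F| - 1)%N.
  rewrite -(card_hyperbola a0 b0) -sum1_card; apply: eq_big => [w|w /eqP->].
    by rewrite inE.
  rewrite -[RHS](cards1 (0 : L)); apply: eq_card => c; by rewrite !inE Nm_eq0.
rewrite (eq_bigr (fun _ => #|F|.+1)) => [|w h]; last exact: card_Nm.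
rewrite sum_nat_const.
have -> : #|[pred w : F * F | a + b * w.1 * w.2 != 0]| = (#|F| ^ 2 - (#|F| - 1))%N.
  rewrite -(card_hyperbola a0 b0) -mulnn -card_prod -(cardsC [set w : F * F | a + b * w.1
    * w.2 == 0]).
  by rewrite addKn; apply: eq_card => w; rewrite !inE.
have := card_finNzRing_gt1 F; move: #|F| => q q1.
have [m ->] : exists m, q = m.+1 by exists q.-1; rewrite prednK // ltnW.
rewrite subn1 /= -mulnn.
have -> : (m.+1 * m.+1 - m = m * m + m + 1)%N by nia.
nia.
Qed.

Lemma card_twisted_pos :
  #|[set g : sl2 L | cj2 g == adj2 g]| = (#|F| ^ 3 + #|F|)%N.
Proof.
have d0 : d != 0 by rewrite -(fmorph_eq0 inj) -eps_sqr expf_neq0.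
rewrite -(card_triples (oner_neq0 F) d0).
pose f (g : sl2 L) := (e11 g, (im (e12 g), im (e21 g))).
have ent (g : sl2 L) : cj2 g = adj2 g -> [/\ e22 g = cj (e11 g), e12 g = eps * inj (im
  (e12 g))
     & e21 g = eps * inj (im (e21 g))].
  by move=> [h1 h2 h3 h4]; split; [rewrite h1 | apply: cj_anti | apply: cj_anti].
rewrite -(card_in_imset (f := f)); last first.
  move=> g h; rewrite !inE => /eqP/ent[g1 g2 g3] /eqP/ent[h1 h2 h3] [e1 e2 e3].
  apply: sl2_ext; [exact: e1 | by rewrite g2 h2 e2 | by rewrite g3 h3 e3 | by rewrite g1
    h1 e1].
apply: eq_card => -[a [x y]]; rewrite [RHS]inE /=; apply/imsetP/eqP => [[g + [-> -> ->]]|h].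
  rewrite inE => /eqP/ent[g1 g2 g3]; apply: (fmorph_inj inj).
  rewrite NmE -g1 !(rmorphD, rmorphM, rmorph1) -eps_sqr.
  have := sl2_det g; rewrite {1}g2 {1}g3 => hd.
  by apply: (eq_by_sub hd); ring.
have hN : a * cj a = 1 + eps ^+ 2 * inj x * inj y.
  by rewrite -NmE h !(rmorphD, rmorphM, rmorph1) -eps_sqr.
have hd : det2 (Mk2 a (eps * inj x) (eps * inj y) (cj a)) == 1.
  by apply/eqP; rewrite /det2 /=; apply: (eq_by_sub hN); ring.
have him z : im (eps * inj z) = z by have [_] := re_im 0 z; rewrite rmorph0 add0r.
exists (SL2 hd); last by rewrite /f /= !him.
by rewrite inE; apply/eqP/m2_ext; rewrite /= ?cjK ?rmorphM ?cj_inj ?cj_eps //; ring.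
Qed.

Lemma card_twisted_neg :
  #|[set g : sl2 L | cj2 g == scale2 (-1) (adj2 g)]| = (#|F| ^ 3 + #|F|)%N.
Proof.
have n0 : (-1 : F) != 0 by rewrite oppr_eq0 oner_neq0.
rewrite -(card_triples n0 n0).
pose f (g : sl2 L) := (e11 g, (re (e12 g), re (e21 g))).
have ent (g : sl2 L) : cj2 g = scale2 (-1) (adj2 g) -> [/\ e22 g = - cj (e11 g), e12 g =
  inj (re (e12 g))
     & e21 g = inj (re (e21 g))].
  move=> [h1 h2 h3 h4]; split; first by rewrite h1 mulN1r opprK.
    by apply: cj_fix; rewrite h2 mulN1r opprK.
  by apply: cj_fix; rewrite h3 mulN1r opprK.
rewrite -(card_in_imset (f := f)); last first.
  move=> g h; rewrite !inE => /eqP/ent[g1 g2 g3] /eqP/ent[h1 h2 h3] [e1 e2 e3].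
  apply: sl2_ext; [exact: e1 | by rewrite g2 h2 e2 | by rewrite g3 h3 e3 | by rewrite g1
    h1 e1].
apply: eq_card => -[a [x y]]; rewrite [RHS]inE /=; apply/imsetP/eqP => [[g + [-> -> ->]]|h].
  rewrite inE => /eqP/ent[g1 g2 g3]; apply: (fmorph_inj inj).
  rewrite NmE !(rmorphD, rmorphM, rmorphN, rmorph1).
  have := sl2_det g; rewrite g1 {1}g2 {1}g3 => hd.
  by apply: (eq_by_sub (esym hd)); ring.
have hN : a * cj a = - 1 - inj x * inj y.
  by rewrite -NmE h !(rmorphD, rmorphM, rmorphN, rmorph1); ring.
have hd : det2 (Mk2 a (inj x) (inj y) (- cj a)) == 1.
  by apply/eqP; rewrite /det2 /=; apply: (eq_by_sub (esym hN)); ring.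
have hre z : re (inj z) = z by have [+ _] := re_im z 0; rewrite rmorph0 mulr0 addr0.
exists (SL2 hd); last by rewrite /f /= !hre.
by rewrite inE; apply/eqP/m2_ext; rewrite /= ?rmorphN ?cjK ?cj_inj //; ring.
Qed.

Lemma card_twisted : #|[set g : sl2 L | twisted cj g]| = (2 * (#|F| ^ 3 + #|F|))%N.
Proof.
have -> : [set g | twisted cj g] = [set g : sl2 L | cj2 g == adj2 g] :|:
    [set g : sl2 L | cj2 g == scale2 (-1) (adj2 g)].
  have s1 (X : m2 L) : scale2 1 X = X by apply: m2_ext; rewrite /= mul1r.
  apply/setP => g; rewrite !inE; apply/twistedP/orP => [[s [] ->]|].
  - by rewrite s1 => ->; left.
  - by move=> ->; right.
  by case=> /eqP e; [exists 1; [left|rewrite s1] | exists (-1); [right|]].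
rewrite cardsU card_twisted_pos card_twisted_neg.
have -> : [set g : sl2 L | cj2 g == adj2 g] :&: [set g : sl2 L | cj2 g == scale2 (-1)
  (adj2 g)] = set0.
  apply/setP => g; rewrite !inE; apply/negP => /andP[/eqP-> /eqP[h1 h2 h3 h4]].
  have z0 (x : L) : x = -1 * x -> x = 0.
    by move=> h; apply: (mulfI two0); apply: (eq_by_sub h); ring.
  have := sl2_det g; rewrite (z0 _ h1) (z0 _ h4) -[e12 g]opprK (z0 _ h2) mul0r oppr0
    mul0r subrr.
  by move/esym/eqP; rewrite (negPf (oner_neq0 L)).
by rewrite cards0 subn0 mul2n addnn.
Qed.

Lemma card_plane : #|perp_eigenplane_set B v| = (#|F| ^ 3 + #|F|)%N.
Proof.
have N2 : sl2N1 L != 1%g := sl2N1_neq1 two0.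
have rN : rho (sl2N1 L) = 1%g.
  apply: GL_ext => x; apply: phi_inj; rewrite rhoE phi_act mulmx1.
  by apply: m2_ext; rewrite /= !(rmorphN, rmorph0, rmorph1); ring.
have NZ : sl2N1 L \in pm1 L by rewrite !inE eqxx orbT.
have eA : perp_eigenplane_set B v = [set rho g | g in [set g | twisted cj g]].
  apply/setP => T; apply/idP/imsetP => [hT|[g + ->]]; last by rewrite inE planeE.
  have [g e] : exists g, T = rho g by apply: Omega_sub_rho; case/setIdP: hT.
  by exists g; rewrite // inE -planeE -e.
apply/eqP; rewrite -(eqn_pmul2l (isT : 0 < 2)%N) -card_twisted eA; apply/eqP/esym.
rewrite -[LHS]sum1_card (partition_big_imset rho) /= mulnC -sum_nat_const.
apply: eq_bigr => T /imsetP[g + ->]; rewrite inE => tg.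
rewrite -[RHS](card_pm1 two0) -(card_lcoset (pm1 L) g) -sum1_card; apply: eq_bigl => h.
rewrite inE mem_lcoset; apply/andP/idP => [[_ /eqP e]|hZ].
  by have := rho_eq e; rewrite -(memJ_conjg _ g) pm1J conjgE mulgKV.
have e : rho h = rho g.
  rewrite -[h](mulKVg g); move: hZ; rewrite !inE => /orP[]/eqP->; first by rewrite mulg1.
  by rewrite rhoM rN mulg1.
by rewrite e eqxx -planeE e planeE.
Qed.

End Model.

(** * Normal form of the orthogonal space *)

Section NormalForm.
Variables (F : finFieldType) (B : 'M[F]_4) (v : 'rV[F]_4).
Hypothesis two0F : 2%:R != 0 :> F.
Hypotheses (B_sym : B \is symmetricmx) (B_nondeg : rad idfun B = 0).
Hypothesis witt : witt_index B = 1%N.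
Local Notation "''[' u , v ]" := (form idfun B u v) : ring_scope.
Hypothesis v0 : '[v, v] != 0.

Lemma gramE x y : '[x, y] = (x *m B *m y^T) 0 0.
Proof. by rewrite /form map_mx_id. Qed.

Lemma gram_sym x y : '[x, y] = '[y, x].
Proof.
have e : B = B^T.
  by move: B_sym; rewrite qualifE /= expr0 scale1r map_mx_id // => /eqP.
rewrite !gramE; transitivity ((x *m B *m y^T)^T 0 0); first by rewrite [RHS]mxE.
by rewrite !trmx_mul trmxK -e mulmxA.
Qed.

Lemma exists_orthogonal a b c : exists2 x, x != 0 & [/\ '[x, a] = 0, '[x, b] = 0 & '[x,
  c] = 0].
Proof.
pose M := col_mx a (col_mx b c).
have : kermx (B *m M^T) != 0.
  rewrite -mxrank_eq0 mxrank_ker -lt0n subn_gt0.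
  by apply: leq_ltn_trans (rank_leq_col _) _.
case/rowV0Pn=> x /sub_kermxP h x0; exists x => //.
move: h; rewrite /M !tr_col_mx !mul_mx_row -[0]row_mx0 => /eq_row_mx[h1].
rewrite -[0]row_mx0 => /eq_row_mx[h2 h3].
by rewrite !gramE -!mulmxA h1 h2 h3 !mxE.
Qed.

(** The vector f separates e from w. *)
Lemma no_isotropic_plane e w f : e != 0 -> w != 0 -> '[e, e] = 0 -> '[w, w] = 0 ->
  '[e, w] = 0 -> '[e, f] != 0 -> '[w, f] = 0 -> False.
Proof.
move=> e0 w0 ee ww ew ef wf.
have cap : (e :&: w)%MS = 0.
  apply/eqP/rowV0P => x; rewrite sub_capmx => /andP[/sub_rVP[a ->] /sub_rVP[b h]].
  have : a * '[e, f] == 0 by rewrite -formZl h formZl wf mulr0.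
  by rewrite mulf_eq0 (negPf ef) orbF => /eqP->; rewrite scale0r.
have r2 : \rank (e + w)%MS = 2%N.
  by have := mxrank_sum_cap e w; rewrite cap mxrank0 addn0 !rank_rV e0 w0.
have : (\rank (e + w)%MS <= witt_index B)%N; last by rewrite r2 witt.
apply: (leq_bigmax_cond (F := fun W : 'M[F]_4 => \rank W)).
have ort x y : (x <= e + w)%MS -> (y <= e + w)%MS -> '[x, y] = 0.
  case/sub_addsmxP=> [[a b] /= ->] /sub_addsmxP[[a' b'] /= ->].
  have s (c : 'M[F]_1) (z : 'rV[F]_4) : c *m z = c 0 0 *: z.
    by rewrite {1}[c]mx11_scalar mul_scalar_mx.
  rewrite !s.
  by rewrite !formDl !formDr !formZl !formZr ee ww (gram_sym w e) ew !(mulr0, addr0).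
apply/rV_subP => x xW; apply/sub_kermxP; rewrite map_mx_id // mulmxA.
apply/matrixP => a j; rewrite [RHS]mxE.
rewrite -(ort x (row j (e + w)%MS) xW (row_sub _ _)).
by rewrite !ord1 gramE !mxE; apply: eq_bigr => k _; rewrite !mxE.
Qed.

(** An orthogonal basis of the complement of v reduces this to [conic]. *)
Lemma exists_isotropic_perp : exists e, [/\ e != 0, '[e, v] = 0 & '[e, e] = 0].
Proof.
have [w1 w10 [h1 _ _]] := exists_orthogonal v v v.
have [i1|n1] := eqVneq '[w1, w1] 0; first by exists w1.
have [w2 w20 [h2 h21 _]] := exists_orthogonal v w1 w1.
have [i2|n2] := eqVneq '[w2, w2] 0; first by exists w2.
have [w3 w30 [h3 h31 h32]] := exists_orthogonal v w1 w2.
have [i3|n3] := eqVneq '[w3, w3] 0; first by exists w3.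
have [x [y hxy]] := conic (- '[w3, w3]) n1 n2.
pose e := x *: w1 + y *: w2 + w3.
have ew3 : '[e, w3] = '[w3, w3].
  by rewrite !formDl !formZl (gram_sym w1) (gram_sym w2) h31 h32 !mulr0 !add0r.
exists e; split.
- by apply: contraNneq n3 => e0; rewrite -ew3 e0 form0l.
- by rewrite !formDl !formZl h1 h2 h3 !mulr0 !addr0.
rewrite {1}/e !formDl !formZl /e !formDr !formZr (gram_sym w1 w2) (gram_sym w1 w3)
  (gram_sym w2 w3).
rewrite h21 h31 h32 !(mulr0, addr0, add0r).
by apply: (eq_by_sub hxy); rewrite /=; ring.
Qed.

Lemma exists_not_orthogonal e : e != 0 -> exists f, '[e, f] != 0.
Proof.
move=> e0.
have : e *m B != 0.
  apply: contra e0 => /eqP h; have : (e <= kermx B)%MS by apply/sub_kermxP.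
  by rewrite -(rad_ker idfun) B_nondeg submx0.
case/rV0Pn => j hj; exists (delta_mx 0 j); rewrite gramE trmx_delta -colE mxE //.
Qed.

(** A hyperbolic pair orthogonal to v is completed by u. If d = - (u,u) / (v,v)
    were a square or 0, the span of u and v would contain an isotropic vector, and
    together with e an isotropic plane. *)
Lemma normal_form : exists (Pm : 'M[F]_4) (ka d : F),
  [/\ Pm \in unitmx, ka != 0, forall x, x ^+ 2 != d,
   forall x y, '[x, y] = ka * (co Pm i0 x * co Pm i0 y
   - d * co Pm i1 x * co Pm i1 y
   - d / 2%:R * (co Pm i2 x * co Pm i3 y + co Pm i3 x * co Pm i2 y))
  & v = row i0 Pm].
Proof.
have [e [e0 ev ee]] := exists_isotropic_perp.
have [f0 ef0] := exists_not_orthogonal e0.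
pose f1 := f0 - ('[f0, v] / '[v, v]) *: v.
have f1v : '[f1, v] = 0 by rewrite /f1 -scaleNr formDl formZl mulNr divfK ?subrr.
have ef1 : '[e, f1] != 0.
  by rewrite /f1 -scaleNr formDr formZr ev mulr0 addr0.
clearbody f1.
pose f2 := f1 - ('[f1, f1] / (2%:R * '[e, f1])) *: e.
have f2v : '[f2, v] = 0 by rewrite /f2 -scaleNr formDl formZl ev mulr0 addr0.
have ef2 : '[e, f2] = '[e, f1] by rewrite /f2 -scaleNr formDr formZr ee mulr0 addr0.
have ff2 : '[f2, f2] = 0.
  rewrite /f2 -scaleNr !formDl !formDr !formZl !formZr ee (gram_sym f1 e) /=.
  by field; rewrite ef1 two0F.
clearbody f2.
have [u u0 [uv ue uf2]] := exists_orthogonal v e f2.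
have [mu0|mu0] := eqVneq '[u, u] 0.
  by case: (no_isotropic_plane e0 u0 ee mu0 _ _ uf2); rewrite ?ef2 // (gram_sym e).
pose ka := '[v, v]; pose d := - '[u, u] / ka.
have d0 : d != 0 by rewrite mulf_neq0 ?invr_neq0 // oppr_eq0.
have dns x : x ^+ 2 != d.
  apply/eqP => xd.
  have x0 : x != 0 by apply: contraNneq d0 => h; rewrite -xd h expr0n.
  have w0 : u + x *: v != 0.
    apply: contraNneq x0 => h.
    have : '[u + x *: v, v] == 0 by rewrite h form0l.
    by rewrite formDl formZl uv add0r mulf_eq0 (negPf v0) orbF.
  apply: (no_isotropic_plane e0 w0 ee _ _ (f := f2)).
  - rewrite !formDl !formDr !formZl !formZr uv (gram_sym v u) uv /= !mulr0 addr0 add0r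
      mulrA -expr2 xd.
    by rewrite /d divfK // addrN.
  - by rewrite formDr formZr (gram_sym e u) ue ev /= mulr0 addr0.
  - by rewrite ef2.
  by rewrite formDl formZl uf2 (gram_sym v) f2v mulr0 addr0.
pose c := '[u, u] / (2%:R * '[e, f2]).
have c0 : c != 0 by rewrite mulf_neq0 // invr_neq0 // mulf_neq0 // ef2.
pose f := c *: f2.
have ef : '[e, f] = '[u, u] / 2%:R.
  by rewrite formZr /c /= ef2; field; rewrite ef1 two0F.
have fv : '[f, v] = 0 by rewrite formZl f2v mulr0.
have ff : '[f, f] = 0 by rewrite formZl formZr ff2 !mulr0.
have uf : '[u, f] = 0 by rewrite formZr uf2 mulr0.
clearbody f.
pose Pm : 'M[F]_4 := \matrix_i [:: v; u; e; f]`_i.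
have rPm (i : 'I_4) : row i Pm = [:: v; u; e; f]`_i by rewrite rowK.
have dec (X : 'rV[F]_4) : X *m Pm = X 0 i0 *: v + X 0 i1 *: u + X 0 i2 *: e + X 0 i3 *: f.
  rewrite mulmx_sum_row !big_ord_recl big_ord0 addr0 !rPm /= !addrA.
  by congr (_ *: _ + _ *: _ + _ *: _ + _ *: _); congr (X _ _); apply: val_inj.
have gram (X Y : 'rV[F]_4) : '[X *m Pm, Y *m Pm] = ka * (X 0 i0 * Y 0 i0
   - d * X 0 i1 * Y 0 i1 - d / 2%:R * (X 0 i2 * Y 0 i3 + X 0 i3 * Y 0 i2)).
  rewrite !dec !formDl !formDr !formZl !formZr /=.
  rewrite (gram_sym v u) (gram_sym v e) (gram_sym v f) (gram_sym e u) (gram_sym f u)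
    (gram_sym f e).
  rewrite uv ev fv ue uf ee ff ef /d -/ka; field.
  by rewrite two0F v0.
have Pu : Pm \in unitmx.
  rewrite -row_free_unit -kermx_eq0; apply/rowV0P => X /sub_kermxP h.
  have g Y : '[X *m Pm, Y *m Pm] = 0 by rewrite h form0l.
  pose D i : 'rV[F]_4 := delta_mx 0 i.
  have ka0 : ka != 0 := v0.
  have X0 : X 0 i0 = 0.
    apply: (mulfI ka0); rewrite mulr0 -(g (D i0)) gram !mxE /=; ring.
  have X1 : X 0 i1 = 0.
    apply: (mulfI (mulf_neq0 ka0 d0)); rewrite mulr0; apply/eqP; rewrite -oppr_eq0 -(g (D
      i1)) gram !mxE /=; apply/eqP; ring.
  have kd : ka * (d / 2%:R) != 0 := mulf_neq0 ka0 (mulf_neq0 d0 (invr_neq0 two0F)).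
  have X2 : X 0 i2 = 0.
    apply: (mulfI kd); rewrite mulr0; apply/eqP; rewrite -oppr_eq0 -(g (D i3)) gram !mxE
      /=; apply/eqP; ring.
  have X3 : X 0 i3 = 0.
    apply: (mulfI kd); rewrite mulr0; apply/eqP; rewrite -oppr_eq0 -(g (D i2)) gram !mxE
      /=; apply/eqP; ring.
  apply/rowP => -[[|[|[|[|//]]]] p]; rewrite [RHS]mxE.
  - by rewrite -[RHS]X0; congr (X _ _); apply: val_inj.
  - by rewrite -[RHS]X1; congr (X _ _); apply: val_inj.
  - by rewrite -[RHS]X2; congr (X _ _); apply: val_inj.
  by rewrite -[RHS]X3; congr (X _ _); apply: val_inj.
exists Pm, ka, d; split; rewrite ?rowK //.
by move=> x y; rewrite -gram !mulmxKV.
Qed.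
End NormalForm.

Theorem theorem2 (F : finFieldType) (B : 'M[F]_4) (v : 'rV[F]_4)
    (q_odd : odd #|F|) (q_gt3 : (3 < #|F|)%N)
    (B_sym : B \is symmetricmx) (B_nondeg : rad idfun B = 0)
    (B_minus : witt_index B = 1%N)
    (v_nonisotropic : form idfun B v v <> 0) :
  maximal_coclique (Omega_group B) (perp_eigenplane_set B v) /\
  #|perp_eigenplane_set B v| = (#|F| ^ 3 + #|F|)%N.
Proof.
have [p p_pr pF] := finPcharP F.
have [k qk] := p_natP (pprimeChar_pgroup pF); rewrite cardsT in qk.
have p_odd : odd p.
  by move: q_odd; rewrite qk oddX => /orP[/eqP k0|//]; move: q_gt3; rewrite qk k0.
have two0F : 2%:R != 0 :> F by apply: two_neq0 pF p_odd.
have [Pm [ka [d [Pu ka0 dns gram vP]]]] :=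
  normal_form two0F B_sym B_nondeg B_minus (introN eqP v_nonisotropic).
pose L : finFieldType := quad dns.
pose inj : {rmorphism F -> L} := quad_in dns.
pose cj : {rmorphism L -> L} := @quad_cj _ _ dns.
pose eps : L := quad_eps dns.
have eps0 : eps != 0 by apply/eqP => /(congr1 snd)/eqP; rewrite oner_eq0.
have two0 : 2%:R != 0 :> L by rewrite -(rmorph_nat inj) fmorph_eq0.
have cv : phi inj eps Pm v = one2 L.
  have h i : co Pm i v = (i == i0)%:R.
    by rewrite /co vP rowE mulmxK // mxE eqxx.
  rewrite /phi !h /= !(rmorph0, rmorph1); apply: m2_ext => /=; ring.
have cardL : #|L| = (#|F| ^ 2)%N := card_quad dns.
have ci a : cj (inj a) = inj a := quad_cj_in dns a.
have ce : cj eps = - eps := quad_cj_eps dns.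
have es : eps ^+ 2 = inj d := quad_eps_sqr dns.
have dc (x : L) : x = inj x.1 + eps * inj x.2 := @quad_decomp F d dns x.
split; last first.
  exact: (card_plane ci ce es dc two0 eps0 Pu ka0 gram B_minus cv cardL).
apply: (plane_maximal ci ce es dc two0 eps0 Pu ka0 gram B_minus cv) => g.
apply: (@generation L cj p k _ p_odd _ _ _ eps eps0 ce).
- by rewrite (fmorph_pchar inj).
- by rewrite cardL qk.
- rewrite -qk -(card_imset predT (fmorph_inj inj)); apply: eq_card => x.
  rewrite inE; apply/eqP/imsetP => [h|[a _ ->]]; last exact: ci.
  by exists x.1 => //; apply: (cj_fix ci ce dc two0 h).
- by rewrite -qk.
Qed.
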